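(* Let $G$ be a Banach--Lie group and $(\mathcal A,G,\alpha)$ a $C^*$-dynamical system with a unital $C^*$-algebra $\mathcal A$. Then the space $\mathcal A^\infty$ of smooth vectors is a subalgebra of $\mathcal A$, it is a topological algebra with respect to its natural topology, and the action of $G$ on the Fréchet space $\mathcal A^\infty$ is smooth. Moreover, $\mathcal A^\infty$ is a continuous inverse algebra.
   Context: Calculus: for locally convex spaces $E,F$ and $U\subseteq E$ open, a map $f:U\to F$ is smooth if it is continuous, all iterated directional derivatives $\mathrm{d}^jf(x)(h_1,\dots,h_j)$ exist and all maps $\mathrm{d}^jf:U\times E^j\to F$ are continuous. A Banach--Lie group is a Lie group modeled on a Banach space; $\mathfrak g$ denotes its Lie algebra and $\exp_G$ its exponential function. A $C^*$-dynamical system is a triple $(\mathcal A,G,\alpha)$, where $\mathcal A$ is a $C^*$-algebra, $G$ a topological group, and $\alpha:G\to\mathrm{Aut}(\mathcal A)$, $g\mapsto\alpha_g$, is a homomorphism into the group of ($*$-)automorphisms defining a continuous action $G\times\mathcal A\to\mathcal A$. An element $a\in\mathcal A$ is a smooth vector if $G\to\mathcal A$, $g\mapsto\alpha_g(a)$, is smooth; $\mathcal A^\infty$ is the space of smooth vectors, on which $G$ acts by restriction of $\alpha$. For $x\in\mathfrak g$ and $a\in\mathcal A^\infty$ put $\mathrm{d}\pi(x)a:=\frac{d}{dt}\big|_{t=0}\alpha_{\exp_G(tx)}(a)\in\mathcal A^\infty$. Natural topology on $\mathcal A^\infty$: fix a norm on $\mathfrak g$ defining its topology with $\|[x,y]\|\le\|x\|\,\|y\|$;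 the topology is the locally convex topology defined by the seminorms $p_n(a):=\sup\{\|\mathrm{d}\pi(x_1)\cdots\mathrm{d}\pi(x_n)a\|: x_i\in\mathfrak g,\|x_i\|\le1\}$, $n\in\mathbb{N}_0$. ''Topological algebra'' here means that the product and the involution of $\mathcal A^\infty$ are continuous. A locally convex unital algebra $\mathcal B$ is a continuous inverse algebra if its group of units $\mathcal B^\times$ is open in $\mathcal B$ and the inversion $\mathcal B^\times\to\mathcal B$, $a\mapsto a^{-1}$, is continuous. *)

(* Defs.v *)
From HB Require Import structures.
From mathcomp Require Import all_boot all_order all_algebra.
From mathcomp Require Import complex.
From mathcomp Require Import all_classical all_reals all_analysis.

Set Implicit Arguments.
Unset Strict Implicit.
Unset Printing Implicit Defensive.

Import Order.TTheory GRing.Theory Num.Theory.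
Import numFieldNormedType.Exports.

Local Open Scope classical_set_scope.
Local Open Scope ring_scope.
Local Open Scope complex_scope.

(* Restriction of scalars: a complex locally convex space seen as a real one. *)
Definition realified (R : realType) (V : Type) : Type := V.

Section RealifiedLmodule.
Context (R : realType) (V : lmodType R[i]).

HB.instance Definition _ := GRing.Zmodule.on (realified R V).

Definition real_scale (r : R) (v : realified R V) : realified R V :=
  r%:C *: (v : V).

Fact real_scaleA r s v : real_scale r (real_scale s v) = real_scale (r * s) v.
Proof. by rewrite /real_scale scalerA rmorphM. Qed.

Fact real_scale1 : left_id 1 real_scale.
Proof. by move=> v; rewrite /real_scale rmorph1 scale1r. Qed.

Fact real_scaleDr : right_distributive real_scale +%R.
Proof. by move=> r u v; rewrite /real_scale scalerDr. Qed.

Fact real_scaleDl v : {morph real_scale^~ v : r s / r + s}.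
Proof. by move=> r s; rewrite /real_scale rmorphD scalerDl. Qed.

HB.instance Definition _ := GRing.Zmodule_isLmodule.Build R (realified R V)
  real_scaleA real_scale1 real_scaleDr real_scaleDl.

End RealifiedLmodule.

Section RealifiedTvs.
Context (R : realType) (V : tvsType R[i]).

HB.instance Definition _ := Uniform.on (realified R V).
HB.instance Definition _ := TopologicalZmodule.on (realified R V).

Fact real_scale_continuous :
  continuous (fun z : R^o * realified R V => z.1 *: z.2).
Proof.
case=> r v U /= rvU.
have [[P Q] /= [Pr Qv] PQU] :=
  @scale_continuous R[i] V (r%:C : R[i]^o, v : V) U rvU.
exists ((fun s : R => s%:C) @^-1` P, Q); last first.
  by move=> [s w] /= [Ps Qw]; exact: (PQU (s%:C, w)).
split=> //=; have /nbhs_ballP[e /= e0 eP] := Pr.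
have e_real : e = (complex.Re e)%:C.
  by case: e e0 {eP} => a b; rewrite /= ltcE /= => /andP[/eqP-> _].
apply/nbhs_ballP; exists (complex.Re e) => /=.
  by rewrite -ltcR -e_real.
move=> s rs; apply: eP; rewrite -ball_normE /= -rmorphB normc_def /=.
rewrite expr0n addr0 sqrtr_sqr e_real ltcR; exact: rs.
Qed.

HB.instance Definition _ :=
  TopologicalZmodule_isTopologicalLmodule.Build R (realified R V)
    real_scale_continuous.

Fact real_locally_convex :
  exists2 B : set_system (realified R V),
    (forall b, b \in B -> convex_set b) & basis B.
Proof.
have [B Bconvex Bbasis] := @locally_convex R[i] V.
exists B => // b bB; apply/convex_setW => x y xb yb l l0 l1.
have l0' : 0 <= (l%:num)%:C :> R[i] by rewrite lecR.
have l1' : (l%:num)%:C <= 1 :> R[i] by rewrite lecR.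
have := Bconvex b bB x y (Itv01 l0' l1') xb yb.
by rewrite /conv /= /unstable.onem -(rmorph1 (real_complex R)) -rmorphB.
Qed.

HB.instance Definition _ :=
  Uniform_isTvs.Build R (realified R V) real_locally_convex.

End RealifiedTvs.

Section Calculus.
Context (R : realType) (E F : tvsType R).
Implicit Types (f : E -> F) (x h : E) (U : set E).

Definition is_dderive f x h (y : F) : Prop :=
  t^-1 *: (f (x + t *: h) - f x) @[t --> (0 : R)^'] --> y.

Definition dderivable f x h : Prop := exists y, is_dderive f x h y.

(* ['D_h f x] is only available for normed spaces. *)
Definition dderive f x h : F := xget 0 [set y | is_dderive f x h y].

(* [iter_dderive f [:: h1; ...; hj] x] is d^j f (x)(hj, ..., h1); all values at
   points of an open set [U] only depend on the restriction of [f] to [U]. *)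
Definition iter_dderive f (hs : seq E) : E -> F :=
  foldr (fun h g x => dderive g x h) f hs.

(* To be used for open [U] only. *)
Definition smooth_on U f : Prop :=
  [/\ {within U, continuous f},
      forall hs x h, U x -> dderivable (iter_dderive f hs) x h
    & forall j, {within U `*` setT,
        continuous (fun p : E * {ptws 'I_j -> E} =>
          iter_dderive f (codom p.2) p.1)}].

End Calculus.

(* [cfun] is meaningful on [cdom] only, and [cinv] on [cfun @` cdom] only. *)
Record chart (M E : Type) := Chart {
  cdom : set M;
  cfun : M -> E;
  cinv : E -> M }.

Definition crange (M E : Type) (c : chart M E) : set E := cfun c @` cdom c.

Definition prod_chart (M N E F : Type) (c : chart M E) (d : chart N F) :
    chart (M * N) (E * F) :=
  Chart (cdom c `*` cdom d) (fun p => (cfun c p.1, cfun d p.2))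
        (fun u => (cinv c u.1, cinv d u.2)).

Definition prod_atlas (M N E F : Type) (A : set (chart M E))
    (B : set (chart N F)) : set (chart (M * N) (E * F)) :=
  [set e | exists c d, [/\ A c, B d & e = prod_chart c d]].

Definition flat_atlas (E : Type) : set (chart E E) :=
  [set Chart setT id id].

Definition is_chart (M : topologicalType) (R : realType) (E : tvsType R)
    (c : chart M E) : Prop :=
  [/\ open (cdom c), open (crange c),
      {in cdom c, cancel (cfun c) (cinv c)},
      {within cdom c, continuous (cfun c)}
    & {within crange c, continuous (cinv c)}].

Definition is_smooth_atlas (M : topologicalType) (R : realType)
    (E : tvsType R) (A : set (chart M E)) : Prop :=
  [/\ forall c, A c -> is_chart c,
      forall p, exists2 c, A c & cdom c p
    & forall c d, A c -> A d ->
        smooth_on (crange c `&` cinv c @^-1` cdom d) (cfun d \o cinv c)].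

Definition smooth_map (M N : topologicalType) (R : realType) (E F : tvsType R)
    (A : set (chart M E)) (B : set (chart N F)) (f : M -> N) : Prop :=
  continuous f /\
  forall c d, A c -> B d ->
    smooth_on (crange c `&` (f \o cinv c) @^-1` cdom d)
              (cfun d \o f \o cinv c).

(* Continuity of the group operations is not part of this structure: for Lie
   groups it is contained in their smoothness. *)
#[short(type="preTopologicalGroupType")]
HB.structure Definition PreTopologicalGroup := {G of Group G & Topological G}.

Section LieGroup.
Context (R : realType) (E : completeNormedModType R).
Context (G : preTopologicalGroupType) (A : set (chart G E)).

Definition is_banach_lie_group : Prop :=
  [/\ hausdorff_space G,
      is_smooth_atlas A,
      smooth_map (prod_atlas A A) A (fun p : G * G => (p.1 * p.2)%g)
    & smooth_map A A (fun g : G => (g^-1)%g)].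

(* A chart [c] of the atlas around 1 identifies the Lie algebra T_1 G with the
   model space [E]. *)
Definition chart_at1 (c : chart G E) : Prop := A c /\ cdom c 1%g.

(* The left invariant vector field with value [x] at 1, read in the chart. *)
Definition left_invariant_field (c : chart G E) (x u : E) : E :=
  dderive (fun v => cfun c (cinv c u * cinv c v)%g) (cfun c 1%g) x.

(* The bracket of vector fields [X, Y] = dY(X) - dX(Y), taken at 1. *)
Definition lie_bracket (c : chart G E) (x y : E) : E :=
  dderive (left_invariant_field c y) (cfun c 1%g) x -
  dderive (left_invariant_field c x) (cfun c 1%g) y.

Definition is_exponential (c : chart G E) (expG : E -> G) : Prop :=
  forall x : E,
  [/\ forall s t : R,
        expG ((s + t) *: x) = (expG (s *: x) * expG (t *: x))%g,
      smooth_map (@flat_atlas R^o) A (fun t : R^o => expG (t *: x))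
    & is_dderive (fun t : R^o => cfun c (expG (t *: x))) 0 1 x].

Definition is_lie_norm (c : chart G E) (N : E -> R) : Prop :=
  [/\ [/\ forall x y, N (x + y) <= N x + N y,
          forall (r : R) x, N (r *: x) = `|r| * N x
        & forall x, N x = 0 -> x = 0],
      forall W : set E, nbhs 0 W <->
        exists2 e : R, 0 < e & [set x | N x < e] `<=` W
    & forall x y, N (lie_bracket c x y) <= N x * N y].

End LieGroup.

(* The product is part of this structure because Hierarchy-Builder does not allow
   a new join of ring structures with normed modules. The zero algebra, with
   1 = 0, is included. *)
HB.mixin Record isUnitalCstarAlgebra (R : realType) A
    of CompleteNormedModule R[i] A := {
  cmul : A -> A -> A;
  cone : A;
  star : A -> A;
  cmulA : associative cmul;
  cmul1a : left_id cone cmul;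
  cmula1 : right_id cone cmul;
  cmulDl : left_distributive cmul +%R;
  cmulDr : right_distributive cmul +%R;
  cmulZl : forall (k : R[i]) (a b : A), cmul (k *: a) b = k *: cmul a b;
  cmulZr : forall (k : R[i]) (a b : A), cmul a (k *: b) = k *: cmul a b;
  starK : involutive star;
  starD : {morph star : a b / a + b};
  starZ : forall (k : R[i]) (a : A), star (k *: a) = conjc k *: star a;
  starM : forall a b, star (cmul a b) = cmul (star b) (star a);
  cnormM : forall a b : A, `|cmul a b| <= `|a| * `|b|;
  cnorm_star : forall a : A, `|cmul (star a) a| = `|a| ^+ 2
}.

#[short(type="unitalCstarAlgType")]
HB.structure Definition UnitalCstarAlgebra (R : realType) :=
  {A of CompleteNormedModule R[i] A & isUnitalCstarAlgebra R A}.

Section DynamicalSystem.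
Context (R : realType) (E : completeNormedModType R).
Context (G : preTopologicalGroupType) (AG : set (chart G E)).
Context (A : unitalCstarAlgType R) (alpha : G -> A -> A).

Definition is_star_automorphism (f : A -> A) : Prop :=
  [/\ bijective f,
      forall (k : R[i]) a b, f (k *: a + b) = k *: f a + f b,
      forall a b, f (cmul a b) = cmul (f a) (f b)
    & forall a, f (star a) = star (f a)].

Definition is_cstar_dynamical_system : Prop :=
  [/\ forall g, is_star_automorphism (alpha g),
      forall g h a, alpha (g * h)%g a = alpha g (alpha h a)
    & continuous (fun p : G * A => alpha p.1 p.2)].

Definition smooth_vectors : set A :=
  [set a | smooth_map AG (@flat_atlas (realified R A)) (alpha^~ a)].

Definition dpi (expG : E -> G) (x : E) (a : A) : A :=
  dderive (fun t : R^o => alpha (expG (t *: x)) a : realified R A) 0 1.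

(* The complex-valued norm of [A] is real, hence the real part. *)
Definition smooth_seminorm (expG : E -> G) (N : E -> R) (n : nat) (a : A) :
    \bar R :=
  ereal_sup [set (complex.Re `|foldr (dpi expG) a xs|)%:E
             | xs in [set xs : seq E | size xs = n /\ all (fun x => N x <= 1) xs]].

Definition is_star_subalgebra (S : set A) : Prop :=
  [/\ S cone, forall (k : R[i]) a b, S a -> S b -> S (k *: a + b),
      forall a b, S a -> S b -> S (cmul a b)
    & forall a, S a -> S (star a)].

(* [iota] identifies the space [B] with the space of smooth vectors, endowed
   with its natural topology. *)
Definition is_smooth_vector_space (expG : E -> G) (N : E -> R)
    (B : tvsType R[i]) (iota : {linear B -> A}) : Prop :=
  [/\ injective iota, range iota = smooth_vectors
    & forall (b : B) (W : set B), nbhs b W <->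
        exists n (e : R), 0 < e /\
          forall b' : B,
            (forall k, (k <= n)%N ->
              (smooth_seminorm expG N k (iota (b' - b)%R) < e%:E)%E) -> W b'].

End DynamicalSystem.

(* Cauchy filters are those of the additive group: [tvsType] does not relate its
   uniform structure to the addition. *)
Definition is_frechet (K : numFieldType) (B : tvsType K) : Prop :=
  [/\ hausdorff_space B,
      exists U : nat -> set B, (forall n, nbhs 0 (U n)) /\
        forall W, nbhs 0 W -> exists n, U n `<=` W
    & forall F : set_system B, ProperFilter F ->
        (forall W, nbhs 0 W ->
          exists2 S, F S & forall b b', S b -> S b' -> W (b - b')) ->
        exists b : B, F --> b].

Definition is_continuous_inverse_algebra (B : topologicalType)
    (mulB : B -> B -> B) (oneB : B) : Prop :=
  let units := [set b | exists b', mulB b b' = oneB /\ mulB b' b = oneB] in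
  open units /\
  exists2 invB : B -> B,
    forall b, units b -> mulB b (invB b) = oneB /\ mulB (invB b) b = oneB
    & {within units, continuous invB}.

(* Main.v *)
(* If [a] is a smooth vector, the derivative of g |-> alpha_g(a) at g in the
   direction h is alpha_g(dpi(x) a), where x is the value at h of the left
   Maurer-Cartan form. Hence the higher derivatives of an orbit map are given by
   the jets (x_1, ..., x_n) |-> dpi(x_1) ... dpi(x_n) a, whose norms are the
   seminorms p_n, and smoothness can be read off these jets. By the Leibniz rule
   the product is continuous. The jets of a Cauchy filter converge uniformly on
   bounded sets, and by the mean value inequality their limits are again the jets
   of a smooth vector, whence completeness. Since
   dpi(x) alpha_g = alpha_g dpi(Ad(g^-1) x), the operators alpha_g are locally
   equicontinuous for each p_n, and the action is smooth because the directional
   derivatives of its orbit maps are obtained by applying it to the jets. Finally,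
   if a smooth vector is invertible in the C*-algebra, then
   dpi(x) a^-1 = - a^-1 (dpi(x) a) a^-1, so that a^-1 is smooth and p_n(a^-1) is
   bounded in terms of |a^-1| and p_k(a), k <= n; openness of the unit group and
   continuity of the inversion follow from those in the C*-algebra. *)

(* Directional derivatives on locally convex spaces come without linearity, chain rule or
   uniformity, and every derivative of an orbit map contains directions that vary with the point,
   namely values of the Maurer-Cartan form. Smoothness is therefore rephrased through families of
   maps with a topological parameter ([Ck]): differentiation turns the direction into a further
   parameter, and each closure property becomes an induction on the order over all parameter spaces.
   Directions that depend on the point are inserted by [Ck_subst].

   No integral occurs: each interchange of a limit with a derivative rests on a mean value
   inequality for seminorms, proved by compactness of the unit interval. For the space of smooth
   vectors it is applied to one component of the jet at a time, inside the C*-algebra, and the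
   resulting bounds are collected by the supremum that defines p_n.

   Vectors of the Lie algebra are elements of the model space, read in the fixed chart [c] around 1;
   orbits are differentiated at other points by translating the curve back to 1. *)
Require Import Defs.
From HB Require Import structures.
From mathcomp Require Import all_boot all_order all_algebra.
From mathcomp Require Import complex.
From mathcomp Require Import all_classical all_reals all_analysis.
From mathcomp Require Import ring lra.

Set Implicit Arguments.
Unset Strict Implicit.
Unset Printing Implicit Defensive.

Import Order.TTheory GRing.Theory Num.Theory.
Import numFieldNormedType.Exports.

Local Open Scope classical_set_scope.
Local Open Scope ring_scope.
Local Open Scope complex_scope.

(* A reflexive decision procedure for linear identities in modules, which
   [ring] does not cover. *)
Section ModuleIdentities.
Context (K : comPzRingType) (V : lmodType K).

Inductive mod_expr : Type :=
| ModVar of nat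
| ModZero
| ModAdd of mod_expr & mod_expr
| ModOpp of mod_expr
| ModScale of K & mod_expr.

Fixpoint mod_eval (env : seq V) (e : mod_expr) : V :=
  match e with
  | ModVar i => nth 0 env i
  | ModZero => 0
  | ModAdd a b => mod_eval env a + mod_eval env b
  | ModOpp a => - mod_eval env a
  | ModScale k a => k *: mod_eval env a
  end.

Fixpoint mod_coef (i : nat) (e : mod_expr) : K :=
  match e with
  | ModVar j => if i == j then 1 else 0
  | ModZero => 0
  | ModAdd a b => mod_coef i a + mod_coef i b
  | ModOpp a => - mod_coef i a
  | ModScale k a => k * mod_coef i a
  end.

(** A conjunction over the variables, so that [repeat split] leaves [ring] one scalar identity per
    variable. *)
Fixpoint mod_coef_eq (n : nat) (e1 e2 : mod_expr) : Prop :=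
  if n is m.+1 then mod_coef m e1 = mod_coef m e2 /\ mod_coef_eq m e1 e2
  else True.

Lemma mod_eval_sum env e :
  mod_eval env e = \sum_(i < size env) mod_coef i e *: nth 0 env i.
Proof.
elim: e => /= [j||a -> b ->|a ->|k a ->].
- have [jn|jn] := ltnP j (size env).
    rewrite (bigD1 (Ordinal jn)) //= eqxx scale1r big1 ?addr0 // => i.
    by rewrite -val_eqE /= => /negPf->; rewrite scale0r.
  rewrite nth_default // big1 // => i _.
  by rewrite (ltn_eqF (leq_trans (ltn_ord i) jn)) scale0r.
- by rewrite big1 // => i _; rewrite scale0r.
- by rewrite -big_split; apply: eq_bigr => i _; rewrite scalerDl.
- by rewrite -sumrN; apply: eq_bigr => i _; rewrite scaleNr.
- by rewrite scaler_sumr; apply: eq_bigr => i _; rewrite scalerA.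
Qed.

Lemma mod_eval_eq env e1 e2 :
  mod_coef_eq (size env) e1 e2 -> mod_eval env e1 = mod_eval env e2.
Proof.
rewrite !mod_eval_sum => e12; apply: eq_bigr => -[i /= ilt] _; congr (_ *: _).
elim: (size env) ilt e12 => // n IHn; rewrite ltnS leq_eqVlt => /orP[/eqP->|ni] [] //.
by move=> _; exact: IHn.
Qed.

End ModuleIdentities.

(* Atoms are compared up to unification, since the same operation may occur
   through different structures. *)
Ltac mod_index x env :=
  match env with
  | ?y :: _ => let _ := match O with _ => unify x y end in constr:(0%N)
  | _ :: ?s => let n := mod_index x s in constr:(S n)
  end.

Ltac mod_atoms env t :=
  lazymatch t with
  | 0%R => env
  | (?a + ?b)%R => let env := mod_atoms env a in mod_atoms env b
  | (- ?a)%R => mod_atoms env a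
  | (_ *: ?a)%R => mod_atoms env a
  | _ => match env with
         | _ => let n := mod_index t env in env
         | _ => constr:(t :: env)
         end
  end.

Ltac mod_reify K env t :=
  lazymatch t with
  | 0%R => constr:(@ModZero K)
  | (?a + ?b)%R =>
      let a := mod_reify K env a in let b := mod_reify K env b in
      constr:(@ModAdd K a b)
  | (- ?a)%R => let a := mod_reify K env a in constr:(@ModOpp K a)
  | (?k *: ?a)%R => let a := mod_reify K env a in constr:(@ModScale K k a)
  | _ => let n := mod_index t env in constr:(@ModVar K n)
  end.

Ltac mod_norm K V :=
  lazymatch goal with
  | |- ?l = ?r =>
      let env := mod_atoms (@nil V) l in
      let env := mod_atoms env r in
      let l' := mod_reify K env l in
      let r' := mod_reify K env r in
      refine (@mod_eval_eq K V env l' r' _); simpl; repeat split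
  end.

Ltac module K V := mod_norm K V; ring.

(** * Limits in products, continuous seminorms and directional derivatives *)

Section PairLimits.
Context (P Q S : topologicalType).

Lemma fst_continuous : continuous (@fst P Q).
Proof. by move=> z; exact: cvg_fst. Qed.

Lemma snd_continuous : continuous (@snd P Q).
Proof. by move=> z; exact: cvg_snd. Qed.

Lemma pair_continuous (f : S -> P) (g : S -> Q) :
  continuous f -> continuous g -> continuous (fun s => (f s, g s)).
Proof. by move=> f_cont g_cont s; exact: cvg_pair (f_cont s) (g_cont s). Qed.

Lemma cvg_comp2 T (Fi : set_system T) {FF : Filter Fi} (f : T -> P) (g : T -> Q)
    (b : P -> Q -> S) p q :
  f @ Fi --> p -> g @ Fi --> q -> b z.1 z.2 @[z --> (p, q)] --> b p q ->
  b (f t) (g t) @[t --> Fi] --> b p q.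
Proof.
move=> fp gq b_cont.
have fg : (f t, g t) @[t --> Fi] --> (p, q) by exact: cvg_pair fp gq.
exact: (cvg_comp _ (fun z => b z.1 z.2) fg b_cont).
Qed.

Lemma open_setX (A : set P) (B : set Q) : open A -> open B -> open (A `*` B).
Proof.
move=> Ao Bo; rewrite openE => -[p q] [/= Ap Bq].
by exists (A, B) => //; split; exact: open_nbhs_nbhs.
Qed.

End PairLimits.
Arguments fst_continuous {P Q} x.
Arguments snd_continuous {P Q} x.

Section Seminorms.
Context (R : realType) (F : tvsType R).

Definition continuous_seminorm (q : F -> R) : Prop :=
  [/\ forall x y, q (x + y) <= q x + q y,
      forall (r : R) x, q (r *: x) = `|r| * q x
    & forall e : R, 0 < e -> \forall x \near (0 : F), q x < e].

(** Local convexity in the form in which all estimates use it. The Hausdorff property is included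
    because it makes directional derivatives unique. *)
Definition seminormed_space : Prop :=
  hausdorff_space F /\
  forall W : set F, nbhs 0 W ->
    exists2 q, continuous_seminorm q & [set x | q x < 1] `<=` W.

Section Seminorm.
Context (q : F -> R) (qP : continuous_seminorm q).

Lemma csnD x y : q (x + y) <= q x + q y. Proof. by case: qP. Qed.

Lemma csnZ r x : q (r *: x) = `|r| * q x. Proof. by case: qP. Qed.

Lemma csn0 : q 0 = 0. Proof. by rewrite -(scale0r (0 : F)) csnZ normr0 mul0r. Qed.

Lemma csnN x : q (- x) = q x.
Proof. by rewrite -scaleN1r csnZ normrN1 mul1r. Qed.

Lemma csn_ge0 x : 0 <= q x.
Proof.
have := csnD x (- x); rewrite subrr csn0 csnN -mulr2n.
by rewrite pmulrn_lge0.
Qed.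

Lemma csn_sub x y : q x <= q (x - y) + q y.
Proof. by have := csnD (x - y) y; rewrite subrK. Qed.

Lemma csn_distC x y : q (x - y) = q (y - x).
Proof. by rewrite -csnN opprB. Qed.

Lemma csn_tri z x y : q (x - y) <= q (x - z) + q (z - y).
Proof. by rewrite -[x - y](subrKA z); exact: csnD. Qed.

Lemma csn_near e : 0 < e -> \forall x \near (0 : F), q x < e.
Proof. by case: qP => _ _; exact. Qed.

End Seminorm.

Lemma tvs_cvgD T (Fi : set_system T) {FF : Filter Fi} (f g : T -> F) a b :
  f @ Fi --> a -> g @ Fi --> b -> f x + g x @[x --> Fi] --> a + b.
Proof.
move=> fa gb; apply: (@cvg_comp _ _ _ (fun t => (f t, g t))
  (fun z : F * F => z.1 + z.2) Fi (nbhs (a, b))).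
  exact: (cvg_pair fa gb).
exact: (@add_continuous F (a, b)).
Qed.

Lemma tvs_cvgZ T (Fi : set_system T) {FF : Filter Fi} (k : T -> R) (g : T -> F) a b :
  k @ Fi --> (a : R) -> g @ Fi --> b -> k x *: g x @[x --> Fi] --> a *: b.
Proof.
move=> fa gb; apply: (@cvg_comp _ _ _ (fun t => (k t : R^o, g t))
  (fun z : R^o * F => z.1 *: z.2) Fi (nbhs ((a : R^o), b))).
  exact: (cvg_pair fa gb).
exact: (@scale_continuous R F (a, b)).
Qed.

Lemma tvs_cvgB T (Fi : set_system T) {FF : Filter Fi} (f g : T -> F) a b :
  f @ Fi --> a -> g @ Fi --> b -> f x - g x @[x --> Fi] --> a - b.
Proof.
move=> fa gb; apply: (@cvg_comp _ _ _ (fun t => (f t, g t))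
  (fun z : F * F => z.1 - z.2) Fi (nbhs (a, b))).
  exact: (cvg_pair fa gb).
exact: (@sub_continuous F (a, b)).
Qed.

Lemma cvg_csn T (Fi : set_system T) {FF : Filter Fi} (f : T -> F) y q e :
  f @ Fi --> y -> continuous_seminorm q -> 0 < e ->
  \forall t \near Fi, q (f t - y) < e.
Proof.
move=> fy qP e0.
have fy0 : f t - y @[t --> Fi] --> (0 : F).
  by rewrite -(subrr y); apply: tvs_cvgB fy _; exact: cvg_cst.
exact: (fy0 _ (csn_near qP e0)).
Qed.

Lemma csn_cvg T (Fi : set_system T) {FF : Filter Fi} (f : T -> F) y :
  seminormed_space ->
  (forall q (e : R), continuous_seminorm q -> 0 < e -> \forall t \near Fi, q (f t - y) < e) ->
  f @ Fi --> y.
Proof.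
move=> [_ lcF] fy.
rewrite (_ : f = (fun t => (f t - y) + y)); last first.
  by apply/funext => t; rewrite subrK.
rewrite -[X in _ --> X]add0r; apply: tvs_cvgD; last exact: cvg_cst.
move=> W /lcF[q qP qW]; apply: filterS (fy q 1 qP ltr01) => t; exact: qW.
Qed.

End Seminorms.

Section DirectionalDerivative.
Context (R : realType) (E F : tvsType R).
Implicit Types (f g : E -> F).
Hypothesis F_lc : seminormed_space F.

Lemma is_dderive_unique f x h y z :
  is_dderive f x h y -> is_dderive f x h z -> y = z.
Proof. by case: F_lc => hF _; apply: (cvg_unique hF). Qed.

Lemma dderive_eq f x h y : is_dderive f x h y -> dderive f x h = y.
Proof.
move=> fy; apply: (@is_dderive_unique f x h) => //.
by rewrite /dderive; case: xgetP => [z -> //|/(_ y)].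
Qed.

Lemma dderivableP f x h : dderivable f x h -> is_dderive f x h (dderive f x h).
Proof. by case=> y fy; rewrite (dderive_eq fy). Qed.

(* A quotient-free form of the definition, in which [t = 0] need not be excluded. *)
Lemma is_dderiveP f x h y : is_dderive f x h y <->
  forall q (e : R), continuous_seminorm q -> 0 < e ->
    \forall t \near (0 : R), q (f (x + t *: h) - f x - t *: y) <= e * `|t|.
Proof.
split=> [fy q e qP e0|fy].
  have : \forall t \near (0 : R)^', q (t^-1 *: (f (x + t *: h) - f x) - y) < e.
    exact: cvg_csn fy qP e0.
  rewrite near_withinE; apply: filterS => t tP.
  have [->|t0] := eqVneq t 0.
    by rewrite !scale0r addr0 !subrr (csn0 qP) normr0 mulr0.
  have tn0 : 0 < `|t| by rewrite normr_gt0.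
  have := ltW (tP t0); rewrite -(ler_pM2r tn0) mulrC -(csnZ qP).
  by rewrite scalerBr scalerA divff // scale1r.
apply: (csn_cvg F_lc) => q e qP e0.
have e20 : 0 < e / 2 by rewrite divr_gt0.
rewrite near_withinE. apply: filterS (fy q _ qP e20) => t tP t0.
have tn0 : 0 < `|t| by rewrite normr_gt0.
rewrite -(ltr_pM2r tn0) mulrC -(csnZ qP) scalerBr scalerA divff // scale1r.
apply: le_lt_trans tP _; rewrite ltr_pM2r //.
by rewrite ltr_pdivrMr // ltr_pMr // ltr1n.
Qed.

End DirectionalDerivative.

(** * The mean value inequality *)

(** Compactness of the unit interval as an induction principle: the supremum of the points reachable
    from 0 is itself reachable, and if it were less than 1 one could go beyond it. *)
Lemma cousin (R : realType) (P : R -> R -> Prop) :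
  (forall s : R, 0 <= s <= 1 -> exists2 d : R, 0 < d &
     forall a b, a <= s <= b -> s - d < a -> b < s + d -> P a b) ->
  (forall a b c : R, P a b -> P b c -> P a c) -> P 0 1.
Proof.
move=> Ploc Ptrans.
pose T := [set x : R | 0 <= x <= 1 /\ P 0 x].
have T0 : T 0.
  split; first by rewrite lexx ler01.
  have [|d d0 Pd] := Ploc 0; first by rewrite lexx ler01.
  by apply: Pd; rewrite ?lexx ?add0r // oppr_lt0.
have T_ub : ubound T 1 by move=> x [/andP[]].
have T_sup : has_sup T by split; [exists 0|exists 1].
pose s := sup T.
have s0 : 0 <= s by exact: sup_upper_bound.
have s1 : s <= 1 by apply: ge_sup => //; exists 0.
have [|d d0 Pd] := Ploc s; first by rewrite s0 s1.
have [x [/andP[x0 x1] Px] sx] := sup_adherent d0 T_sup.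
have xs : x <= s by apply: sup_upper_bound => //; split => //; rewrite x0 x1.
have P0s : P 0 s by apply: (Ptrans _ x) => //; apply: Pd; rewrite ?xs ?lexx ?ltrDl.
have [s_lt1|] := ltP s 1; last by move=> s_ge1; rewrite (_ : 1 = s) //; apply/le_anti/andP.
pose y := Num.min 1 (s + d / 2).
have d20 : 0 < d / 2 by rewrite divr_gt0.
have sy : s < y by rewrite /y lt_min s_lt1 ltrDl.
have : y <= s.
  apply: sup_upper_bound => //; split.
    by rewrite (le_trans s0 (ltW sy)) /y ge_min lexx.
  apply: (Ptrans _ s) => //; apply: Pd; rewrite ?lexx ?(ltW sy) ?ltrBlDr ?ltrDl //.
  by rewrite /y gt_min ltrD2l ltr_pdivrMr // ltr_pMr // ltr1n orbT.
by rewrite leNgt sy.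
Qed.

Lemma near0_mulr (R : realType) (P : R -> Prop) (t : R) :
  (\forall s \near (0 : R), P s) -> \forall s \near (0 : R), P (s * t).
Proof.
have : s * t @[s --> (0 : R)] --> 0 * t by apply: cvgM; [exact: cvg_id|exact: cvg_cst].
by rewrite mul0r => /[apply].
Qed.

Section MeanValue.
Context (R : realType) (F : tvsType R) (q : F -> R).
Hypothesis qP : continuous_seminorm q.

(** The bound [(M + e) * (b - a)] on increments is additive under concatenation of intervals, and
    differentiability at [s] gives it on small intervals containing [s], split at [s]; [cousin]
    glues them, and [e] is arbitrary. *)
Lemma mean_value_le (f f' : R -> F) (M : R) :
  (forall s : R, 0 <= s <= 1 -> forall e : R, 0 < e ->
    \forall t \near (0 : R), q (f (s + t) - f s - t *: f' s) <= e * `|t|) ->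
  (forall s : R, 0 <= s <= 1 -> q (f' s) <= M) ->
  q (f 1 - f 0) <= M.
Proof.
move=> f_der f'M; apply/ler_addgt0Pr => e e0; rewrite -[leRHS]mulr1 -[X in _ * X](subr0 1).
apply: (@cousin _ (fun a b => q (f b - f a) <= (M + e) * (b - a))) => [s s01|a b c ab bc].
  have /nbhs_ballP[d /= d0 fd] := f_der s s01 e e0.
  have incr t : `|t| < d -> q (f (s + t) - f s) <= (M + e) * `|t|.
    move=> td; have := fd t; rewrite -ball_normE /= sub0r normrN => /(_ td) ft.
    apply: le_trans (csn_sub qP _ (t *: f' s)) _; rewrite addrC mulrDl lerD //.
    by rewrite (csnZ qP) mulrC ler_wpM2r // f'M.
  exists d => // a b /andP[as_ sb] sa bs.
  apply: le_trans (csn_tri qP (f s) _ _) _.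
  rewrite -[b - a](subrKA s) mulrDr lerD //.
    have := incr (b - s); rewrite subrKC ger0_norm ?subr_ge0 //; apply.
    by rewrite ltrBlDl.
  rewrite (csn_distC qP); have := incr (a - s); rewrite subrKC distrC.
  rewrite ger0_norm ?subr_ge0 //; apply.
  by rewrite ltrBlDl -ltrBlDr.
apply: le_trans (csn_tri qP (f b) _ _) _.
by rewrite -[c - a](subrKA b) mulrDr lerD.
Qed.

End MeanValue.

Section StrictDerivative.
Context (R : realType) (E F : tvsType R) (q : F -> R).
Hypothesis F_lc : seminormed_space F.
Hypothesis qP : continuous_seminorm q.

(** The linear term [t *: w] is absorbed into the curve, so that the mean value inequality bounds
    the remainder by the oscillation of the derivative around [w] on the segment. *)
Lemma dderive_mean (f : E -> F) (g : R -> F) (x v : E) (w : F) (t M : R) :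
  (forall s : R, 0 <= s <= 1 -> is_dderive f (x + (s * t) *: v) v (g s)) ->
  (forall s : R, 0 <= s <= 1 -> q (g s - w) <= M) ->
  q (f (x + t *: v) - f x - t *: w) <= `|t| * M.
Proof.
move=> f_der gM.
pose p s := f (x + (s * t) *: v) - (s * t) *: w.
have -> : f (x + t *: v) - f x - t *: w = p 1 - p 0.
  by rewrite /p mul1r mul0r !scale0r addr0 subr0 addrAC.
apply: (mean_value_le qP (f' := fun s => t *: (g s - w))) => [s s01 e e0|s s01]; last first.
  by rewrite (csnZ qP) ler_wpM2l // gM.
(* The summand 1 covers the case [t = 0]. *)
have e't0 : 0 < `|t| + 1 by rewrite ltr_wpDl.
have e'0 : 0 < e / (`|t| + 1) by rewrite divr_gt0.
have := near0_mulr t ((is_dderiveP F_lc _ _ _ _).1 (f_der s s01) q _ qP e'0).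
apply: filterS => r /le_trans; rewrite /p => H.
have -> : f (x + ((s + r) * t) *: v) - ((s + r) * t) *: w -
    (f (x + (s * t) *: v) - (s * t) *: w) - r *: (t *: (g s - w)) =
    f (x + (s * t) *: v + (r * t) *: v) - f (x + (s * t) *: v) - (r * t) *: g s.
  have -> : x + ((s + r) * t) *: v = x + (s * t) *: v + (r * t) *: v by module R E.
  by module R F.
apply: H; rewrite normrM mulrACA ler_piMr ?mulr_ge0 ?(ltW e0) //.
by rewrite mulrC ler_pdivrMr // mul1r lerDl.
Qed.

(** By continuity [df] stays close to [df x k] along short segments that start near [x] in
    directions near [k]. The estimate is uniform in base point and direction, which is what
    additivity of the derivative and the chain rule need, where both move with [t]. *)
Lemma strict_dderive (f : E -> F) (df : E -> E -> F) (U : set E) (x k : E) (e : R) :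
  open U -> U x ->
  (forall y h, U y -> is_dderive f y h (df y h)) ->
  {for (x, k), continuous (fun z : E * E => df z.1 z.2)} -> 0 < e ->
  \forall z \near ((0 : R), (x, k)),
    q (f (z.2.1 + z.1 *: z.2.2) - f z.2.1 - z.1 *: df x k) <= e * `|z.1|.
Proof.
move=> Uo Ux f_der df_cont e0.
have m_cvg : (z.2.1 + z.1 *: z.2.2, z.2.2) @[z --> ((0 : R), (x, k))] --> (x, k).
  have c2 : z.2 @[z --> ((0 : R), (x, k))] --> (x, k) by exact: cvg_snd.
  have c21 : z.2.1 @[z --> ((0 : R), (x, k))] --> x by exact: cvg_comp c2 cvg_fst.
  have c22 : z.2.2 @[z --> ((0 : R), (x, k))] --> k by exact: cvg_comp c2 cvg_snd.
  have c1 : z.2.1 + z.1 *: z.2.2 @[z --> ((0 : R), (x, k))] --> x + 0 *: k.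
    by apply: (tvs_cvgD c21); apply: (tvs_cvgZ _ c22); exact: cvg_fst.
  by move: c1; rewrite scale0r addr0 => c1; exact: cvg_pair c1 c22.
have near_xk : \forall y \near (x, k), U y.1 /\ q (df y.1 y.2 - df x k) < e.
  near=> y; split; near: y.
    by apply: (@cvg_fst _ _ (nbhs x) (nbhs k)); exact: open_nbhs_nbhs.
  exact: (cvg_csn df_cont qP e0).
have [[A B] /= [A0 Bxk] AB] := m_cvg _ near_xk.
have /nbhs_ballP[d /= d0 dA] := A0.
exists (ball 0 d, B); first by split; [exact: nbhsx_ballx|exact: Bxk].
move=> [t [y h]] /= [td Byh].
rewrite [leRHS]mulrC; apply: (dderive_mean (g := fun s => df (y + (s * t) *: h) h)).
all: move=> s /andP[s0 s1].
all: have [|Us qs] := AB (s * t, (y, h)); last by [exact: f_der|exact: ltW].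
all: split=> //=; apply: dA; move: td; rewrite -ball_normE /= !sub0r !normrN normrM.
all: by apply: le_lt_trans; rewrite ler_piMl // ger0_norm.
Unshelve. all: by end_near. Qed.

End StrictDerivative.

(** * Rules of differentiation and the chain rule *)

Section Derivation.
Context (R : realType).
Implicit Types (D E F H : tvsType R).

Lemma line_cvg E (x h : E) : x + t *: h @[t --> (0 : R)] --> x.
Proof.
have : x + t *: h @[t --> (0 : R)] --> x + 0 *: h.
  by apply: tvs_cvgD; [exact: cvg_cst|apply: tvs_cvgZ; [exact: cvg_id|exact: cvg_cst]].
by rewrite scale0r addr0.
Qed.
Arguments line_cvg {E} x h.

Lemma near_line E (U : set E) (x h : E) : open U -> U x ->
  \forall t \near (0 : R), U (x + t *: h).
Proof. by move=> Uo Ux; apply: line_cvg; exact: open_nbhs_nbhs. Qed.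

Lemma is_dderive_near E F (f g : E -> F) (U : set E) x h y :
  open U -> U x -> {in U, f =1 g} -> is_dderive f x h y -> is_dderive g x h y.
Proof.
move=> Uo Ux fg; apply: cvg_trans; apply: near_eq_cvg.
rewrite near_withinE; apply: filterS (near_line h Uo Ux) => t Ut _.
by rewrite !fg ?inE.
Qed.

Lemma is_dderive_ext E F (f g : E -> F) x h y :
  f =1 g -> is_dderive f x h y -> is_dderive g x h y.
Proof. by move=> /funext->. Qed.

Lemma is_dderive_eq_near E F (f g : E -> F) x h y :
  (\forall z \near x, f z = g z) -> is_dderive f x h y -> is_dderive g x h y.
Proof.
move=> fg; apply: cvg_trans; apply: near_eq_cvg.
have fgx : f x = g x by exact: (nbhs_singleton fg).
have fg_line : \forall t \near (0 : R), f (x + t *: h) = g (x + t *: h).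
  exact: line_cvg fg.
rewrite near_withinE; apply: filterS fg_line => t fgt _.
by rewrite fgx fgt.
Qed.

Lemma is_dderive_line E F (f : E -> F) x h y :
  is_dderive f x h y <-> is_dderive (fun t : R^o => f (x + t *: h)) 0 1 y.
Proof.
rewrite /is_dderive.
have -> // : (fun t : R => t^-1 *: (f (x + ((0 : R^o) + t *: 1) *: h) -
    f (x + (0 : R^o) *: h))) = fun t => t^-1 *: (f (x + t *: h) - f x).
by apply/funext => t; rewrite scale0r addr0 add0r [t *: (1 : R^o)]mulr1.
Qed.

Lemma dderivable_near E F (f g : E -> F) (U : set E) x h :
  open U -> U x -> {in U, f =1 g} -> dderivable f x h -> dderivable g x h.
Proof. by move=> Uo Ux fg [y fy]; exists y; exact: (is_dderive_near Uo Ux fg fy). Qed.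

Lemma dderive_near E F (f g : E -> F) (U : set E) x h :
  open U -> U x -> {in U, f =1 g} -> dderive f x h = dderive g x h.
Proof.
move=> Uo Ux fg; congr xget; apply/seteqP; split=> y fy;
  by apply: (is_dderive_near Uo Ux _ fy) => z zU; rewrite fg.
Qed.

Lemma is_dderive_cst E F (a : F) (x h : E) : is_dderive (fun=> a) x h 0.
Proof. by rewrite /is_dderive; under eq_fun do rewrite subrr scaler0; exact: cvg_cst. Qed.

Lemma is_dderiveD E F (f g : E -> F) x h y z :
  is_dderive f x h y -> is_dderive g x h z ->
  is_dderive (fun x => f x + g x) x h (y + z).
Proof.
move=> fy gz; rewrite /is_dderive.
under eq_fun do rewrite opprD addrACA scalerDr.
exact: tvs_cvgD fy gz.
Qed.

Section Linear.
Context (E F : lmodType R) (l : E -> F).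
Hypothesis l_lin : linear l.

Lemma lin0 : l 0 = 0.
Proof.
have /eqP := l_lin 1 0 0; rewrite scaler0 addr0 scale1r.
by rewrite -subr_eq0 opprD addrA subrr sub0r oppr_eq0 => /eqP.
Qed.

Lemma linD x y : l (x + y) = l x + l y.
Proof. by have := l_lin 1 x y; rewrite !scale1r. Qed.

Lemma linZ r x : l (r *: x) = r *: l x.
Proof. by have := l_lin r x 0; rewrite lin0 !addr0. Qed.

Lemma linN x : l (- x) = - l x.
Proof. by rewrite -scaleN1r linZ scaleN1r. Qed.

Lemma linB x y : l (x - y) = l x - l y.
Proof. by rewrite linD linN. Qed.

End Linear.

(* A linear map need not be continuous to be differentiable along lines. *)
Lemma is_dderive_lin E F (l : E -> F) x h : linear l -> is_dderive l x h (l h).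
Proof.
move=> l_lin; rewrite /is_dderive; apply: cvg_near_cst.
rewrite near_withinE; near=> t => t0.
by rewrite -(linB l_lin) addrC addKr (linZ l_lin) scalerA mulVf // scale1r.
Unshelve. all: by end_near. Qed.

Lemma is_dderive_postlin D E F (g : D -> E) (l : E -> F) x h y :
  linear l -> continuous l -> is_dderive g x h y -> is_dderive (l \o g) x h (l y).
Proof.
move=> l_lin l_cont gy; rewrite /is_dderive /=.
under eq_fun do rewrite -(linB l_lin) -(linZ l_lin).
exact: cvg_comp gy (l_cont y).
Qed.

Lemma is_dderive_cvg E F (f : E -> F) x h y :
  is_dderive f x h y -> f (x + t *: h) @[t --> (0 : R)^'] --> f x.
Proof.
move=> fy.
have t0 : t @[t --> (0 : R)^'] --> (0 : R) by exact: nbhs_dnbhs.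
have : t *: (t^-1 *: (f (x + t *: h) - f x)) + f x @[t --> (0 : R)^'] --> 0 *: y + f x.
  by apply: tvs_cvgD; [exact: tvs_cvgZ|exact: cvg_cst].
rewrite scale0r add0r; apply: cvg_trans; apply: near_eq_cvg.
rewrite near_withinE; near=> t => t_neq0.
by rewrite scalerA divff // scale1r subrK.
Unshelve. all: by end_near. Qed.

Lemma is_dderive_pair D E F (f : D -> E) (g : D -> F) x h y z :
  is_dderive f x h y -> is_dderive g x h z ->
  is_dderive (fun x => (f x, g x)) x h (y, z).
Proof. by move=> fy gz; exact: cvg_pair fy gz. Qed.

Lemma is_dderive_bilin D E F H (b : E -> F -> H) (f : D -> E) (g : D -> F) x h y z :
  (forall u, linear (b u)) -> (forall v, linear (b ^~ v)) ->
  continuous (fun w : E * F => b w.1 w.2) ->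
  is_dderive f x h y -> is_dderive g x h z ->
  is_dderive (fun x => b (f x) (g x)) x h (b y (g x) + b (f x) z).
Proof.
move=> b_linr b_linl b_cont fy gz; rewrite /is_dderive.
have -> : (fun t : R => t^-1 *: (b (f (x + t *: h)) (g (x + t *: h)) - b (f x) (g x))) =
  (fun t => b (t^-1 *: (f (x + t *: h) - f x)) (g (x + t *: h)) +
            b (f x) (t^-1 *: (g (x + t *: h) - g x))).
  apply/funext => t; rewrite (linZ (b_linl _)) (linZ (b_linr _)) -scalerDr.
  by rewrite (linB (b_linl _)) (linB (b_linr _)) subrKA.
apply: tvs_cvgD.
  have c : (t^-1 *: (f (x + t *: h) - f x), g (x + t *: h)) @[t --> (0 : R)^'] -->
      (y, g x) by exact: cvg_pair fy (is_dderive_cvg gz).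
  exact: (cvg_comp _ (fun w : E * F => b w.1 w.2) c (b_cont (y, g x))).
have c2 : f x @[t --> (0 : R)^'] --> f x by exact: cvg_cst.
have c : (f x, t^-1 *: (g (x + t *: h) - g x)) @[t --> (0 : R)^'] --> (f x, z).
  exact: cvg_pair c2 gz.
exact: (cvg_comp _ (fun w : E * F => b w.1 w.2) c (b_cont (f x, z))).
Qed.

Section Curves.
Context (E F : tvsType R).
Hypothesis F_lc : seminormed_space F.

Lemma is_dderiveZ (f : E -> F) x h y r :
  is_dderive f x h y -> is_dderive f x (r *: h) (r *: y).
Proof.
move=> fy; apply/(is_dderiveP F_lc) => q e qP e0.
have e'0 : 0 < e / (`|r| + 1) by rewrite divr_gt0 // ltr_wpDl.
have := near0_mulr r ((is_dderiveP F_lc _ _ _ _).1 fy q _ qP e'0).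
apply: filterS => t; rewrite !scalerA => /le_trans; apply.
rewrite normrM mulrACA ler_piMr ?mulr_ge0 ?(ltW e0) //.
by rewrite mulrC ler_pdivrMr ?mul1r ?lerDl // ltr_wpDl.
Qed.

Section StronglyDifferentiable.
Context (f : E -> F) (df : E -> E -> F) (U : set E).
Hypotheses (Uo : open U)
  (f_der : forall y h, U y -> is_dderive f y h (df y h))
  (df_cont : forall x h, U x -> {for (x, h), continuous (fun z : E * E => df z.1 z.2)}).

(** The increment along [h + k] is split at [x + t *: h]; the second piece has a moving base point
    and is handled by strict differentiability. *)
Lemma is_dderive_add x h k : U x -> df x (h + k) = df x h + df x k.
Proof.
move=> Ux. apply: (is_dderive_unique F_lc (@f_der x (h + k) Ux)).
apply/(is_dderiveP F_lc) => q e qP e0.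
have e20 : 0 < e / 2 by rewrite divr_gt0.
have z_cvg : (t, (x + t *: h, k)) @[t --> (0 : R)] --> ((0 : R), (x, k)).
  have c1 : (x + t *: h, k) @[t --> (0 : R)] --> (x, k).
    have c2 : k @[t --> (0 : R)] --> k by exact: cvg_cst.
    exact: cvg_pair (line_cvg x h) c2.
  have c0 : t @[t --> (0 : R)] --> (0 : R) by exact: cvg_id.
  exact: cvg_pair c0 c1.
have near1 : \forall t \near (0 : R),
    q (f (x + t *: h + t *: k) - f (x + t *: h) - t *: df x k) <= e / 2 * `|t|.
  exact: z_cvg _ (strict_dderive F_lc qP Uo Ux f_der (@df_cont _ k Ux) e20).
have near2 : \forall t \near (0 : R),
    q (f (x + t *: h) - f x - t *: df x h) <= e / 2 * `|t|.
  exact: (is_dderiveP F_lc _ _ _ _).1 (@f_der _ h Ux) q _ qP e20.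
apply: filterS2 near1 near2 => t /= le1 le2.
have -> : f (x + t *: (h + k)) - f x - t *: (df x h + df x k) =
  (f (x + t *: h + t *: k) - f (x + t *: h) - t *: df x k) +
  (f (x + t *: h) - f x - t *: df x h).
  by rewrite [t *: (h + k)]scalerDr [x + (_ + _)]addrA; module R F.
apply: le_trans (csnD qP _ _) _; apply: le_trans (lerD le1 le2) _.
by rewrite -mulrDl -splitr.
Qed.

Lemma is_dderive_scale x h r : U x -> df x (r *: h) = r *: df x h.
Proof.
by move=> Ux; apply: (is_dderive_unique F_lc (@f_der _ _ Ux)); exact/is_dderiveZ/f_der.
Qed.

(** The value [g (x + t *: v)] is [g x] plus [t] times the difference quotient of [g]. This quotient
    tends to [k] and serves as the moving direction in [strict_dderive]. *)
Lemma is_dderive_comp D (g : D -> E) x v k :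
  U (g x) -> is_dderive g x v k -> is_dderive (f \o g) x v (df (g x) k).
Proof.
move=> Ux gk; apply: (csn_cvg F_lc) => q e qP e0.
have e20 : 0 < e / 2 by rewrite divr_gt0.
have z_cvg : (t, (g x, t^-1 *: (g (x + t *: v) - g x))) @[t --> (0 : R)^'] -->
    ((0 : R), (g x, k)).
  have c1 : (g x, t^-1 *: (g (x + t *: v) - g x)) @[t --> (0 : R)^'] --> (g x, k).
    have c2 : g x @[t --> (0 : R)^'] --> g x by exact: cvg_cst.
    exact: cvg_pair c2 gk.
  have c0 : t @[t --> (0 : R)^'] --> (0 : R) by exact: nbhs_dnbhs.
  exact: cvg_pair c0 c1.
near=> t; have t0 : t != 0 by near: t; exact: nbhs_dnbhs_neq.
have : q (f (g x + t *: (t^-1 *: (g (x + t *: v) - g x))) - f (g x) -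
    t *: df (g x) k) <= e / 2 * `|t|.
  near: t; exact: z_cvg _ (strict_dderive F_lc qP Uo Ux f_der (@df_cont _ k Ux) e20).
rewrite scalerA divff // scale1r subrKC.
have tn0 : 0 < `|t| by rewrite normr_gt0.
rewrite -(ltr_pM2r tn0) [X in _ -> X < _]mulrC -(csnZ qP) scalerBr scalerA divff // scale1r.
move=> /le_lt_trans; apply; rewrite ltr_pM2r // ltr_pdivrMr // ltr_pMr //.
exact: ltr1n.
Unshelve. all: by end_near. Qed.

End StronglyDifferentiable.
End Curves.
End Derivation.
Arguments line_cvg {R E} x h.

(** * Smooth families of maps *)

Section ProductSeminorms.
Context (R : realType) (E F : tvsType R).

Lemma seminormed_prod : seminormed_space E -> seminormed_space F ->
  seminormed_space (E * F)%type.
Proof.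
move=> [hE lcE] [hF lcF]; split.
  move=> [x y] [x' y'] cl; congr (_, _).
    apply: hE => A B Ax Bx'.
    have [] := cl (A `*` setT) (B `*` setT).
    - by exists (A, setT) => //; split => //; exact: filterT.
    - by exists (B, setT) => //; split => //; exact: filterT.
    by move=> [u v] [[/= Au _] [Bu _]]; exists u.
  apply: hF => A B Ay By'.
  have [] := cl (setT `*` A) (setT `*` B).
  - by exists (setT, A) => //; split => //; exact: filterT.
  - by exists (setT, B) => //; split => //; exact: filterT.
  by move=> [u v] [[/= _ Au] [_ Bu]]; exists v.
move=> W [[A B] /= [A0 B0] ABW].
have [p pP pA] := lcE _ A0; have [q qP qB] := lcF _ B0.
exists (fun z => p z.1 + q z.2).
  split=> [x y|r x|e e0] /=.
  - by rewrite addrACA lerD ?(csnD pP) ?(csnD qP).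
  - by rewrite (csnZ pP) (csnZ qP) mulrDr.
  have e20 : 0 < e / 2 by rewrite divr_gt0.
  exists ([set x | p x < e / 2], [set x | q x < e / 2]).
    by split; [exact: (csn_near pP)|exact: (csn_near qP)].
  by move=> [x y] /= [px qy]; rewrite (splitr e) ltrD.
move=> [x y] /= pq; apply: ABW; split => /=.
  by apply: pA; apply: le_lt_trans pq; rewrite lerDl (csn_ge0 qP).
by apply: qB; apply: le_lt_trans pq; rewrite lerDr (csn_ge0 pP).
Qed.

End ProductSeminorms.

Section SmoothFamilies.
Context (R : realType).

(* [Ck k U f]: the family [f] of maps on [U] is of class C^k, with derivatives
   continuous jointly in the parameter; the directions of differentiation are
   successively added to the parameters. *)
Fixpoint Ck (E F : tvsType R) (k : nat) (U : set E) (P : topologicalType)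
    (f : P -> E -> F) : Prop :=
  (forall p x, U x -> f z.1 z.2 @[z --> (p, x)] --> f p x) /\
  if k is k'.+1 then
    (forall p x h, U x -> dderivable (f p) x h) /\
    Ck k' U (fun (z : P * E) x => dderive (f z.1) x z.2)
  else True.

Section Basics.
Context (E F : tvsType R).
Implicit Types (U V : set E) (P Q : topologicalType).

Lemma Ck_cvg k U P (f : P -> E -> F) p x : Ck k U f -> U x ->
  f z.1 z.2 @[z --> (p, x)] --> f p x.
Proof. by case: k => [|k] [+ _]; exact. Qed.

Lemma Ck_sub k U V P (f : P -> E -> F) : V `<=` U -> Ck k U f -> Ck k V f.
Proof.
move=> VU; elim: k P f => [|k IHk] P f /= [f_cont f_Ck].
  by split=> // p x Vx; apply: f_cont; exact: VU.
split=> [p x Vx|]; first by apply: f_cont; exact: VU.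
case: f_Ck => f_der f_Ck; split=> [p x h Vx|]; last exact: IHk.
by apply: f_der; exact: VU.
Qed.

(** [Ck] on a set is a conjunction of conditions at its points, each about limits in the whole
    space. *)
Lemma Ck_local k U P (f : P -> E -> F) :
  (forall x, U x -> exists2 V, V x & Ck k V f) -> Ck k U f.
Proof.
elim: k P f => [|k IHk] P f fV.
  by split=> // p x Ux; have [V Vx fC] := fV x Ux; exact: (Ck_cvg fC Vx).
split=> [p x Ux|]; first by have [V Vx fC] := fV x Ux; exact: (Ck_cvg fC Vx).
split=> [p x h Ux|].
  by have [V Vx [_ [f_der _]]] := fV x Ux; exact: f_der.
by apply: IHk => x Ux; have [V Vx [_ [_ fC]]] := fV x Ux; exists V.
Qed.

Lemma Ck_reparam k U P Q (f : P -> E -> F) (phi : Q -> P) :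
  continuous phi -> Ck k U f -> Ck k U (fun q => f (phi q)).
Proof.
have cvg_phi (Q' P' : topologicalType) (phi' : Q' -> P') q (x : E) :
    phi' @ q --> phi' q -> (phi' z.1, z.2) @[z --> (q, x)] --> (phi' q, x).
  move=> phi_cont.
  have c1 : phi' z.1 @[z --> (q, x)] --> phi' q.
    by apply: cvg_comp phi_cont; exact: cvg_fst.
  have c2 : z.2 @[z --> (q, x)] --> x by exact: cvg_snd.
  exact: cvg_pair c1 c2.
elim: k P Q f phi => [|k IHk] P Q f phi phi_cont [f_cont f_Ck].
  split=> // q x Ux.
  exact: (cvg_comp _ (fun z => f z.1 z.2) (cvg_phi _ _ _ _ _ (phi_cont q)) (f_cont _ _ Ux)).
split=> [q x Ux|].
  exact: (cvg_comp _ (fun z => f z.1 z.2) (cvg_phi _ _ _ _ _ (phi_cont q)) (f_cont _ _ Ux)).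
case: f_Ck => f_der f_Ck; split=> [q x h|]; first exact: f_der.
apply: (IHk _ _ (fun z x => dderive (f z.1) x z.2) (fun z => (phi z.1, z.2))) => //.
by move=> [q h]; apply: cvg_phi; exact: phi_cont.
Qed.

Lemma CkW k U P (f : P -> E -> F) : Ck k.+1 U f -> Ck k U f.
Proof.
elim: k P f => [|k IHk] P f [f_cont [f_der f_Ck]]; first by [].
by split=> //; split=> //; exact: IHk.
Qed.

Lemma Ck_near k U P (f g : P -> E -> F) : open U ->
  (forall p x, U x -> f p x = g p x) -> Ck k U f -> Ck k U g.
Proof.
move=> Uo; elim: k P f g => [|k IHk] P f g fg [f_cont f_Ck].
all: have g_cont p x : U x -> g z.1 z.2 @[z --> (p, x)] --> g p x.
- move=> Ux; rewrite -fg //; apply: cvg_trans (f_cont p x Ux); apply: near_eq_cvg.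
  have Uz : \forall z \near (p, x), U z.2.
    by apply: (@cvg_snd _ _ (nbhs p) (nbhs x)); exact: open_nbhs_nbhs.
  by apply: filterS Uz => z Uz; rewrite fg.
- by split.
- move=> Ux; rewrite -fg //; apply: cvg_trans (f_cont p x Ux); apply: near_eq_cvg.
  have Uz : \forall z \near (p, x), U z.2.
    by apply: (@cvg_snd _ _ (nbhs p) (nbhs x)); exact: open_nbhs_nbhs.
  by apply: filterS Uz => z Uz; rewrite fg.
have fgU p : {in U, f p =1 g p} by move=> x /[!inE]; exact: fg.
case: f_Ck => f_der f_Ck; split=> //; split=> [p x h Ux|].
  exact: (dderivable_near Uo Ux (fgU p) (f_der p x h Ux)).
by apply: IHk f_Ck => z x Ux; exact: (dderive_near _ Uo Ux (fgU _)).
Qed.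

Lemma dderivable_Ck k U P (f : P -> E -> F) p x h : seminormed_space F ->
  Ck k.+1 U f -> U x -> is_dderive (f p) x h (dderive (f p) x h).
Proof. by move=> F_lc [_ [f_der _]] Ux; exact/(dderivableP F_lc)/f_der. Qed.

Lemma Ck_dderive k U P (f : P -> E -> F) :
  Ck k.+1 U f -> Ck k U (fun z x => dderive (f z.1) x z.2).
Proof. by case=> _ []. Qed.

Lemma CkS k U P (f : P -> E -> F) (df : P * E -> E -> F) :
  seminormed_space F -> open U ->
  (forall p x, U x -> f z.1 z.2 @[z --> (p, x)] --> f p x) ->
  (forall p x h, U x -> is_dderive (f p) x h (df (p, h) x)) ->
  Ck k U df -> Ck k.+1 U f.
Proof.
move=> F_lc Uo f_cont f_der df_Ck; split=> //; split=> [p x h Ux|].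
  by exists (df (p, h) x); exact: f_der.
apply: Ck_near df_Ck => // -[p h] x Ux /=.
by rewrite (dderive_eq F_lc (f_der p x h Ux)).
Qed.

End Basics.
End SmoothFamilies.
Arguments dderivable_Ck {R E F k U P f} p {x} h _ _ _.

Section FamilyOperations.
Context (R : realType).
Implicit Types (E F H : tvsType R) (P Q : topologicalType).

(** Linear maps and constants are treated together because this class is closed under
    differentiation: the derivative [l h] is constant in the point and continuous in the new
    parameter [h]. *)
Lemma Ck_affine E F k (U : set E) P (l : E -> F) (a : P -> F) :
  seminormed_space F -> open U ->
  linear l -> continuous l -> continuous a -> Ck k U (fun p x => l x + a p).
Proof.
move=> F_lc Uo.
elim: k P l a => [|k IHk] P l a l_lin l_cont a_cont.
all: have f_cont p x : l z.2 + a z.1 @[z --> (p, x)] --> l x + a p.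
- apply: tvs_cvgD; first exact: cvg_comp (snd_continuous (p, x)) (l_cont x).
  exact: cvg_comp (fst_continuous (p, x)) (a_cont p).
- by split.
- apply: tvs_cvgD; first exact: cvg_comp (snd_continuous (p, x)) (l_cont x).
  exact: cvg_comp (fst_continuous (p, x)) (a_cont p).
apply: (CkS F_lc Uo (df := fun z _ => 0 + l z.2)) => //.
  move=> p x h _ /=; rewrite add0r -[X in is_dderive _ _ _ X]addr0.
  by apply: is_dderiveD; [exact: is_dderive_lin|exact: is_dderive_cst].
apply: (IHk _ (fun=> 0)).
- by move=> r x y; rewrite scaler0 addr0.
- exact: cst_continuous.
- by move=> z; exact: cvg_comp (snd_continuous z) (l_cont z.2).
Qed.

Lemma Ck_lin E F k (U : set E) P (l : E -> F) :
  seminormed_space F -> open U -> linear l -> continuous l ->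
  Ck k U (fun (_ : P) x => l x).
Proof.
move=> F_lc Uo l_lin l_cont.
apply: (Ck_near Uo _ (Ck_affine k F_lc Uo l_lin l_cont (@cst_continuous P F 0))) => p x _.
by rewrite addr0.
Qed.

Lemma Ck_cst E F k (U : set E) P (a : P -> F) :
  seminormed_space F -> open U -> continuous a -> Ck k U (fun p _ => a p).
Proof.
move=> F_lc Uo a_cont.
have l0 : linear ((fun=> 0) : E -> F) by move=> r x y; rewrite scaler0 addr0.
apply: (Ck_near Uo _ (Ck_affine k F_lc Uo l0 (@cst_continuous E F 0) a_cont)) => p x _.
by rewrite add0r.
Qed.

Lemma Ck_id E k (U : set E) P : seminormed_space E -> open U ->
  Ck k U (fun (_ : P) x => x).
Proof. by move=> E_lc Uo; apply: Ck_lin => // x; exact: cvg_id. Qed.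

Lemma CkD E F k (U : set E) P (f g : P -> E -> F) : seminormed_space F -> open U ->
  Ck k U f -> Ck k U g -> Ck k U (fun p x => f p x + g p x).
Proof.
move=> F_lc Uo; elim: k P f g => [|k IHk] P f g fC gC.
  by split=> // p x Ux; exact: tvs_cvgD (Ck_cvg fC Ux) (Ck_cvg gC Ux).
apply: CkS (IHk _ _ _ (Ck_dderive fC) (Ck_dderive gC)) => // [p x Ux|p x h Ux /=].
  exact: tvs_cvgD (Ck_cvg fC Ux) (Ck_cvg gC Ux).
exact: is_dderiveD (dderivable_Ck _ _ F_lc fC Ux) (dderivable_Ck _ _ F_lc gC Ux).
Qed.

Lemma Ck_postlin E F H k (U : set E) P (f : P -> E -> F) (l : F -> H) :
  seminormed_space F -> seminormed_space H -> open U ->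
  linear l -> continuous l -> Ck k U f -> Ck k U (fun p x => l (f p x)).
Proof.
move=> F_lc H_lc Uo l_lin l_cont; elim: k P f => [|k IHk] P f fC.
  by split=> // p x Ux; exact: cvg_comp (Ck_cvg fC Ux) (l_cont _).
apply: CkS (IHk _ _ (Ck_dderive fC)) => // [p x Ux|p x h Ux /=].
  exact: cvg_comp (Ck_cvg fC Ux) (l_cont _).
exact: is_dderive_postlin (dderivable_Ck _ _ F_lc fC Ux).
Qed.

Lemma Ck_pair E F H k (U : set E) P (f : P -> E -> F) (g : P -> E -> H) :
  seminormed_space F -> seminormed_space H -> open U ->
  Ck k U f -> Ck k U g -> Ck k U (fun p x => (f p x, g p x)).
Proof.
move=> F_lc H_lc Uo; elim: k P f g => [|k IHk] P f g fC gC.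
  by split=> // p x Ux; exact: cvg_pair (Ck_cvg fC Ux) (Ck_cvg gC Ux).
apply: CkS (IHk _ _ _ (Ck_dderive fC) (Ck_dderive gC)) => // [||p x h Ux /=].
- exact: seminormed_prod.
- by move=> p x Ux; exact: cvg_pair (Ck_cvg fC Ux) (Ck_cvg gC Ux).
exact: is_dderive_pair (dderivable_Ck _ _ F_lc fC Ux) (dderivable_Ck _ _ H_lc gC Ux).
Qed.

Lemma Ck_bilin E F1 F2 H k (U : set E) P (b : F1 -> F2 -> H)
    (f : P -> E -> F1) (g : P -> E -> F2) :
  seminormed_space F1 -> seminormed_space F2 -> seminormed_space H -> open U ->
  (forall u, linear (b u)) -> (forall v, linear (b ^~ v)) ->
  continuous (fun w : F1 * F2 => b w.1 w.2) ->
  Ck k U f -> Ck k U g -> Ck k U (fun p x => b (f p x) (g p x)).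
Proof.
move=> F1_lc F2_lc H_lc Uo b_linr b_linl b_cont.
elim: k P f g => [|k IHk] P f g fC gC.
all: have fg_cont p x : U x ->
    b (f z.1 z.2) (g z.1 z.2) @[z --> (p, x)] --> b (f p x) (g p x).
- by move=> Ux; exact: cvg_comp2 (Ck_cvg fC Ux) (Ck_cvg gC Ux) (b_cont (_, _)).
- by split.
- by move=> Ux; exact: cvg_comp2 (Ck_cvg fC Ux) (Ck_cvg gC Ux) (b_cont (_, _)).
have C1 := IHk _ _ _ (Ck_dderive fC) (Ck_reparam fst_continuous (CkW gC)).
have C2 := IHk _ _ _ (Ck_reparam fst_continuous (CkW fC)) (Ck_dderive gC).
apply: CkS (CkD H_lc Uo C1 C2) => // p x h Ux /=.
exact: is_dderive_bilin (dderivable_Ck _ _ F1_lc fC Ux) (dderivable_Ck _ _ F2_lc gC Ux).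
Qed.

(* As [f] is linear in the substituted part of its parameter, no derivative in
   that direction is needed. *)
Lemma Ck_subst E F H k (U : set E) P (f : P * H -> E -> F) (g : P -> E -> H) :
  seminormed_space F -> seminormed_space H -> open U ->
  (forall p x, U x -> linear (fun y => f (p, y) x)) ->
  Ck k U f -> Ck k U g -> Ck k U (fun p x => f (p, g p x) x).
Proof.
move=> F_lc H_lc Uo; elim: k P f g => [|k IHk] P f g f_lin fC gC.
all: have fg_cont p x : U x ->
    f (z.1, g z.1 z.2) z.2 @[z --> (p, x)] --> f (p, g p x) x.
- move=> Ux.
  have c1 : (z.1, g z.1 z.2) @[z --> (p, x)] --> (p, g p x).
    exact: cvg_pair (fst_continuous (p, x)) (Ck_cvg gC Ux).
  exact: cvg_comp2 c1 (snd_continuous (p, x)) (Ck_cvg fC Ux).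
- by split.
- move=> Ux.
  have c1 : (z.1, g z.1 z.2) @[z --> (p, x)] --> (p, g p x).
    exact: cvg_pair (fst_continuous (p, x)) (Ck_cvg gC Ux).
  exact: cvg_comp2 c1 (snd_continuous (p, x)) (Ck_cvg fC Ux).
(* The derivative with the substituted parameter frozen. It is again linear in that parameter, so
   the induction hypothesis applies to it. *)
pose df z x := dderive (f (z.1.1, z.2)) x z.1.2.
have C1 : Ck k U (fun z x => df (z, g z.1 x) x).
  apply: (IHk _ df (fun z => g z.1)).
  - move=> [p h] x Ux r u v; rewrite /df /=; apply: (dderive_eq F_lc).
    have r_lin : linear ( *:%R r : F -> F).
      by move=> s y z; rewrite scalerDr !scalerA mulrC.
    have r_cont : continuous ( *:%R r : F -> F).
      by move=> y; apply: tvs_cvgZ; [exact: cvg_cst|exact: cvg_id].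
    have := is_dderiveD (is_dderive_postlin r_lin r_cont
      (dderivable_Ck (p, u) h F_lc fC Ux)) (dderivable_Ck (p, v) h F_lc fC Ux).
    by apply: (is_dderive_near Uo Ux) => y /[!inE] Uy /=; rewrite f_lin.
  - pose phi (z : (P * E) * H) := ((z.1.1, z.2), z.1.2).
    apply: (Ck_reparam (phi := phi) _ (Ck_dderive fC)).
    apply: pair_continuous; first apply: pair_continuous => z.
    + exact: cvg_comp (fst_continuous z) (fst_continuous _).
    + exact: snd_continuous.
    + by move=> z; exact: cvg_comp (fst_continuous z) (snd_continuous _).
  - exact: Ck_reparam fst_continuous (CkW gC).
have C2 : Ck k U (fun z x => f (z.1, dderive (g z.1) x z.2) x).
  apply: (IHk _ (fun z : (P * E) * H => f (z.1.1, z.2))).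
  - by move=> [p h] x Ux; exact: f_lin.
  - pose phi (z : (P * E) * H) := (z.1.1, z.2).
    apply: (Ck_reparam (phi := phi) _ (CkW fC)).
    apply: pair_continuous => z; last exact: snd_continuous.
    exact: cvg_comp (fst_continuous z) (fst_continuous _).
  - exact: Ck_dderive gC.
apply: CkS (CkD F_lc Uo C1 C2) => // p x h Ux /=.
have gy := dderivable_Ck p h H_lc gC Ux.
have fy := dderivable_Ck (p, g p x) h F_lc fC Ux.
rewrite addrC /is_dderive /df /=.
have Ux_near : \forall t \near (0 : R)^', U (x + t *: h).
  exact/nbhs_dnbhs/near_line.
(* Linearity carries the difference quotient of [g] into the parameter slot, where joint continuity
   of [f] gives the limit. *)
have f_cvg : f (p, t^-1 *: (g p (x + t *: h) - g p x)) (x + t *: h)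
    @[t --> (0 : R)^'] --> f (p, dderive (g p) x h) x.
  have c0 : p @[t --> (0 : R)^'] --> p by exact: cvg_cst.
  have c1 : (p, t^-1 *: (g p (x + t *: h) - g p x)) @[t --> (0 : R)^'] -->
      (p, dderive (g p) x h) by exact: cvg_pair c0 gy.
  have c2 : x + t *: h @[t --> (0 : R)^'] --> x.
    exact: cvg_comp (@nbhs_dnbhs _ (0 : R)) (line_cvg x h).
  exact: cvg_comp2 c1 c2 (Ck_cvg fC Ux).
apply: cvg_trans (tvs_cvgD f_cvg fy); apply: near_eq_cvg.
apply: filterS Ux_near => t Ut.
rewrite (linZ (f_lin p _ Ut)) (linB (f_lin p _ Ut)) -scalerDr.
by rewrite subrKA.
Qed.

End FamilyOperations.

Section ChainRule.
Context (R : realType) (E H F : tvsType R).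
Hypotheses (H_lc : seminormed_space H) (F_lc : seminormed_space F).

Lemma dderive_linear k (V : set H) (P : topologicalType) (f : P -> H -> F) p x :
  open V -> Ck k.+1 V f -> V x -> linear (dderive (f p) x).
Proof.
move=> Vo fC Vx r h h'.
have f_der y v : V y -> is_dderive (f p) y v (dderive (f p) y v).
  by move=> Vy; exact: (dderivable_Ck p v F_lc fC Vy).
have df_cont y v : V y ->
    {for (y, v), continuous (fun z : H * H => dderive (f p) z.1 z.2)}.
  move=> Vy.
  have c0 : p @[_ --> (y, v)] --> p by exact: cvg_cst.
  have c1 : (p, z.2) @[z --> (y, v)] --> (p, v).
    exact: cvg_pair c0 (snd_continuous (y, v)).
  exact: (cvg_comp2 (b := fun z u => dderive (f z.1) u z.2) c1
    (fst_continuous (y, v)) (Ck_cvg (Ck_dderive fC) Vy)).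
rewrite (is_dderive_add F_lc Vo f_der df_cont) //.
by rewrite (is_dderive_scale F_lc f_der).
Qed.

Lemma is_dderive_comp_Ck k (V : set H) (P : topologicalType) (f : P -> H -> F) p
    (g : E -> H) x v y :
  open V -> Ck k.+2 V f -> V (g x) -> is_dderive g x v y ->
  is_dderive (f p \o g) x v (dderive (f p) (g x) y).
Proof.
move=> Vo fC Vx gy.
apply: (is_dderive_comp (df := dderive (f p)) F_lc Vo) =>
  // [u h Vu|u h Vu]; first exact: (dderivable_Ck p h F_lc fC Vu).
have c0 : p @[_ --> (u, h)] --> p by exact: cvg_cst.
have c1 : (p, z.2) @[z --> (u, h)] --> (p, h).
  exact: cvg_pair c0 (snd_continuous (u, h)).
exact: (cvg_comp2 (b := fun z u => dderive (f z.1) u z.2) c1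
    (fst_continuous (u, h)) (Ck_cvg (Ck_dderive fC) Vu)).
Qed.

(** In the chain rule the derivative of [f] is taken in a direction that varies with [x]. As it is
    linear in this direction, [Ck_subst] reduces the induction step to composing [g] with the
    derivative of [f] in a fixed direction. *)
Lemma Ck_comp k (U : set E) (V : set H) (P : topologicalType)
    (f : P -> H -> F) (g : P -> E -> H) :
  open U -> open V -> (forall p x, U x -> V (g p x)) ->
  Ck k V f -> Ck k U g -> Ck k U (fun p x => f p (g p x)).
Proof.
move=> Uo Vo; elim: k P f g => [|k IHk] P f g UV fC gC.
  split=> // p x Ux.
  exact: cvg_comp2 (fst_continuous (p, x)) (Ck_cvg gC Ux) (Ck_cvg fC (UV _ _ Ux)).
pose df (z : (P * E) * H) x := dderive (f z.1.1) (g z.1.1 x) z.2.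
have C : Ck k U (fun z x => df (z, dderive (g z.1) x z.2) x).
  apply: (Ck_subst (g := fun z x => dderive (g z.1) x z.2) F_lc H_lc Uo).
  - by move=> z x Ux; exact: (dderive_linear z.1 Vo fC (UV _ _ Ux)).
  - apply: (IHk _ (fun z y => dderive (f z.1.1) y z.2) (fun z => g z.1.1)).
    + by move=> z x; exact: UV.
    + pose phi (z : (P * E) * H) := (z.1.1, z.2).
      apply: (Ck_reparam (phi := phi) _ (Ck_dderive fC)).
      apply: pair_continuous => z; last exact: snd_continuous.
      exact: cvg_comp (fst_continuous z) (fst_continuous _).
    + apply: (Ck_reparam _ (CkW gC)) => z.
      exact: cvg_comp (fst_continuous z) (fst_continuous _).
  - exact: Ck_dderive gC.
apply: CkS C => // [p x Ux|p x h Ux].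
  exact: cvg_comp2 (fst_continuous (p, x)) (Ck_cvg gC Ux) (Ck_cvg fC (UV _ _ Ux)).
apply: (is_dderive_comp (df := dderive (f p)) F_lc Vo) => [y v Vy|y v Vy||].
- exact: (dderivable_Ck p v F_lc fC Vy).
- have c0 : p @[_ --> (y, v)] --> p by exact: cvg_cst.
  have c1 : (p, z.2) @[z --> (y, v)] --> (p, v).
    exact: cvg_pair c0 (snd_continuous (y, v)).
  exact: (cvg_comp2 (b := fun z u => dderive (f z.1) u z.2) c1
    (fst_continuous (y, v)) (Ck_cvg (Ck_dderive fC) Vy)).
- exact: UV.
- exact: (dderivable_Ck p h H_lc gC Ux).
Qed.

End ChainRule.

(** * Smooth maps in terms of families *)

Lemma cvg_ptws (T : Type) (I : eqType) (V : topologicalType) (Fi : set_system T)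
    {FF : Filter Fi} (s : T -> {ptws I -> V}) (f : {ptws I -> V}) :
  (forall i, s t i @[t --> Fi] --> f i) -> s @ Fi --> f.
Proof.
move=> sf; apply/cvg_sup => i; apply/cvg_image.
  by rewrite eqEsubset; split=> // v _; exists (fun=> v).
move=> W /(sf i) sW; exists ((fun g => g i) @^-1` W) => //.
by rewrite eqEsubset; split=> [_ [g gW <-] //|v Wv]; exists (fun=> v).
Qed.

Lemma codom_nth (T T' : Type) (f : T -> T') (x0 : T) (xs : seq T) :
  codom (fun i : 'I_(size xs) => f (nth x0 xs i)) = map f xs.
Proof.
rewrite /codom /image_mem (map_comp f) (map_comp (nth x0 xs) val) val_enum_ord.
by rewrite map_nth_iota0 // take_size.
Qed.

Section SmoothOn.
Context (R : realType) (E F : tvsType R) (U : set E).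
Hypotheses (F_lc : seminormed_space F) (Uo : open U).

(** The new direction comes first because [iter_dderive] differentiates in the head of the list
    last. *)
Definition ptws_cons j (s : {ptws 'I_j -> E}) (y : E) : {ptws 'I_j.+1 -> E} :=
  fun i => if unlift ord0 i is Some i' then s i' else y.

Lemma ptws_cons_continuous j :
  continuous (fun z : {ptws 'I_j -> E} * E => ptws_cons z.1 z.2).
Proof.
move=> z; apply: cvg_ptws => i; rewrite /ptws_cons.
case: (unlift ord0 i) => [i'|]; last exact: snd_continuous.
exact: cvg_comp (fst_continuous z) (@proj_continuous _ _ i' _).
Qed.

Lemma codom_ordS j (s : 'I_j.+1 -> E) :
  codom s = s ord0 :: codom (fun i => s (lift ord0 i)).
Proof. by rewrite /codom /image_mem enum_ordSl /= -map_comp. Qed.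

Lemma codom_ptws_cons j (s : {ptws 'I_j -> E}) (y : E) :
  codom (ptws_cons s y) = y :: codom s.
Proof.
rewrite codom_ordS {1}/ptws_cons unlift_none; congr (_ :: _).
by apply: eq_codom => i; rewrite /ptws_cons liftK.
Qed.

(** Stated for all numbers [j] of directions at once: differentiating a jet of order [j] in a
    direction that becomes a parameter gives a jet of order [j.+1], so the induction on [k] raises
    [j]. *)
Lemma Ck_iter_dderive k (f : E -> F) j (Q : topologicalType)
    (s : Q -> {ptws 'I_j -> E}) : smooth_on U f -> continuous s ->
  Ck k U (fun q x => iter_dderive f (codom (s q)) x).
Proof.
move=> [_ f_der f_cont]; elim: k j Q s => [|k IHk] j Q s s_cont.
all: have it_cont q x : U x -> iter_dderive f (codom (s z.1)) z.2 @[z --> (q, x)] -->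
    iter_dderive f (codom (s q)) x.
1, 3: move=> Ux; have := f_cont j.
1, 2: rewrite continuous_open_subspace; last by apply: open_setX => //; exact: openT.
1, 2: move=> /(_ (x, s q)); rewrite inE => /(_ (conj Ux I)) c.
1, 2: have cs : s z.1 @[z --> (q, x)] --> s q
  by exact: cvg_comp (fst_continuous (q, x)) (s_cont q).
1, 2: exact: (cvg_comp2 (b := fun x (s : {ptws 'I_j -> E}) => iter_dderive f (codom s) x)
      (snd_continuous (q, x)) cs c).
  by split.
split=> //; split=> [q x h Ux|]; first exact: f_der.
have s'_cont : continuous (fun z : Q * E => ptws_cons (s z.1) z.2).
  move=> z.
  have c1 : s q @[q --> z.1] --> s z.1 by exact: s_cont.
  have c2 : s y.1 @[y --> z] --> s z.1 by exact: cvg_comp (fst_continuous z) c1.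
  exact: cvg_comp2 c2 (snd_continuous z) (@ptws_cons_continuous j (s z.1, z.2)).
apply: (Ck_near Uo _ (IHk _ _ _ s'_cont)) => z x Ux.
by rewrite codom_ptws_cons.
Qed.

Lemma smooth_on_Ck (f : E -> F) (P : topologicalType) k :
  smooth_on U f -> Ck k U (fun _ : P => f).
Proof.
move=> f_smooth.
have : Ck k U (fun _ : P => iter_dderive f (codom ((fun=> 0) : {ptws 'I_0 -> E}))).
  by apply: (Ck_iter_dderive k f_smooth (s := fun=> (fun=> 0))) => p; exact: cvg_cst.
by rewrite (_ : codom _ = [::]) //; apply: size0nil; rewrite size_codom card_ord.
Qed.

Lemma Ck_smooth_on (f : E -> F) :
  (forall (P : topologicalType) k, Ck k U (fun _ : P => f)) -> smooth_on U f.
Proof.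
move=> fC.
have iter_Ck j k : Ck k U (fun (s : {ptws 'I_j -> E}) x => iter_dderive f (codom s) x).
  elim: j k => [|j IHj] k.
    apply: Ck_near (fC _ k) => // s x Ux.
    by rewrite (_ : codom s = [::]) //; apply: size0nil; rewrite size_codom card_ord.
  pose phi (s : {ptws 'I_j.+1 -> E}) : {ptws 'I_j -> E} * E :=
    (fun i => s (lift ord0 i), s ord0).
  have phi_cont : continuous phi.
    apply: pair_continuous => s; last exact: (@proj_continuous _ _ ord0).
    by apply: (@cvg_ptws _ _ _ _ (nbhs_filter s)) => i; exact: (@proj_continuous _ _ (lift ord0 i)).
  apply: Ck_near (Ck_reparam phi_cont (Ck_dderive (IHj k.+1))) => // s x Ux.
  by rewrite codom_ordS.
split.
- rewrite continuous_open_subspace // => x /[!inE] Ux.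
  have c0 : (fun=> 0 : E) y @[y --> x] --> (0 : E) by exact: cvg_cst.
  have c1 : y @[y --> x] --> x by exact: cvg_id.
  exact: (cvg_comp2 c0 c1 (Ck_cvg (fC E 0%N) Ux)).
- move=> hs x h Ux.
  have [_ [f_der _]] := iter_Ck (size hs) 1%N.
  have := f_der (fun i => nth 0 hs i) x h Ux.
  by rewrite (codom_nth id) map_id.
move=> j; rewrite continuous_open_subspace; last first.
  by apply: open_setX => //; exact: openT.
move=> [x s] /[!inE] -[/= Ux _].
exact: (cvg_comp2 (b := fun (s : {ptws 'I_j -> E}) x => iter_dderive f (codom s) x)
  (snd_continuous (x, s)) (fst_continuous (x, s)) (Ck_cvg (iter_Ck j 0%N) Ux)).
Qed.

End SmoothOn.
Arguments is_dderive_comp_Ck {R E H F} _ {k V P f} p {g x v y} _ _ _ _.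

(** * Normed spaces and unital C*-algebras *)

Section NormedSeminorms.
Context (R : realType) (E : normedModType R).

Lemma csn_norm : continuous_seminorm (fun x : E => `|x|).
Proof.
split=> [x y|r x|e e0]; [exact: ler_normD|exact: normrZ|].
exact: nbhs0_lt.
Qed.

Lemma csn_scale (F : tvsType R) (q : F -> R) k :
  0 <= k -> continuous_seminorm q -> continuous_seminorm (fun x => k * q x).
Proof.
move=> k0 qP; split=> [x y|r x|e e0].
- by rewrite -mulrDr ler_wpM2l // (csnD qP).
- by rewrite (csnZ qP) mulrCA.
have k10 : 0 < k + 1 by rewrite ltr_wpDl.
have e'0 : 0 < e / (k + 1) by rewrite divr_gt0.
apply: filterS (csn_near qP e'0) => x; rewrite ltr_pdivlMr // => qx.
apply: le_lt_trans qx; rewrite mulrDr mulr1 mulrC lerDl.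
exact: csn_ge0.
Qed.

Lemma seminormed_normed : seminormed_space E.
Proof.
split; first exact: norm_hausdorff.
move=> W /nbhs_ballP[d /= d0 dW]; exists (fun x => d^-1 * `|x|).
  by apply: csn_scale csn_norm; rewrite invr_ge0 ltW.
move=> x /=; rewrite ltr_pdivrMl // mulr1 => xd; apply: dW.
by rewrite -ball_normE /= sub0r normrN.
Qed.

End NormedSeminorms.

Section RealNorm.
Context (R : realType) (A : normedModType R[i]).
Implicit Types a b : A.

Definition renorm a : R := complex.Re `|a|.

Lemma renormE a : `|a| = (renorm a)%:C.
Proof.
rewrite /renorm; have := normr_ge0 a; case: `|a| => x y /=.
by rewrite lecE /= => /andP[/eqP-> _].
Qed.

Lemma renorm_ge0 a : 0 <= renorm a.
Proof. by have := normr_ge0 a; rewrite renormE lecR. Qed.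

Lemma renorm0 : renorm 0 = 0.
Proof. by rewrite /renorm normr0. Qed.

Lemma renorm_eq0 a : renorm a = 0 -> a = 0.
Proof. by move=> a0; apply/eqP; rewrite -normr_eq0 renormE a0. Qed.

Lemma renormD a b : renorm (a + b) <= renorm a + renorm b.
Proof. by have := ler_normD a b; rewrite !renormE -rmorphD lecR. Qed.

Lemma renormZ (k : R[i]) a : renorm (k *: a) = complex.Re `|k| * renorm a.
Proof.
by apply: complexI; rewrite -renormE normrZ rmorphM /= -renormE.
Qed.

Lemma renormZr (r : R) a : renorm (r%:C *: a) = `|r| * renorm a.
Proof.
by rewrite renormZ normc_def /= expr0n addr0 sqrtr_sqr.
Qed.

Lemma renormN a : renorm (- a) = renorm a.
Proof. by rewrite /renorm normrN. Qed.

Lemma nbhs0_renorm (W : set A) :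
  nbhs 0 W <-> exists2 e : R, 0 < e & [set a | renorm a < e] `<=` W.
Proof.
split=> [/nbhs_ballP[e /= e0 eW]|[e e0 eW]].
  have e_real : e = (complex.Re e)%:C.
    by case: e e0 {eW} => a b; rewrite /= ltcE /= => /andP[/eqP-> _].
  exists (complex.Re e); first by rewrite -ltcR -e_real.
  move=> a /= ae; apply: eW; rewrite -ball_normE /= sub0r normrN renormE e_real.
  by rewrite ltcR.
apply/nbhs_ballP; exists e%:C => /=; first by rewrite ltcR.
move=> a; rewrite -ball_normE /= sub0r normrN renormE ltcR; exact: eW.
Qed.

Lemma csn_renorm : continuous_seminorm (renorm : realified R A -> R).
Proof.
split=> [a b|r a|e e0]; [exact: renormD|exact: renormZr|].
by apply/nbhs0_renorm; exists e.
Qed.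

Lemma seminormed_realified : seminormed_space (realified R A).
Proof.
split; first exact: (@norm_hausdorff _ A).
move=> W /nbhs0_renorm[d d0 dW]; exists (fun x => d^-1 * renorm x).
  by apply: csn_scale csn_renorm; rewrite invr_ge0 ltW.
by move=> x /=; rewrite ltr_pdivrMl // mulr1 => xd; apply: dW.
Qed.

Lemma cvg_renormP T (Fi : set_system T) {FF : Filter Fi} (f : T -> A) a :
  f @ Fi --> a <-> forall e : R, 0 < e -> \forall t \near Fi, renorm (f t - a) < e.
Proof.
split=> [fa e e0|fa].
  exact: (@cvg_csn R (realified R A) T Fi FF f a renorm e fa csn_renorm e0).
suff fa0 : (f t - a : realified R A) @[t --> Fi] --> (0 : realified R A).
  have ca : (fun=> a : realified R A) @ Fi --> (a : realified R A) by exact: cvg_cst.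
  have := @tvs_cvgD R (realified R A) T Fi FF _ _ _ _ fa0 ca.
  by under eq_fun do rewrite subrK; rewrite add0r.
by move=> W /nbhs0_renorm[d d0 dW]; apply: filterS (fa d d0) => t; exact: dW.
Qed.

End RealNorm.

Section CstarAlgebra.
Context (R : realType) (A : unitalCstarAlgType R).
Implicit Types a b : A.

Lemma realified_scale (r : R) (a : realified R A) : r *: a = r%:C *: (a : A) :> A.
Proof. by []. Qed.

Lemma renormM a b : renorm (cmul a b) <= renorm a * renorm b.
Proof. by have := cnormM a b; rewrite !renormE -rmorphM lecR. Qed.

(** The C*-identity bounds the square of |b| by |star b| |b|; cancel |b| and use that [star] is an
    involution. *)
Lemma renorm_star a : renorm (star a) = renorm a.
Proof.
suff le_star b : renorm b <= renorm (star b).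
  by apply/le_anti; rewrite le_star andbT -{2}(starK a) le_star.
have [b0|b0] := leP (renorm b) 0; first exact: le_trans b0 (renorm_ge0 _).
have := cnormM (star b) b; rewrite cnorm_star !renormE -rmorphM -rmorphXn lecR.
by rewrite expr2 ler_pM2r.
Qed.

Lemma cmul_linearr a : linear (cmul a : realified R A -> realified R A).
Proof. by move=> r x y; rewrite !realified_scale cmulDr cmulZr. Qed.

Lemma cmul_linearl b :
  linear ((fun a => cmul a b) : realified R A -> realified R A).
Proof. by move=> r x y; rewrite !realified_scale cmulDl cmulZl. Qed.

Lemma star_linear : linear (star : realified R A -> realified R A).
Proof.
by move=> r x y; rewrite !realified_scale starD starZ conjc_real.
Qed.

Lemma cmul0 a : cmul a 0 = 0. Proof. exact: (lin0 (cmul_linearr a)). Qed.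
Lemma cmul0l a : cmul 0 a = 0. Proof. exact: (lin0 (cmul_linearl a)). Qed.
Lemma cmulBr a x y : cmul a (x - y) = cmul a x - cmul a y.
Proof. exact: (linB (cmul_linearr a)). Qed.
Lemma cmulBl a x y : cmul (x - y) a = cmul x a - cmul y a.
Proof. exact: (linB (cmul_linearl a)). Qed.

Lemma star_continuous : continuous (star : A -> A).
Proof.
move=> a; apply/cvg_renormP => e e0.
have /cvg_renormP/(_ _ e0) : x @[x --> a] --> a by exact: cvg_id.
apply: filterS => x; rewrite -(linB star_linear); by rewrite renorm_star.
Qed.

Lemma cmul_continuous : continuous (fun w : A * A => cmul w.1 w.2).
Proof.
move=> [a b]; apply/cvg_renormP => e e0.
have Ma : 0 < renorm a + 1 by rewrite ltr_wpDl // renorm_ge0.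
have Mb : 0 < renorm b + 1 by rewrite ltr_wpDl // renorm_ge0.
have e20 : 0 < e / 2 by rewrite divr_gt0.
near=> w.
have -> : cmul w.1 w.2 - cmul a b = cmul (w.1 - a) w.2 + cmul a (w.2 - b).
  by rewrite cmulBl cmulBr subrKA.
have wb : renorm w.2 <= renorm b + 1.
  have : renorm (w.2 - b) < 1.
    by near: w; exact: (cvg_renormP _ _).1 (snd_continuous (a, b)) _ ltr01.
  have := renormD (w.2 - b) b; rewrite subrK => le1 lt1.
  by rewrite (le_trans le1) // addrC lerD2l ltW.
rewrite (le_lt_trans (renormD _ _)) // (splitr e) ltrD //.
  apply: le_lt_trans (renormM _ _) _.
  apply: (@le_lt_trans _ _ (renorm (w.1 - a) * (renorm b + 1))).
    by rewrite ler_wpM2l // renorm_ge0.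
  rewrite -ltr_pdivlMr //; near: w.
  by apply: (cvg_renormP _ _).1 (fst_continuous (a, b)) _ _; rewrite divr_gt0.
apply: le_lt_trans (renormM _ _) _.
apply: (@le_lt_trans _ _ ((renorm a + 1) * renorm (w.2 - b))).
  by rewrite ler_wpM2r ?renorm_ge0 // lerDl.
rewrite -ltr_pdivlMl // mulrC; near: w.
by apply: (cvg_renormP _ _).1 (snd_continuous (a, b)) _ _; rewrite divr_gt0.
Unshelve. all: by end_near. Qed.

Definition cpow (x : A) n : A := iter n (cmul x) cone.
Definition geom (x : A) n : A := \sum_(k < n) cpow x k.

Lemma geom_mul x n : geom x n - cmul x (geom x n) = cone - cpow x n.
Proof.
elim: n => [|n IHn]; first by rewrite /geom big_ord0 cmul0 /cpow /= !subrr.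
rewrite /geom big_ord_recr /= -/(geom x n) cmulDr opprD addrACA IHn.
by rewrite /cpow /= addrA subrK.
Qed.

Lemma cpowSr x n : cmul (cpow x n) x = cmul x (cpow x n).
Proof.
elim: n => [|n IHn]; first by rewrite /cpow /= cmul1a cmula1.
by rewrite /cpow /= -cmulA -/(cpow x n) IHn.
Qed.

Lemma geom_comm x n : cmul (geom x n) x = cmul x (geom x n).
Proof.
elim: n => [|n IHn]; first by rewrite /geom big_ord0 cmul0 cmul0l.
by rewrite /geom big_ord_recr /= -/(geom x n) cmulDl cmulDr IHn cpowSr.
Qed.

Lemma renorm_cpow x n : renorm (cpow x n) <= renorm x ^+ n * renorm (cone : A).
Proof.
elim: n => [|n IHn]; first by rewrite expr0 mul1r.
rewrite /cpow /= exprS -mulrA; apply: le_trans (renormM _ _) _.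
by rewrite ler_wpM2l // renorm_ge0.
Qed.

Lemma renorm_geomB x m n : renorm x < 1 ->
  renorm (geom x (n + m) - geom x n) <= renorm x ^+ n * (renorm (cone : A) / (1 - renorm x)).
Proof.
move=> x1; have x0 := renorm_ge0 x; have x1' : 0 < 1 - renorm x by rewrite subr_gt0.
(* The induction on [m] closes only for the exact value of the finite geometric sum. *)
suff : renorm (geom x (n + m) - geom x n) <=
    renorm x ^+ n * (renorm (cone : A) / (1 - renorm x)) * (1 - renorm x ^+ m).
  move=> /le_trans; apply.
  have K0 : 0 <= renorm x ^+ n * (renorm (cone : A) / (1 - renorm x)).
    by rewrite mulr_ge0 ?exprn_ge0 // divr_ge0 ?renorm_ge0 // ltW.
  by rewrite ler_piMr // lerBlDr lerDl exprn_ge0.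
elim: m => [|m IHm]; first by rewrite addn0 subrr renorm0 expr0 subrr mulr0.
rewrite addnS /geom big_ord_recr /= -/(geom x (n + m)) -/(geom x n) addrAC.
apply: le_trans (renormD _ _) _; apply: le_trans (lerD IHm (renorm_cpow _ _)) _.
rewrite exprD exprS le_eqVlt; apply/orP; left; apply/eqP.
by field; rewrite gt_eqF.
Qed.

Lemma neumann_inverse (x : A) : renorm x < 1 ->
  exists y, cmul (cone - x) y = cone /\ cmul y (cone - x) = cone.
Proof.
move=> x1; have x0 := renorm_ge0 x.
have pow_cvg : renorm x ^+ n @[n --> \oo] --> (0 : R).
  by apply: cvg_expr; rewrite ger0_norm.
(* The summand 1 keeps [K] positive in the zero algebra. *)
pose K := renorm (cone : A) / (1 - renorm x) + 1.
have K0 : 0 < K by rewrite ltr_wpDl // divr_ge0 ?renorm_ge0 // subr_ge0 ltW.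
have small (e : R) : 0 < e -> \forall n \near \oo, renorm x ^+ n < e / K.
  move=> e0; have e'0 : 0 < e / K by rewrite divr_gt0.
  have abs_small : \forall n \near \oo, `|renorm x ^+ n| < e / K.
    by move: e'0; move: (e / K); apply/cvgr0Pnorm_lt.
  by apply: filterS abs_small => n; rewrite ger0_norm // exprn_ge0.
have geom_small (e : R) n m : 0 < e -> renorm x ^+ n < e / K ->
    renorm (geom x (n + m) - geom x n) < e.
  move=> e0 xn; apply: le_lt_trans (renorm_geomB m n x1) _.
  apply: (@le_lt_trans _ _ (renorm x ^+ n * K)); last by rewrite -ltr_pdivlMr.
  by rewrite ler_wpM2l ?exprn_ge0 // lerDl.
have geom_lim : cvg (geom x n @[n --> \oo]).
  apply: cauchy_cvg; apply: cauchy_exP => e e0.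
  have e_real : e = (complex.Re e)%:C.
    by case: e e0 => a b; rewrite ltcE /= => /andP[/eqP-> _].
  have re0 : 0 < complex.Re e by rewrite -ltcR -e_real.
  have [n _ /(_ n (leqnn n)) /= nP] := small _ re0.
  exists (geom x n); exists n => // m /= nm.
  rewrite -ball_normE /= renormE [ltRHS]e_real ltcR -renormN opprB -(subnKC nm).
  exact: geom_small.
have /cvg_ex[y geom_y] := geom_lim.
have pow0 : cpow x n @[n --> \oo] --> (0 : A).
  apply/cvg_renormP => e e0; apply: filterS (small e e0) => n xn; rewrite subr0.
  apply: le_lt_trans (renorm_cpow _ _) _.
  apply: (@le_lt_trans _ _ (renorm x ^+ n * K)); last by rewrite -ltr_pdivlMr.
  rewrite ler_wpM2l ?exprn_ge0 // /K.
  apply: (@le_trans _ _ (renorm (cone : A) / (1 - renorm x))); last by rewrite lerDl.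
  by rewrite ler_peMr ?renorm_ge0 // invf_ge1 ?subr_gt0 // lerBlDr lerDl.
have lim1 : cone - cpow x n @[n --> \oo] --> y - cmul x y.
  rewrite (_ : (fun n => cone - cpow x n) = fun n => geom x n - cmul x (geom x n)); last first.
    by apply/funext => n; rewrite geom_mul.
  apply: (@tvs_cvgB R (realified R A)) => //.
  have cx : (fun=> x) n @[n --> \oo] --> x by exact: cvg_cst.
  exact: cvg_comp2 cx geom_y (@cmul_continuous (x, y)).
have lim2 : cone - cpow x n @[n --> \oo] --> (cone - 0 : A).
  by apply: (@tvs_cvgB R (realified R A)) => //; exact: cvg_cst.
have lim3 : cone - cpow x n @[n --> \oo] --> y - cmul y x.
  rewrite (_ : (fun n => cone - cpow x n) = fun n => geom x n - cmul (geom x n) x); last first.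
    by apply/funext => n; rewrite geom_comm geom_mul.
  apply: (@tvs_cvgB R (realified R A)) => //.
  have cx : (fun=> x) n @[n --> \oo] --> x by exact: cvg_cst.
  exact: cvg_comp2 geom_y cx (@cmul_continuous (y, x)).
have [hA _] := seminormed_realified A.
have y1 : y - cmul x y = cone.
  by rewrite -[RHS]subr0; exact: (cvg_unique hA lim1 lim2).
have y2 : y - cmul y x = cone.
  by rewrite -[RHS]subr0; exact: (cvg_unique hA lim3 lim2).
by exists y; rewrite cmulBl cmulBr cmul1a cmula1.
Qed.

(** Factor b = a (1 - a' (a - b)) and invert the second factor by the Neumann series. *)
Lemma unit_near (a a' b : A) : cmul a a' = cone -> cmul a' a = cone ->
  renorm (b - a) * renorm a' < 1 ->
  exists b', cmul b b' = cone /\ cmul b' b = cone.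
Proof.
move=> aa' a'a ba.
have [|y [y1 y2]] := @neumann_inverse (cmul a' (a - b)).
  by apply: le_lt_trans (renormM _ _) _; rewrite mulrC -renormN opprB.
have bE : b = cmul a (cone - cmul a' (a - b)).
  by rewrite cmulBr cmula1 cmulA aa' cmul1a opprB subrKC.
exists (cmul y a'); split.
  by rewrite {1}bE -cmulA [cmul _ (cmul y _)]cmulA y1 cmul1a.
rewrite [b in LHS]bE cmulA -[cmul (cmul y a') a]cmulA a'a cmula1.
exact: y2.
Qed.

(** From b' = a' - a' (b - a) b' one gets |b'| <= |a'| + |b'| / 2. *)
Lemma renorm_inverse (a a' b b' : A) : cmul a a' = cone -> cmul a' a = cone ->
  cmul b b' = cone -> renorm (b - a) * renorm a' <= 2^-1 ->
  renorm b' <= 2 * renorm a'.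
Proof.
move=> aa' a'a bb' ba.
have b'E : b' = a' - cmul (cmul a' (b - a)) b'.
  by rewrite cmulBr cmulBl a'a cmul1a -cmulA bb' cmula1 opprB subrKC.
have : renorm b' <= renorm a' + 2^-1 * renorm b'.
  rewrite {1}b'E; apply: le_trans (renormD _ _) _; rewrite lerD2l renormN.
  apply: le_trans (renormM _ _) _; rewrite ler_wpM2r ?renorm_ge0 //.
  by apply: le_trans (renormM _ _) _; rewrite mulrC.
by lra.
Qed.

End CstarAlgebra.

(** * Calculus on Banach-Lie groups *)

Section LieGroupCalculus.
Context (R : realType) (E : completeNormedModType R).
Context (G : preTopologicalGroupType) (AG : set (chart G E)).
Hypothesis G_lie : is_banach_lie_group AG.
Implicit Types (d e k : chart G E) (g : G) (u v w x h : E).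

Let E_lc : seminormed_space E := seminormed_normed E.
Let EE_lc : seminormed_space (E * E)%type := seminormed_prod E_lc E_lc.

Lemma lie_chart d : AG d -> is_chart d.
Proof. by case: G_lie => _ [AG_chart _ _] _ _; exact: AG_chart. Qed.

Lemma lie_chart_ex g : exists2 d, AG d & cdom d g.
Proof. by case: G_lie => _ [_ AG_cover _] _ _; exact: AG_cover. Qed.

Lemma open_cdom d : AG d -> open (cdom d).
Proof. by move=> /lie_chart[]. Qed.

Lemma open_crange d : AG d -> open (crange d).
Proof. by move=> /lie_chart[]. Qed.

Lemma cinvK d g : AG d -> cdom d g -> cinv d (cfun d g) = g.
Proof. by move=> /lie_chart[_ _ dK _ _] dg; rewrite dK ?inE. Qed.

Lemma cfunK d u : AG d -> crange d u -> cfun d (cinv d u) = u.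
Proof. by move=> dA [g dg <-]; rewrite cinvK. Qed.

Lemma cdom_cinv d u : AG d -> crange d u -> cdom d (cinv d u).
Proof. by move=> dA [g dg <-]; rewrite cinvK. Qed.

Lemma crange_cfun d g : cdom d g -> crange d (cfun d g).
Proof. by exists g. Qed.

Lemma cinv_cvg d u : AG d -> crange d u -> cinv d @ u --> cinv d u.
Proof.
move=> dA du; case: (lie_chart dA) => _ dr _ _.
by rewrite continuous_open_subspace // => /(_ u); rewrite inE; exact.
Qed.

Lemma cfun_cvg d g : AG d -> cdom d g -> cfun d @ g --> cfun d g.
Proof.
move=> dA dg; case: (lie_chart dA) => dd _ _ + _.
by rewrite continuous_open_subspace // => /(_ g); rewrite inE; exact.
Qed.

Lemma near_cdom d g : AG d -> cdom d g -> \forall g' \near g, cdom d g'.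
Proof. by move=> dA dg; apply: open_nbhs_nbhs; split => //; exact: open_cdom. Qed.

Lemma near_crange d u : AG d -> crange d u -> \forall v \near u, crange d v.
Proof. by move=> dA du; apply: open_nbhs_nbhs; split => //; exact: open_crange. Qed.

Lemma mulg_continuous : continuous (fun p : G * G => (p.1 * p.2)%g).
Proof. by case: G_lie => _ _ []. Qed.

Lemma invg_continuous : continuous (fun g : G => (g^-1)%g).
Proof. by case: G_lie => _ _ _ []. Qed.

Lemma mulg_cvg T (Fi : set_system T) {FF : Filter Fi} (f f' : T -> G) g g' :
  f @ Fi --> g -> f' @ Fi --> g' -> (f t * f' t)%g @[t --> Fi] --> (g * g')%g.
Proof.
move=> fg fg'.
exact: (cvg_comp2 (b := fun g g' : G => (g * g')%g) fg fg' (@mulg_continuous (g, g'))).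
Qed.

Definition mul_dom d e k : set (E * E) :=
  [set w | [/\ crange d w.1, crange e w.2 & cdom k (cinv d w.1 * cinv e w.2)%g]].

Definition chart_mul d e k (w : E * E) : E :=
  cfun k (cinv d w.1 * cinv e w.2)%g.

Lemma cinv_mul_cvg d e (w : E * E) : AG d -> AG e -> crange d w.1 -> crange e w.2 ->
  (cinv d z.1 * cinv e z.2)%g @[z --> w] --> (cinv d w.1 * cinv e w.2)%g.
Proof.
move=> dA eA dw ew; apply: mulg_cvg.
  exact: cvg_comp (fst_continuous w) (cinv_cvg dA dw).
exact: cvg_comp (snd_continuous w) (cinv_cvg eA ew).
Qed.

Lemma open_mul_dom d e k : AG d -> AG e -> AG k -> open (mul_dom d e k).
Proof.
move=> dA eA kA; rewrite openE => w [dw ew kw]; rewrite /interior /=.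
have n1 : \forall z \near w, crange d z.1.
  exact: fst_continuous (near_crange dA dw).
have n2 : \forall z \near w, crange e z.2.
  exact: snd_continuous (near_crange eA ew).
have n3 : \forall z \near w, cdom k (cinv d z.1 * cinv e z.2)%g.
  exact: cinv_mul_cvg (near_cdom kA kw).
by near=> z; split; near: z.
Unshelve. all: by end_near. Qed.

Lemma chart_mul_Ck d e k (P : topologicalType) n : AG d -> AG e -> AG k ->
  Ck n (mul_dom d e k) (fun _ : P => chart_mul d e k).
Proof.
move=> dA eA kA; apply: smooth_on_Ck => //; [exact: open_mul_dom|].
case: G_lie => _ _ [_ mul_smooth] _.
have deA : prod_atlas AG AG (prod_chart d e) by exists d, e.
have := mul_smooth _ k deA kA; rewrite (_ : crange _ `&` _ = mul_dom d e k) //.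
apply/seteqP; split=> [[u v] [[[g g'] [/= dg eg']]]|[u v] [/= du ev kuv]].
  by move=> [<- <-] /=; rewrite !cinvK // => kgg'; split => /=; [exists g|exists g'|rewrite !cinvK].
split=> //; exists (cinv d u, cinv e v); last by rewrite /= !cfunK.
by split; exact: cdom_cinv.
Qed.

Definition inv_dom d e : set E :=
  [set u | crange d u /\ cdom e (cinv d u)^-1%g].

Lemma cinv_inv_cvg d u : AG d -> crange d u ->
  ((cinv d v)^-1)%g @[v --> u] --> ((cinv d u)^-1)%g.
Proof. by move=> dA du; exact: cvg_comp (cinv_cvg dA du) (@invg_continuous _). Qed.

Lemma open_inv_dom d e : AG d -> AG e -> open (inv_dom d e).
Proof.
move=> dA eA; rewrite openE => u [du eu]; rewrite /interior /=.
have n1 : \forall v \near u, crange d v by exact: near_crange.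
have n2 : \forall v \near u, cdom e (cinv d v)^-1%g.
  exact: cinv_inv_cvg (near_cdom eA eu).
by near=> z; split; near: z.
Unshelve. all: by end_near. Qed.

Lemma chart_inv_Ck d e (P : topologicalType) n : AG d -> AG e ->
  Ck n (inv_dom d e) (fun (_ : P) u => cfun e (cinv d u)^-1%g).
Proof.
move=> dA eA; apply: smooth_on_Ck => //; [exact: open_inv_dom|].
by case: G_lie => _ _ _ [_]; exact.
Qed.

Section ChartAtOne.
Context (c : chart G E) (c1 : chart_at1 AG c).

Let cA : AG c. Proof. by case: c1. Qed.
Let c_one : cdom c 1%g. Proof. by case: c1. Qed.

Definition origin : E := cfun c 1%g.

Lemma crange_origin : crange c origin. Proof. exact: crange_cfun. Qed.

Lemma cinv_origin : cinv c origin = 1%g. Proof. by rewrite cinvK. Qed.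

(* The left Maurer-Cartan form in the chart [d]. *)
Definition left_log d u h : E :=
  dderive (fun v => cfun c ((cinv d u)^-1 * cinv d v)%g) u h.

Lemma is_dderive_snd (f : E * E -> E) u v h y :
  is_dderive f (u, v) (0, h) y -> is_dderive (fun v => f (u, v)) v h y.
Proof.
apply: cvg_trans; apply: near_eq_cvg; apply: nearW => t /=.
rewrite (_ : (u, v) + t *: (0, h) = (u, v + t *: h)) //.
by apply: injective_projections; rewrite /= ?scaler0 ?addr0.
Qed.

Lemma is_dderive_fst (f : E * E -> E) u v h y :
  is_dderive f (u, v) (h, 0) y -> is_dderive (fun u => f (u, v)) u h y.
Proof.
apply: cvg_trans; apply: near_eq_cvg; apply: nearW => t /=.
rewrite (_ : (u, v) + t *: (h, 0) = (u + t *: h, v)) //.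
by apply: injective_projections; rewrite /= ?scaler0 ?addr0.
Qed.

(** The point [v] occurs both as the place of differentiation and inside the map. The map is
    therefore factored through the chart multiplication at [(iota v, v)], whose derivative in the
    second variable is a smooth family composed with a smooth map. A chart [e] for the inverses is
    available only near [u]. *)
Lemma left_log_local d u : AG d -> crange d u ->
  exists U (f : E * E -> E -> E),
  [/\ open U, U u, forall n, Ck n U (fun (h : E) v => f (0, h) v)
    & forall v h, U v ->
      is_dderive (fun w => cfun c ((cinv d v)^-1 * cinv d w)%g) v h (f (0, h) v)].
Proof.
move=> dA du; have [e eA eu] := lie_chart_ex (cinv d u)^-1%g.
pose iota v := cfun e (cinv d v)^-1%g.
pose f (z : E * E) v := dderive (chart_mul e d c) (iota v, v) z.
exists (inv_dom d e `&` crange d), f.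
have Uo : open (inv_dom d e `&` crange d).
  by apply: openI; [exact: open_inv_dom|exact: open_crange].
have iotaU v : (inv_dom d e `&` crange d) v -> mul_dom e d c (iota v, v).
  move=> [[_ ev] dv]; split=> //=; first exact: crange_cfun.
  by rewrite cinvK // mulVg.
split=> // [n|v h Uv].
  apply: (Ck_comp (V := mul_dom e d c) EE_lc E_lc
    (f := fun h (z : E * E) => dderive (chart_mul e d c) z (0, h))
    (g := fun _ v => (iota v, v))) => //.
  - exact: open_mul_dom.
  - have C := Ck_dderive (@chart_mul_Ck e d c (E * E)%type n.+1 eA dA cA).
    apply: (Ck_reparam (phi := fun h : E => ((0, h), (0, h))) _ C).
    by apply: pair_continuous; apply: pair_continuous => h;
      [exact: cvg_cst|exact: cvg_id|exact: cvg_cst|exact: cvg_id].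
  - apply: Ck_pair => //.
      apply: Ck_sub (chart_inv_Ck _ n dA eA); exact: subIsetl.
    exact: Ck_id.
have := dderivable_Ck (0 : E) (0, h) E_lc
  (@chart_mul_Ck e d c E 1%N eA dA cA) (iotaU v Uv).
move=> /is_dderive_snd; rewrite /chart_mul /= /iota cinvK //.
by case: Uv => [[]].
Qed.

Lemma left_logP d u h : AG d -> crange d u ->
  is_dderive (fun v => cfun c ((cinv d u)^-1 * cinv d v)%g) u h (left_log d u h).
Proof.
move=> dA du; have [U [f [_ Uu _ f_der]]] := left_log_local dA du.
by rewrite /left_log (dderive_eq E_lc (f_der u h Uu)); exact: f_der.
Qed.

Lemma left_log_Ck d n : AG d -> Ck n (crange d) (fun h u => left_log d u h).
Proof.
move=> dA; apply: Ck_local => u du.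
have [U [f [Uo Uu fC f_der]]] := left_log_local dA du.
exists U => //; apply: (Ck_near Uo _ (fC n)) => h v Uv.
by rewrite /left_log (dderive_eq E_lc (f_der v h Uv)).
Qed.

Lemma left_log_cvg d u h : AG d -> crange d u ->
  left_log d z.1 z.2 @[z --> (u, h)] --> left_log d u h.
Proof.
move=> dA du.
exact: (cvg_comp2 (b := fun h u => left_log d u h) (snd_continuous (u, h))
  (fst_continuous (u, h)) (Ck_cvg (left_log_Ck 0 dA) du)).
Qed.

Lemma left_log_linear d u : AG d -> crange d u -> linear (left_log d u).
Proof.
move=> dA du.
pose U := [set v | crange d v /\ cdom c ((cinv d u)^-1 * cinv d v)%g].
have [e eA eu] := lie_chart_ex (cinv d u)^-1%g.
have Uo : open U.
  rewrite openE => v [dv cv]; rewrite /interior /=.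
  have n1 : \forall w \near v, crange d w by exact: near_crange.
  have n2 : \forall w \near v, cdom c ((cinv d u)^-1 * cinv d w)%g.
    have cu : (fun=> (cinv d u)^-1%g) @ v --> (cinv d u)^-1%g by exact: cvg_cst.
    exact: mulg_cvg cu (cinv_cvg dA dv) _ (near_cdom cA cv).
  by near=> w; split; near: w.
apply: (dderive_linear E_lc (f := fun _ v => cfun c ((cinv d u)^-1 * cinv d v)%g)
  (0 : E) (V := U) (k := 0%N) Uo); last by split; rewrite // mulVg.
apply: (Ck_near Uo (f := fun _ v => chart_mul e d c (cfun e (cinv d u)^-1%g, v))).
  by move=> _ v _; rewrite /chart_mul /= cinvK.
apply: (Ck_comp EE_lc E_lc (V := mul_dom e d c) (f := fun _ (z : E * E) => chart_mul e d c z)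
  (g := fun _ v => (cfun e (cinv d u)^-1%g, v)) Uo).
- exact: open_mul_dom.
- by move=> _ v [dv cv]; split=> //=; [exact: crange_cfun|rewrite cinvK].
- exact: chart_mul_Ck.
- apply: Ck_pair => //; last exact: Ck_id.
  by apply: Ck_cst => //; exact: cst_continuous.
Unshelve. all: by end_near. Qed.

Lemma left_log_origin h : left_log c origin h = h.
Proof.
apply: (dderive_eq E_lc).
have : is_dderive (id : E -> E) origin h h by apply: is_dderive_lin => r x y.
apply: (is_dderive_near (open_crange cA) crange_origin) => v /[!inE] cv /=.
by rewrite cinv_origin invg1 mul1g cfunK.
Qed.

(** The right invariant vector field with value [x] at 1, read in the chart [d]. *)
Definition right_field d u x : E :=
  dderive (fun v => cfun d (cinv c v * cinv d u)%g) origin x.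

Lemma mul_dom_right d u : AG d -> crange d u -> mul_dom c d d (origin, u).
Proof.
move=> dA du; split=> //=; first exact: crange_origin.
by rewrite cinv_origin mul1g; exact: cdom_cinv.
Qed.

Lemma right_field_dderive d u x : AG d -> crange d u ->
  is_dderive (fun v => cfun d (cinv c v * cinv d u)%g) origin x
    (dderive (chart_mul c d d) (origin, u) (x, 0)).
Proof.
move=> dA du.
have := dderivable_Ck (0 : E) (x, 0) E_lc
  (@chart_mul_Ck c d d E 1%N cA dA dA) (mul_dom_right dA du).
by move=> /is_dderive_fst.
Qed.

Lemma right_fieldP d u x : AG d -> crange d u ->
  is_dderive (fun v => cfun d (cinv c v * cinv d u)%g) origin x (right_field d u x).
Proof.
move=> dA du; have der := @right_field_dderive _ _ x dA du.
by rewrite /right_field (dderive_eq E_lc der).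
Qed.

Lemma right_fieldZ d u r x : AG d -> crange d u ->
  right_field d u (r *: x) = r *: right_field d u x.
Proof.
by move=> dA du; apply: (dderive_eq E_lc); apply: (is_dderiveZ E_lc); exact: right_fieldP.
Qed.

Lemma right_field_cvg d u x : AG d -> crange d u ->
  right_field d z.1 z.2 @[z --> (u, x)] --> right_field d u x.
Proof.
move=> dA du.
rewrite {2}/right_field (dderive_eq E_lc (@right_field_dderive _ _ x dA du)).
have c1' : (origin, z.1) @[z --> (u, x)] --> (origin, u).
  have c0 : (fun=> origin) z @[z --> (u, x)] --> origin by exact: cvg_cst.
  exact: cvg_pair c0 (fst_continuous (u, x)).
have c2 : ((0 : E), (z.2, (0 : E))) @[z --> (u, x)] --> ((0 : E), (x, (0 : E))).
  have c0 : (fun=> (0 : E)) z @[z --> (u, x)] --> (0 : E) by exact: cvg_cst.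
  have c3 : (z.2, (0 : E)) @[z --> (u, x)] --> (x, (0 : E)).
    exact: cvg_pair (snd_continuous (u, x)) c0.
  exact: cvg_pair c0 c3.
have c4 : dderive (chart_mul c d d) (origin, z.1) (z.2, 0) @[z --> (u, x)] -->
    dderive (chart_mul c d d) (origin, u) (x, 0).
  exact: (cvg_comp2 (b := fun (z : E * (E * E)) (w : E * E) =>
    dderive (chart_mul c d d) w z.2) c2 c1'
    (Ck_cvg (Ck_dderive (@chart_mul_Ck c d d E 1%N cA dA dA)) (mul_dom_right dA du))).
apply: cvg_trans c4; apply: near_eq_cvg.
have cu : z.1 @[z --> (u, x)] --> u by exact: (fst_continuous (u, x)).
have n1 : \forall z \near (u, x), crange d z.1 by exact: cu (near_crange dA du).
apply: filterS n1 => z dz.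
by rewrite /right_field (dderive_eq E_lc (@right_field_dderive _ _ z.2 dA dz)).
Qed.

(* The inverse adjoint action [Ad(g^-1)] for [g = cinv d u]. *)
Definition adjoint_inv d u x : E := left_log d u (right_field d u x).

Lemma adjoint_invZ d u r x : AG d -> crange d u ->
  adjoint_inv d u (r *: x) = r *: adjoint_inv d u x.
Proof.
move=> dA du; rewrite /adjoint_inv right_fieldZ //.
exact: (linZ (left_log_linear dA du)).
Qed.

Lemma adjoint_inv_cvg d u x : AG d -> crange d u ->
  adjoint_inv d z.1 z.2 @[z --> (u, x)] --> adjoint_inv d u x.
Proof.
move=> dA du.
exact: (cvg_comp2 (b := fun u h => left_log d u h) (fst_continuous (u, x))
  (right_field_cvg dA du) (left_log_cvg dA du)).
Qed.

End ChartAtOne.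
End LieGroupCalculus.
Arguments left_log_cvg {R E G AG} _ {c} _ {d u} h _ _.
Arguments cinv_cvg {R E G AG} _ {d u} _ _.
Arguments cfun_cvg {R E G AG} _ {d g} _ _.
Arguments adjoint_inv_cvg {R E G AG} _ {c} _ {d u} x _ _.
Arguments left_logP {R E G AG} _ {c} _ {d u} h _ _.
Arguments right_fieldP {R E G AG} _ {c} _ {d u} x _ _.

(** * Topological vector spaces defined by seminorms *)

Section Subspaces.
Context (K : numFieldType) (V : lmodType K).

Definition subspace_closed (S : set V) : Prop :=
  S 0 /\ forall (k : K) a b, S a -> S b -> S (k *: a + b).

Context (S : set V) (S_closed : subspace_closed S).

(** The closure proof is an argument so that the submodule structure can be attached to the
    predicate. *)
Definition in_subspace of subspace_closed S : {pred V} := [pred a | a \in S].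

Definition subspace : Type := {a : V | in_subspace S_closed a}.

HB.instance Definition _ := SubChoice.on subspace.

Fact subspace_submod_closed : submod_closed (in_subspace S_closed).
Proof.
case: (S_closed) => S0 SD; split; first exact: mem_set.
by move=> k a b /set_mem aS /set_mem bS; exact/mem_set/SD.
Qed.

HB.instance Definition _ :=
  GRing.isSubmodClosed.Build K V (in_subspace S_closed) subspace_submod_closed.

HB.instance Definition _ := [SubChoice_isSubLmodule of subspace by <:].

Lemma subspace_valP (v : subspace) : S (val v).
Proof. exact/set_mem/(valP v). Qed.

Definition to_subspace (a : V) (aS : S a) : subspace := exist _ a (mem_set aS).

End Subspaces.

Section SeminormedSpaces.
Context (R : realType) (V : lmodType R[i]).

Definition seminorm_family (q : nat -> V -> R) : Prop :=
  forall n, (forall x y, q n (x + y) <= q n x + q n y) /\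
    forall (k : R[i]) x, q n (k *: x) = complex.Re `|k| * q n x.

Context (q : nat -> V -> R) (qP : seminorm_family q).

Definition seminormed of seminorm_family q : Type := V.

Local Notation B := (seminormed qP).

HB.instance Definition _ := GRing.Lmodule.on B.

Implicit Types (x y z : B) (n : nat) (e : R).

Lemma snD n x y : q n (x + y) <= q n x + q n y.
Proof. by case: (qP n). Qed.

Lemma snZ n (k : R[i]) x : q n (k *: x) = complex.Re `|k| * q n x.
Proof. by case: (qP n). Qed.

Lemma sn0 n : q n 0 = 0.
Proof. by rewrite -(scale0r (0 : B)) snZ normr0 mul0r. Qed.

Lemma snN n x : q n (- x) = q n x.
Proof. by rewrite -scaleN1r snZ normrN1 mul1r. Qed.

Lemma sn_tri n z x y : q n (x - y) <= q n (x - z) + q n (z - y).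
Proof. by rewrite -[x - y](subrKA z); exact: snD. Qed.

Lemma sn_ge0 n x : 0 <= q n x.
Proof.
have := snD n x (- x); rewrite subrr sn0 snN -mulr2n.
by rewrite pmulrn_lge0.
Qed.

(** Balls for all seminorms up to [n], the shape used in [is_smooth_vector_space], so that the
    neighbourhoods agree by definition. *)
Definition sn_ball n e x : set B := [set y | forall k, (k <= n)%N -> q k (y - x) < e].

Definition sn_nbhs x : set_system B :=
  [set W | exists n e, 0 < e /\ sn_ball n e x `<=` W].

HB.instance Definition _ := hasNbhs.Build B sn_nbhs.

Fact sn_nbhs_filter x : ProperFilter (sn_nbhs x).
Proof.
split=> [[n [e [e0 eW]]]|].
  by apply: (eW x) => k _; rewrite subrr sn0.
split; first by exists 0%N, 1; split => //; exact: ltr01.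
  move=> W W' [n [e [e0 eW]]] [n' [e' [e'0 e'W']]].
  exists (maxn n n'), (Num.min e e'); split; first by rewrite lt_min e0.
  move=> y yB; split; [apply: eW|apply: e'W'] => k kn.
    by have := yB k (leq_trans kn (leq_maxl _ _)); rewrite lt_min => /andP[].
  by have := yB k (leq_trans kn (leq_maxr _ _)); rewrite lt_min => /andP[].
by move=> W W' WW' [n [e [e0 eW]]]; exists n, e; split => // y /eW /WW'.
Qed.

Fact sn_nbhs_singleton x (W : set B) : sn_nbhs x W -> W x.
Proof. by move=> [n [e [e0 eW]]]; apply: eW => k _; rewrite subrr sn0. Qed.

Fact sn_ball_nbhs n e x y : sn_ball n e x y -> sn_nbhs y (sn_ball n e x).
Proof.
move=> yB.
(* Finitely many strict inequalities leave a common margin [d]. *)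
suff [d d0 dP] : exists2 d : R, 0 < d & forall k, (k <= n)%N -> q k (y - x) + d <= e.
  exists n, d; split => // z zB k kn; apply: le_lt_trans (sn_tri k y z x) _.
  by rewrite addrC; apply: lt_le_trans (dP k kn); rewrite ltrD2l; exact: zB.
elim: n yB => [|n IHn] yB.
  exists (e - q 0%N (y - x)) => [|k]; first by rewrite subr_gt0; exact: yB.
  by rewrite leqn0 => /eqP ->; rewrite subrKC.
have [|d d0 dP] := IHn; first by move=> k kn; apply: yB; rewrite leqW.
exists (Num.min d (e - q n.+1 (y - x))) => [|k].
  by rewrite lt_min d0 subr_gt0; exact: yB.
rewrite leq_eqVlt => /orP[/eqP->|kn].
  by rewrite addrC -lerBrDr ge_min lexx orbT.
by apply: le_trans (dP k kn); rewrite lerD2l ge_min lexx.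
Qed.

Fact sn_nbhs_nbhs x (W : set B) : sn_nbhs x W -> sn_nbhs x (sn_nbhs^~ W).
Proof.
move=> [n [e [e0 eW]]]; exists n, e; split => // y /sn_ball_nbhs[m [d [d0 dB]]].
by exists m, d; split => // z /dB /eW.
Qed.

HB.instance Definition _ := Nbhs_isNbhsTopological.Build B
  sn_nbhs_filter sn_nbhs_singleton sn_nbhs_nbhs.

Lemma cvg_snP T (Fi : set_system T) {FF : Filter Fi} (f : T -> B) x :
  f @ Fi --> x <-> forall n e, 0 < e -> \forall t \near Fi, q n (f t - x) < e.
Proof.
split=> [fx n e e0|fx W [n [e [e0 eW]]]].
  have xB : nbhs x [set y | q n (y - x) < e].
    by exists n, e; split => // y yB; exact: yB.
  exact: fx _ xB.
suff : \forall t \near Fi, sn_ball n e x (f t) by apply: filterS => t /eW.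
elim: n {eW} => [|n IHn].
  by apply: filterS (fx 0%N e e0) => t ft k; rewrite leqn0 => /eqP->.
apply: filterS2 IHn (fx n.+1 e e0) => t tB ft k.
by rewrite leq_eqVlt => /orP[/eqP->//|]; exact: tB.
Qed.

Fact sn_add_continuous : continuous (fun z : B * B => z.1 + z.2).
Proof.
move=> [x y]; apply/cvg_snP => n e e0.
have e20 : 0 < e / 2 by rewrite divr_gt0.
near=> z.
have zx : q n (z.1 - x) < e / 2.
  by near: z; exact: (cvg_snP _ _).1 (fst_continuous (x, y)) n _ e20.
have zy : q n (z.2 - y) < e / 2.
  by near: z; exact: (cvg_snP _ _).1 (snd_continuous (x, y)) n _ e20.
by rewrite opprD addrACA (splitr e); apply: le_lt_trans (snD _ _ _) _; rewrite ltrD.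
Unshelve. all: by end_near. Qed.

Fact sn_scale_continuous : continuous (fun z : R[i]^o * B => z.1 *: z.2).
Proof.
move=> [r x]; apply/cvg_snP => n e e0.
pose M := complex.Re `|r| + 1.
have r_ge0 (s : R[i]) : 0 <= complex.Re `|s|.
  by have := normr_ge0 s; rewrite lecE => /andP[].
have M0 : 0 < M by rewrite ltr_wpDl.
have Q0 : 0 < q n x + 1 by rewrite ltr_wpDl // sn_ge0.
have e20 : 0 < e / 2 by rewrite divr_gt0.
have eQ0 : 0 < e / 2 / (q n x + 1) by rewrite divr_gt0.
have eM0 : 0 < e / 2 / M by rewrite divr_gt0.
have cr : z.1 @[z --> (r : R[i]^o, x)] --> (r : R[i]^o) by exact: cvg_fst.
have cx : z.2 @[z --> (r : R[i]^o, x)] --> x by exact: cvg_snd.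
have renorm_r (d : R) : 0 < d -> \forall z \near (r : R[i]^o, x), complex.Re `|z.1 - r| < d.
  move=> d0; exact: (@cvg_renormP R R[i]^o _ _ _ _ r).1 cr d d0.
near=> z.
have -> : z.1 *: z.2 - r *: x = z.1 *: (z.2 - x) + (z.1 - r) *: x.
  by rewrite scalerBr scalerBl subrKA.
apply: le_lt_trans (snD _ _ _) _; rewrite (splitr e) !snZ ltrD //.
  have zM : complex.Re `|z.1| <= M.
    have r1 : complex.Re `|z.1 - r| < 1 by near: z; exact: renorm_r ltr01.
    rewrite -[z.1](subrK r); apply: le_trans (@renormD R R[i]^o (z.1 - r) r) _.
    by rewrite addrC lerD2l ltW.
  apply: (@le_lt_trans _ _ (M * q n (z.2 - x))); first by rewrite ler_wpM2r // sn_ge0.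
  rewrite -ltr_pdivlMl // mulrC; near: z.
  exact: (cvg_snP _ _).1 cx n _ eM0.
apply: (@le_lt_trans _ _ (complex.Re `|z.1 - r| * (q n x + 1))).
  by rewrite ler_wpM2l // lerDl.
by rewrite -ltr_pdivlMr //; near: z; exact: renorm_r.
Unshelve. all: by end_near. Qed.

Fact sn_locally_convex : exists2 Bs : set_system B,
  (forall b, b \in Bs -> convex_set b) & basis Bs.
Proof.
exists [set b | exists n e x, b = sn_ball n e x].
  move=> _ /[!inE] -[n [e [x ->]]]; apply/convex_setW => y z /[!inE] yB zB l l0 l1.
  rewrite inE /conv /= => k kn.
  set r : R[i] := l%:num in l0 l1 *; have r0 : 0 <= r by exact: ltW.
  have r1 : 0 <= 1 - r by rewrite subr_ge0 ltW.
  have -> : (r *: (y : B) + unstable.onem r *: (z : B) - x : B) =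
      r *: (y - x : B) + (1 - r) *: (z - x : B).
    by rewrite !scalerBr addrACA -opprD -scalerDl subrKC scale1r.
  have [y_lt z_lt] := (yB k kn, zB k kn).
  apply: le_lt_trans (snD _ _ _) _; rewrite !snZ !ger0_norm //.
  have rr : complex.Re r + complex.Re (1 - r) = 1 by rewrite -raddfD /= subrKC.
  have rr1 : 0 <= complex.Re (1 - r) by move: r1; rewrite lecE => /andP[].
  have rr0 : 0 < complex.Re r by move: l0; rewrite ltcE => /andP[].
  rewrite -[e]mul1r -rr mulrDl ltr_leD ?ltr_pM2l //.
  by rewrite ler_wpM2l // ltW.
split=> [_ [n [e [x ->]]]|x W [n [e [e0 eW]]]].
  by rewrite openE => y /sn_ball_nbhs.
exists (sn_ball n e x) => //; split; first by exists n, e, x.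
by move=> k _; rewrite subrr sn0.
Qed.

HB.instance Definition _ := PreTopologicalLmod_isTvs.Build R[i] B
  sn_add_continuous sn_scale_continuous sn_locally_convex.

HB.instance Definition _ :=
  PreTopologicalNmodule_isTopologicalNmodule.Build B sn_add_continuous.
HB.instance Definition _ :=
  TopologicalNmodule_isTopologicalLmodule.Build R[i] B sn_scale_continuous.
HB.instance Definition _ := Uniform_isTvs.Build R[i] B sn_locally_convex.

End SeminormedSpaces.

(** * Smooth vectors *)

Section SmoothVectors.
Context (R : realType) (E : completeNormedModType R).
Context (G : preTopologicalGroupType) (AG : set (chart G E)).
Context (A : unitalCstarAlgType R) (alpha : G -> A -> A).
Context (c : chart G E) (expG : E -> G).
Hypotheses (G_lie : is_banach_lie_group AG)
  (alpha_sys : is_cstar_dynamical_system alpha)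
  (c1 : chart_at1 AG c) (expG_exp : is_exponential AG c expG).
Implicit Types (d e k : chart G E) (g : G) (u v w x h : E) (a b : A).

Let E_lc : seminormed_space E := seminormed_normed E.
Let EE_lc : seminormed_space (E * E)%type := seminormed_prod E_lc E_lc.
Let A_lc : seminormed_space (realified R A) := seminormed_realified A.
Let cA : AG c. Proof. by case: c1. Qed.
Let c_one : cdom c 1%g. Proof. by case: c1. Qed.
Local Notation o := (origin c).
Local Notation dpi := (dpi alpha expG).
Local Notation sv := (smooth_vectors AG alpha).

Lemma alphaM g g' a : alpha (g * g')%g a = alpha g (alpha g' a).
Proof. by case: alpha_sys. Qed.

Lemma alpha1 a : alpha 1%g a = a.
Proof.
case: alpha_sys => /(_ 1%g)[[f fK _] _ _ _] _ _.
by apply: (can_inj fK); rewrite -alphaM mulg1.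
Qed.

Lemma alphaK g a : alpha (g^-1)%g (alpha g a) = a.
Proof. by rewrite -alphaM mulVg alpha1. Qed.

Lemma alpha_linearC g (k : R[i]) a b : alpha g (k *: a + b) = k *: alpha g a + alpha g b.
Proof. by case: alpha_sys => /(_ g)[]. Qed.

Lemma alpha_cmul g a b : alpha g (cmul a b) = cmul (alpha g a) (alpha g b).
Proof. by case: alpha_sys => /(_ g)[]. Qed.

Lemma alpha_star g a : alpha g (star a) = star (alpha g a).
Proof. by case: alpha_sys => /(_ g)[]. Qed.

Lemma alpha_cone g : alpha g cone = cone.
Proof.
rewrite -[RHS](alphaK (g^-1)%g) invgK -[alpha g^-1%g cone]cmul1a alpha_cmul.
by rewrite -alphaM mulgV alpha1 cmula1.
Qed.

Lemma alpha_linear g : linear (alpha g : realified R A -> realified R A).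
Proof. by move=> r a b; rewrite !realified_scale alpha_linearC. Qed.

Lemma alpha_cvg T (Fi : set_system T) {FF : Filter Fi} (f : T -> G) (f' : T -> A) g a :
  f @ Fi --> g -> f' @ Fi --> a -> alpha (f t) (f' t) @[t --> Fi] --> alpha g a.
Proof.
move=> fg fa; case: alpha_sys => _ _ alpha_cont.
exact: cvg_comp2 fg fa (alpha_cont (g, a)).
Qed.

Lemma alpha_continuous g : continuous (alpha g).
Proof. by move=> a; apply: alpha_cvg; [exact: cvg_cst|exact: cvg_id]. Qed.

(** Continuity of the action at [(g0, 0)] bounds it on a ball around 0, and homogeneity spreads the
    bound over [A]. *)
Lemma alpha_locally_bounded g0 : exists2 C : R, 0 < C &
  \forall g \near g0, forall a, renorm (alpha g a) <= C * renorm a.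
Proof.
case: alpha_sys => _ _ /(_ (g0, 0)).
move=> /cvg_renormP /(_ 1 ltr01) /= [[V W] /= [Vg0 /nbhs0_renorm[r r0 rW]] VW].
exists (2 / r); first by rewrite divr_gt0.
apply: filterS Vg0 => g Vg a.
have [a0|a0] := leP (renorm a) 0.
  have -> : a = 0 by apply: renorm_eq0; apply/le_anti; rewrite a0 renorm_ge0.
  by rewrite (lin0 (alpha_linear g)) renorm0 mulr0.
(* Scales [a] to norm [r / 2], inside the ball of radius [r]; hence the constant [2 / r]. *)
pose s := r / 2 / renorm a.
have s0 : 0 < s by rewrite !divr_gt0.
have := VW (g, s%:C *: a); rewrite /= (lin0 (alpha_linear g0)) subr0.
rewrite (linZ (alpha_linear g) s a) realified_scale renormZr gtr0_norm // => sa.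
have {}sa : s * renorm (alpha g a) < 1.
  apply: sa; split=> //; apply: rW; rewrite /= renormZr gtr0_norm //.
  by rewrite divfK ?gt_eqF // ltr_pdivrMr // ltr_pMr // ltr1n.
rewrite -(ler_pM2l s0) (le_trans (ltW sa)) //.
have r_neq0 : r != 0 by rewrite gt_eqF.
have a_neq0 : renorm a != 0 by rewrite gt_eqF.
by rewrite (_ : s * _ = 1) // /s; field; rewrite r_neq0 a_neq0.
Qed.

Lemma exp0 x : expG (0 *: x) = 1%g.
Proof.
have [expD _ _] := expG_exp x.
by have := expD 0 0; rewrite addr0 -[LHS]mulg1 => /mulgI.
Qed.

Lemma expD x s t : expG ((s + t) *: x) = (expG (s *: x) * expG (t *: x))%g.
Proof. by have [expD _ _] := expG_exp x. Qed.

Lemma exp_continuous x : continuous (fun t : R => expG (t *: x)).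
Proof. by have [_ [exp_cont _] _] := expG_exp x. Qed.

(** The vector may depend on a parameter so that jets whose directions vary are covered. *)
Definition smooth_vector_family (P : topologicalType) (b : P -> A) :=
  forall d n, AG d ->
    Ck n (crange d) (fun p u => alpha (cinv d u) (b p) : realified R A).

(** A point of [P] is given because families over the empty space are smooth vacuously. *)
Lemma smooth_vectorP a (P : topologicalType) (p : P) :
  sv a <-> smooth_vector_family (fun _ : P => a).
Proof.
split=> [[_ a_smooth] d n dA|a_fam].
  have := a_smooth d _ dA (erefl _).
  rewrite preimage_setT setIT => /smooth_on_Ck; apply=> //.
  exact: open_crange dA.
split; first by move=> g; apply: alpha_cvg; [exact: cvg_id|exact: cvg_cst].
move=> d e dA ->; rewrite preimage_setT setIT.
apply: Ck_smooth_on => // [|Q n]; first exact: open_crange dA.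
exact: (Ck_reparam (@cst_continuous Q P p) (a_fam d n dA)).
Qed.

Lemma sv_Ck a (P : topologicalType) d n : sv a -> AG d ->
  Ck n (crange d) (fun (_ : P) u => alpha (cinv d u) a : realified R A).
Proof.
move=> /(smooth_vectorP a (0 : E)) a_fam dA.
exact: (Ck_reparam (@cst_continuous P E 0) (a_fam d n dA)).
Qed.

Lemma sv_curve_chart a x (gam : R^o -> G) : sv a ->
  is_dderive (fun t => cfun c (gam t)) 0 1 x -> gam @ 0 --> gam 0 -> gam 0 = 1%g ->
  is_dderive (fun t => alpha (gam t) a : realified R A) 0 1
    (dderive (fun u => alpha (cinv c u) a : realified R A) o x).
Proof.
move=> a_sv gam_x gam_cont gam0.
have oc : crange c (cfun c (gam 0)) by rewrite gam0; exact: crange_cfun.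
have near_c : \forall t \near (0 : R^o), cdom c (gam t).
  have : \forall g \near gam 0, cdom c g by rewrite gam0; exact: (near_cdom G_lie cA).
  exact: gam_cont.
have := is_dderive_comp_Ck A_lc (0 : E) (open_crange G_lie cA) (sv_Ck E 2 a_sv cA) oc gam_x.
rewrite /origin -gam0; apply: is_dderive_eq_near.
by apply: filterS near_c => t ct; rewrite /= (cinvK G_lie).
Qed.

Lemma dpi_chart a x : sv a -> is_dderive
    (fun t : R^o => alpha (expG (t *: x)) a : realified R A) 0 1 (dpi x a) /\
  dpi x a = dderive (fun u => alpha (cinv c u) a : realified R A) o x.
Proof.
move=> a_sv; have [_ _ exp_x] := expG_exp x.
have := sv_curve_chart a_sv exp_x (@exp_continuous x 0) (exp0 x).
by move=> der; rewrite /Defs.dpi (dderive_eq A_lc der).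
Qed.

Lemma dpiP a x : sv a -> is_dderive
  (fun t : R^o => alpha (expG (t *: x)) a : realified R A) 0 1 (dpi x a).
Proof. by move=> /(dpi_chart x)[]. Qed.

(** The chain rule in the chart [c] shows that only the velocity of the curve at 1 matters, so the
    exponential curve may be replaced by any other one. *)
Lemma sv_curve a x (gam : R^o -> G) : sv a ->
  is_dderive (fun t => cfun c (gam t)) 0 1 x -> gam @ 0 --> gam 0 -> gam 0 = 1%g ->
  is_dderive (fun t => alpha (gam t) a : realified R A) 0 1 (dpi x a).
Proof.
by move=> a_sv gx g0 g1; have [_ ->] := dpi_chart x a_sv; exact: sv_curve_chart.
Qed.

(** The operator at [cinv d u] is pulled out; what remains is the orbit along the curve [gam]
    through 1, whose velocity is [left_log c d u h] by definition. *)
Lemma dorbit a d u h : sv a -> AG d -> crange d u ->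
  is_dderive (fun v => alpha (cinv d v) a : realified R A) u h
    (alpha (cinv d u) (dpi (left_log c d u h) a)).
Proof.
move=> a_sv dA du; apply/is_dderive_line.
pose gam (t : R^o) := ((cinv d u)^-1 * cinv d (u + t *: h))%g.
have gam0 : gam 0 = 1%g by rewrite /gam scale0r addr0 mulVg.
have gam_cont : gam @ 0 --> gam 0.
  have g0 : (fun=> (cinv d u)^-1%g) @ (0 : R^o) --> (cinv d u)^-1%g by exact: cvg_cst.
  apply: (mulg_cvg G_lie g0); rewrite scale0r addr0.
  exact: cvg_comp (line_cvg u h) (cinv_cvg G_lie dA du).
have gam_x : is_dderive (fun t => cfun c (gam t)) 0 1 (left_log c d u h).
  exact: (is_dderive_line _ _ _ _).1 (left_logP G_lie c1 h dA du).
have := is_dderive_postlin (alpha_linear (cinv d u)) (@alpha_continuous (cinv d u))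
  (sv_curve a_sv gam_x gam_cont gam0).
rewrite (_ : _ \o _ = fun t : R^o => alpha (cinv d (u + t *: h)) a) //.
by apply/funext => t; rewrite /= -alphaM /gam mulVKg.
Qed.

Lemma dpi_linear a : sv a -> linear (fun x => dpi x a : realified R A).
Proof.
move=> a_sv r x y; rewrite !(dpi_chart _ a_sv).2.
exact: (dderive_linear A_lc (0 : E) (open_crange G_lie cA) (sv_Ck E 1 a_sv cA)
  (crange_origin c1)).
Qed.

(** For g = [cinv d u], the vector [alpha g (dpi x b)] is the derivative at [v = o] in the direction
    [x] of the orbit of [b] along the products [g * cinv c v]. It is thus a partial derivative of
    the smooth map [f] at [(u, o)], smooth jointly in the point, the parameter and [x]. *)
Lemma sv_family_dpi (P : topologicalType) (b : P -> A) : smooth_vector_family b ->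
  smooth_vector_family (fun z : P * E => dpi z.2 (b z.1)).
Proof.
move=> b_fam d n dA.
have b_sv p : sv (b p).
  apply/(smooth_vectorP _ (0 : E)) => e m eA.
  exact: (Ck_reparam (@cst_continuous E P p) (b_fam e m eA)).
pose f p (z : E * E) := alpha (cinv d (chart_mul d c d z)) (b p) : realified R A.
have Uo := open_crange G_lie dA.
have Mo := open_mul_dom G_lie dA cA dA.
(* One order more than the goal, spent on the partial derivative. *)
have fC : Ck n.+1 (mul_dom d c d) f.
  apply: (Ck_comp E_lc A_lc Mo Uo (f := fun p u => alpha (cinv d u) (b p) : realified R A)
    (g := fun _ => chart_mul d c d)) => [_ z [_ _ ?]||].
  - exact: crange_cfun.
  - exact: b_fam.
  - exact: (chart_mul_Ck G_lie _ _ dA cA dA).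
have Mu u : crange d u -> mul_dom d c d (u, o).
  move=> du; split=> //=; first exact: (crange_origin c1).
  by rewrite (cinv_origin G_lie c1) mulg1; exact: (cdom_cinv G_lie).
have C : Ck n (crange d) (fun (z : P * E) u => dderive (f z.1) (u, o) (0, z.2)).
  apply: (Ck_comp EE_lc A_lc Uo Mo
    (f := fun (z : P * E) y => dderive (f z.1) y (0, z.2)) (g := fun _ u => (u, o))).
  - by move=> _; exact: Mu.
  - apply: (Ck_reparam (phi := fun z : P * E => (z.1, (0 : E, z.2))) _ (Ck_dderive fC)).
    apply: pair_continuous => z; first exact: fst_continuous.
    have c0 : (fun=> 0 : E) @ z --> (0 : E) by exact: cvg_cst.
    exact: cvg_pair c0 (snd_continuous z).
  - apply: Ck_pair => //; first exact: Ck_id.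
    by apply: Ck_cst => //; exact: cst_continuous.
apply: (Ck_near Uo _ C) => -[p x] u du /=; apply: (dderive_eq A_lc).
have : is_dderive (fun v => alpha (cinv d u) (alpha (cinv c v) (b p)) : realified R A) o x
    (alpha (cinv d u) (dpi x (b p))).
  have := is_dderive_postlin (alpha_linear (cinv d u)) (@alpha_continuous (cinv d u))
    (@dorbit (b p) c o x (b_sv p) cA (crange_origin c1)).
  by rewrite (left_log_origin G_lie c1) (cinv_origin G_lie c1) alpha1.
move=> /(is_dderive_eq_near (g := fun v => f p (u, v))) der.
have {}der : is_dderive (fun v => f p (u, v)) o x (alpha (cinv d u) (dpi x (b p))).
  apply: der.
  have cv : (cinv d u * cinv c v)%g @[v --> o] --> (cinv d u * cinv c o)%g.
    have g0 : (fun=> cinv d u) @ o --> cinv d u by exact: cvg_cst.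
    exact: (mulg_cvg G_lie g0 (cinv_cvg G_lie cA (crange_origin c1))).
  have [_ _ dcu] := Mu u du.
  have n1 : \forall v \near o, cdom d (cinv d u * cinv c v)%g.
    exact: cv (near_cdom G_lie dA dcu).
  apply: filterS n1 => v dv.
  by rewrite /f /chart_mul /= (cinvK G_lie) // alphaM.
move: der; apply: cvg_trans; apply: near_eq_cvg; apply: nearW => t /=.
rewrite (_ : (u, o) + t *: (0, x) = (u, o + t *: x)) //.
by apply: injective_projections; rewrite /= ?scaler0 ?addr0.
Qed.

Lemma svP a : (forall d n, AG d ->
  Ck n (crange d) (fun (_ : E) u => alpha (cinv d u) a : realified R A)) -> sv a.
Proof. by move=> aC; apply/(smooth_vectorP a (0 : E)). Qed.

Lemma sv_linear (k : R[i]) a b : sv a -> sv b -> sv (k *: a + b).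
Proof.
move=> a_sv b_sv; apply: svP => d n dA; have Uo := open_crange G_lie dA.
have k_lin : linear ( *:%R k : realified R A -> realified R A).
  by move=> r x y; rewrite !realified_scale scalerDr !scalerA mulrC.
have k_cont : continuous ( *:%R k : A -> A).
  by move=> x; apply: (@cvgZ _ A); [exact: cvg_cst|exact: cvg_id].
have C := CkD A_lc Uo (Ck_postlin A_lc A_lc Uo k_lin k_cont (sv_Ck E n a_sv dA))
  (sv_Ck E n b_sv dA).
by apply: (Ck_near Uo _ C) => p u _; rewrite alpha_linearC.
Qed.

Lemma sv_cone : sv cone.
Proof.
apply: svP => d n dA; have Uo := open_crange G_lie dA.
have C : Ck n (crange d) (fun (_ : E) (_ : E) => cone : realified R A).
  by apply: Ck_cst => //; exact: cst_continuous.
by apply: (Ck_near Uo _ C) => p u _; rewrite alpha_cone.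
Qed.

Lemma sv_0 : sv 0.
Proof.
have := sv_linear (-1) sv_cone sv_cone.
by rewrite scaleN1r addNr.
Qed.

Lemma sv_add a b : sv a -> sv b -> sv (a + b).
Proof. by move=> a_sv b_sv; rewrite -[a]scale1r; exact: sv_linear. Qed.

Lemma sv_scale (k : R[i]) a : sv a -> sv (k *: a).
Proof. by move=> a_sv; rewrite -[_ *: _]addr0; apply: sv_linear => //; exact: sv_0. Qed.

Lemma sv_sub a b : sv a -> sv b -> sv (a - b).
Proof. by move=> a_sv b_sv; rewrite addrC -scaleN1r; exact: sv_linear. Qed.

Lemma sv_cmul a b : sv a -> sv b -> sv (cmul a b).
Proof.
move=> a_sv b_sv; apply: svP => d n dA; have Uo := open_crange G_lie dA.
have C := Ck_bilin A_lc A_lc A_lc Uo (@cmul_linearr R A) (@cmul_linearl R A)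
  (@cmul_continuous R A) (sv_Ck E n a_sv dA) (sv_Ck E n b_sv dA).
by apply: (Ck_near Uo _ C) => p u _; rewrite alpha_cmul.
Qed.

Lemma sv_star a : sv a -> sv (star a).
Proof.
move=> a_sv; apply: svP => d n dA; have Uo := open_crange G_lie dA.
have C := Ck_postlin A_lc A_lc Uo (@star_linear R A) (@star_continuous R A)
  (sv_Ck E n a_sv dA).
by apply: (Ck_near Uo _ C) => p u _; rewrite alpha_star.
Qed.

(** The orbit map of [alpha g a] is that of [a] after right translation by [g], which in charts is
    the multiplication with its second argument fixed. *)
Lemma sv_alpha g a : sv a -> sv (alpha g a).
Proof.
move=> a_sv; apply: svP => d n dA; apply: Ck_local => u0 du0.
have [e eA eg] := lie_chart_ex G_lie g.
have [k kA ku] := lie_chart_ex G_lie (cinv d u0 * g)%g.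
pose U := [set u | crange d u /\ cdom k (cinv d u * g)%g].
have gc : crange e (cfun e g) by exact: crange_cfun.
have Uo : open U.
  rewrite openE => u [du kug]; rewrite /interior /=.
  have cu : (cinv d v * g)%g @[v --> u] --> (cinv d u * g)%g.
    have g0 : (fun=> g) @ u --> g by exact: cvg_cst.
    exact: (mulg_cvg G_lie (cinv_cvg G_lie dA du) g0).
  have n1 : \forall v \near u, crange d v by exact: (near_crange G_lie dA du).
  have n2 : \forall v \near u, cdom k (cinv d v * g)%g by exact: cu (near_cdom G_lie kA kug).
  by near=> v; split; near: v.
exists U => //.
have Mo := open_mul_dom G_lie dA eA kA; have ko := open_crange G_lie kA.
have C : Ck n U (fun (_ : E) u =>
    alpha (cinv k (chart_mul d e k (u, cfun e g))) a : realified R A).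
  apply: (Ck_comp E_lc A_lc (V := crange k)
    (f := fun _ v => alpha (cinv k v) a : realified R A)
    (g := fun _ u => chart_mul d e k (u, cfun e g))) => //.
  - move=> _ u [du ku']; rewrite /chart_mul /= (cinvK G_lie) //; exact: crange_cfun.
  - exact: sv_Ck.
  apply: (Ck_comp EE_lc E_lc (V := mul_dom d e k)
    (f := fun _ => chart_mul d e k) (g := fun _ u => (u, cfun e g))) => //.
  - by move=> _ u [du ku']; split=> //=; rewrite (cinvK G_lie).
  - exact: (chart_mul_Ck G_lie _ _ dA eA kA).
  apply: Ck_pair => //; first exact: Ck_id.
  by apply: Ck_cst => //; exact: cst_continuous.
apply: (Ck_near Uo _ C) => _ u [du ku'].
by rewrite /chart_mul /= !(cinvK G_lie) // alphaM.
Unshelve. all: by end_near. Qed.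

Lemma sv_dpi x a : sv a -> sv (dpi x a).
Proof.
move=> /(smooth_vectorP a (0 : E))/sv_family_dpi a_fam.
apply: svP => d n dA.
apply: (Ck_reparam (phi := fun p : E => (p, x)) _ (a_fam d n dA)).
by apply: pair_continuous; [move=> p; exact: cvg_id|exact: cst_continuous].
Qed.

Lemma dpi_linearC x (k : R[i]) a b : sv a -> sv b ->
  dpi x (k *: a + b) = k *: dpi x a + dpi x b.
Proof.
move=> a_sv b_sv; apply: (dderive_eq A_lc).
have k_lin : linear ( *:%R k : realified R A -> realified R A).
  by move=> r y z; rewrite !realified_scale scalerDr !scalerA mulrC.
have k_cont : continuous ( *:%R k : A -> A).
  by move=> y; apply: (@cvgZ _ A); [exact: cvg_cst|exact: cvg_id].
have := is_dderiveD (is_dderive_postlin k_lin k_cont (@dpiP a x a_sv)) (@dpiP b x b_sv).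
apply: is_dderive_ext => t /=.
by rewrite alpha_linearC.
Qed.

Lemma dpi0r x : dpi x 0 = 0.
Proof.
have := dpi_linearC x (-1) sv_0 sv_0.
by rewrite scaleN1r oppr0 addr0 scaleN1r addNr.
Qed.

Lemma dpi_scale x (k : R[i]) a : sv a -> dpi x (k *: a) = k *: dpi x a.
Proof. by move=> a_sv; rewrite -[k *: a]addr0 (dpi_linearC _ _ a_sv sv_0) dpi0r addr0. Qed.

Lemma dpi_cmul x a b : sv a -> sv b ->
  dpi x (cmul a b) = cmul (dpi x a) b + cmul a (dpi x b).
Proof.
move=> a_sv b_sv; apply: (dderive_eq A_lc).
have := is_dderive_bilin (E := realified R A) (F := realified R A) (H := realified R A)
  (b := @cmul R A) (@cmul_linearr R A) (@cmul_linearl R A) (@cmul_continuous R A)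
  (@dpiP a x a_sv) (@dpiP b x b_sv).
rewrite (exp0 x) !alpha1.
by apply: is_dderive_ext => t /=; rewrite alpha_cmul.
Qed.

Lemma dpi_star x a : sv a -> dpi x (star a) = star (dpi x a).
Proof.
move=> a_sv; apply: (dderive_eq A_lc).
have := is_dderive_postlin (@star_linear R A) (@star_continuous R A) (@dpiP a x a_sv).
by apply: is_dderive_ext => t /=; rewrite alpha_star.
Qed.

Definition dpis (xs : seq E) a : A := foldr dpi a xs.

Lemma sv_dpis xs a : sv a -> sv (dpis xs a).
Proof. by move=> a_sv; elim: xs => //= x xs; exact: sv_dpi. Qed.

Lemma dpis_linearC xs (k : R[i]) a b : sv a -> sv b ->
  dpis xs (k *: a + b) = k *: dpis xs a + dpis xs b.
Proof.
move=> a_sv b_sv; elim: xs => //= x xs ->.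
by rewrite dpi_linearC //; exact: sv_dpis.
Qed.

Lemma dpisB xs a b : sv a -> sv b -> dpis xs (a - b) = dpis xs a - dpis xs b.
Proof.
by move=> a_sv b_sv; rewrite addrC -scaleN1r dpis_linearC // scaleN1r addrC.
Qed.

Lemma dpis_scale xs (k : R[i]) a : sv a -> dpis xs (k *: a) = k *: dpis xs a.
Proof.
by move=> a_sv; elim: xs => //= x xs ->; rewrite dpi_scale //; exact: sv_dpis.
Qed.

Lemma dpiZ (r : R) x a : sv a -> dpi (r *: x) a = r%:C *: dpi x a.
Proof. by move=> a_sv; rewrite (linZ (dpi_linear a_sv)). Qed.

Lemma dpi0l a : sv a -> dpi 0 a = 0.
Proof. by move=> a_sv; rewrite (lin0 (dpi_linear a_sv)). Qed.

Lemma dpisZ (r : R) xs a : sv a ->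
  dpis [seq r *: x | x <- xs] a = (r ^+ size xs)%:C *: dpis xs a.
Proof.
move=> a_sv; elim: xs => [|x xs IHxs] /=; first by rewrite expr0 scale1r.
rewrite IHxs dpi_scale ?dpiZ; [|exact: sv_dpis|exact: sv_dpis].
by rewrite !scalerA -rmorphM exprS mulrC.
Qed.

Lemma sv_family_dpis (P : topologicalType) (b : P -> A) (phis : seq (P -> E)) :
  smooth_vector_family b -> (forall phi, List.In phi phis -> continuous phi) ->
  smooth_vector_family (fun p => dpis [seq phi p | phi <- phis] (b p)).
Proof.
move=> b_fam; elim: phis => [|phi phis IHphis] phis_cont //= d n dA.
have := sv_family_dpi (IHphis (fun psi psiP => phis_cont psi (or_intror psiP))).
move=> /(_ d n dA); apply: (Ck_reparam (phi := fun p => (p, phi p))).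
apply: pair_continuous; first by move=> p; exact: cvg_id.
by apply: phis_cont; left.
Qed.

(** The directions are read as parameters through the coordinate projections; the order 0 part of
    the resulting smooth family at 1, where [alpha] is the identity, is the claim. The finiteness of
    the seminorms p_n comes from here. *)
Lemma dpis_codom_continuous n a : sv a ->
  continuous (fun s : {ptws 'I_n -> E} => dpis (codom s) a).
Proof.
move=> a_sv s.
pose phis : seq ({ptws 'I_n -> E} -> E) := [seq (fun s : {ptws 'I_n -> E} => s i) | i <- enum 'I_n].
have phis_cont phi : List.In phi phis -> continuous phi.
  rewrite /phis; elim: (enum 'I_n) => //= i l IHl [<-|]; last exact: IHl.
  exact: (@proj_continuous _ _ i).
have a_fam : smooth_vector_family (fun _ : {ptws 'I_n -> E} => a).
  by apply/(smooth_vectorP a (s : {ptws 'I_n -> E})).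
have phisE s' : [seq phi s' | phi <- phis] = codom s' by rewrite /phis -map_comp.
have C := sv_family_dpis a_fam phis_cont 0 cA.
have c0 := @cst_continuous {ptws 'I_n -> E} E o s.
have cs : continuous (fun s' : {ptws 'I_n -> E} => s') by move=> s'; exact: cvg_id.
have -> : (fun s' : {ptws 'I_n -> E} => dpis (codom s') a) =
    (fun s' => alpha (cinv c o) (dpis [seq phi s' | phi <- phis] a)).
  by apply/funext => s'; rewrite (cinv_origin G_lie c1) alpha1 phisE.
exact: (@cvg_comp2 _ _ (realified R A) _ (nbhs s) (nbhs_filter s) _ _
  (fun s' u => alpha (cinv c u) (dpis [seq phi s' | phi <- phis] a))
  _ _ (cs s) c0 (Ck_cvg C (crange_origin c1))).
Qed.

Lemma renorm_lim_le T (Fi : set_system T) {FF : ProperFilter Fi} (f : T -> A) a (M : R) :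
  f @ Fi --> a -> (\forall t \near Fi, renorm (f t) <= M) -> renorm a <= M.
Proof.
move=> /cvg_renormP fa fM; apply/ler_addgt0Pr => e e0.
have := filter_ex (filterI fM (fa e e0)) => -[t [ftM fte]].
rewrite -[a](subrK (f t)) addrC; apply: le_trans (renormD _ _) _.
by rewrite lerD // -renormN opprB ltW.
Qed.

Lemma is_dderive_renorm (D : tvsType R) (f : D -> A) (x h : D) a :
  (forall e : R, 0 < e ->
    \forall t \near (0 : R), renorm (f (x + t *: h) - f x - t%:C *: a) <= e * `|t|) ->
  is_dderive (f : D -> realified R A) x h a.
Proof.
move=> f_der; apply/cvg_renormP => e e0.
have e20 : 0 < e / 2 by rewrite divr_gt0.
have := f_der _ e20; rewrite near_withinE; apply: filterS => t tP t0.
have tn0 : 0 < `|t| by rewrite normr_gt0.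
rewrite -(ltr_pM2r tn0) mulrC -renormZr scalerBr realified_scale scalerA -rmorphM.
rewrite divff // rmorph1 scale1r; apply: le_lt_trans tP _.
by rewrite ltr_pM2r // ltr_pdivrMr // ltr_pMr // ltr1n.
Qed.

Lemma dpi_cvg x b : sv b ->
  (t^-1 *: (alpha (expG (t *: x)) b - b : realified R A)) @[t --> (0 : R)^'] -->
  (dpi x b : realified R A).
Proof.
move=> b_sv; have := @dpiP b x b_sv; rewrite /is_dderive (exp0 x) alpha1.
by under eq_fun do rewrite add0r [_ *: (1 : R^o)]mulr1.
Qed.

Lemma dexp x b s : sv b -> is_dderive
  (fun t : R^o => alpha (expG (t *: x)) b : realified R A) s 1
  (alpha (expG (s *: x)) (dpi x b)).
Proof.
move=> b_sv; apply/is_dderive_line.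
have := is_dderive_postlin (alpha_linear (expG (s *: x)))
  (@alpha_continuous (expG (s *: x))) (@dpiP b x b_sv).
by apply: is_dderive_ext => t /=; rewrite -alphaM -expD [t *: (1 : R^o)]mulr1.
Qed.

(* Each [dpi x] is a closed operator, hence may be interchanged with derivatives. *)
Lemma is_dderive_dpi (y z : E -> A) (U : set E) u h x :
  open U -> U u -> (forall v, U v -> sv (y v)) -> (forall v, U v -> sv (z v)) ->
  (forall v, U v -> is_dderive (y : E -> realified R A) v h (z v)) ->
  dpi x (z v) @[v --> u] --> dpi x (z u) ->
  is_dderive (fun v => dpi x (y v) : realified R A) u h (dpi x (z u)).
Proof.
move=> Uo Uu y_sv z_sv yz dz_cvg; apply: is_dderive_renorm => e e0.
have w_cvg : alpha (expG (r.1 *: x)) (dpi x (z r.2)) @[r --> ((0 : R), u)] -->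
    dpi x (z u).
  rewrite -[X in _ --> X]alpha1 -(exp0 x); apply: alpha_cvg.
    exact: cvg_comp (fst_continuous ((0 : R), u)) (@exp_continuous x 0).
  exact: cvg_comp (snd_continuous ((0 : R), u)) dz_cvg.
have [[V W] /= [V0 Wu] VW] := (cvg_renormP _ _).1 w_cvg e e0.
have WU : nbhs u (W `&` U) by apply: filterI Wu _; exact: open_nbhs_nbhs.
have /nbhs_ballP[d /= d0 dWU] := line_cvg u h _ WU.
apply/nbhs_ballP; exists d => //= t td.
have seg s : 0 <= s <= 1 -> (W `&` U) (u + (s * t) *: h).
  move=> /andP[s0 s1]; apply: dWU; move: td; rewrite -ball_normE /= !sub0r !normrN.
  by apply: le_lt_trans; rewrite normrM ler_piMl // ger0_norm.
(* The unbounded operator [dpi x] is replaced by difference quotients, which are continuous in the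
   vector; the estimate is proved for all small [r] other than 0 and passed to the limit. *)
pose Y r v := r^-1 *: (alpha (expG (r *: x)) (y v) - y v : realified R A).
have Y_cvg v : U v -> Y r v @[r --> (0 : R)^'] --> (dpi x (y v) : realified R A).
  by move=> Uv; apply: dpi_cvg; exact: y_sv.
have Uth : U (u + t *: h) by have [] := seg 1 _; rewrite ?lexx ?ler01 ?mul1r.
have YY_cvg : (Y r (u + t *: h) - Y r u - t *: (dpi x (z u) : realified R A))
    @[r --> (0 : R)^'] --> (dpi x (y (u + t *: h)) - dpi x (y u) -
      t *: (dpi x (z u) : realified R A) : realified R A).
  by apply: tvs_cvgB; [apply: tvs_cvgB; exact: Y_cvg|exact: cvg_cst].
apply: (renorm_lim_le YY_cvg).
have /nbhs_ballP[d' /= d'0 dV] := V0.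
near=> r; rewrite mulrC.
have r0 : r != 0 by near: r; exact: nbhs_dnbhs_neq.
have rV s : 0 <= s <= 1 -> V (s * r).
  move=> /andP[s0 s1]; apply: dV; rewrite -ball_normE /= sub0r normrN normrM.
  apply: (@le_lt_trans _ _ `|r|); first by rewrite ler_piMl // ger0_norm.
  by near: r; exact: dnbhs0_lt.
(* First mean value estimate, along the segment from [u] to [u + t *: h], with [r] fixed. *)
apply: (dderive_mean A_lc (csn_renorm A)
  (g := fun s => r^-1 *: (alpha (expG (r *: x)) (z (u + (s * t) *: h)) -
                          z (u + (s * t) *: h) : realified R A))) => s s01.
  have [_ Us] := seg s s01.
  have dy := yz _ Us.
  have day := is_dderive_postlin (alpha_linear (expG (r *: x)))
    (@alpha_continuous (expG (r *: x))) dy.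
  have r_lin (q : R) : linear ( *:%R q : realified R A -> realified R A).
    by move=> q' a b; rewrite scalerDr !scalerA mulrC.
  have r_cont (q : R) : continuous ( *:%R q : realified R A -> realified R A).
    by move=> b; apply: tvs_cvgZ; [exact: cvg_cst|exact: cvg_id].
  have := is_dderive_postlin (r_lin r^-1) (r_cont r^-1)
    (is_dderiveD day (is_dderive_postlin (r_lin (-1)) (r_cont (-1)) dy)).
  rewrite scaleN1r; apply: is_dderive_ext => v /=.
  by rewrite scaleN1r.
have [Ws Us] := seg s s01; have zs := z_sv _ Us.
set b := z _ in zs Ws *.
have rn0 : 0 < `|r| by rewrite normr_gt0.
rewrite -(ler_pM2l rn0) -renormZr -realified_scale scalerBr scalerA divff // scale1r.
(* Second mean value estimate, along the exponential curve from 0 to [r], where the derivative is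
   within [e] of [dpi x (z u)] by the choice of [V] and [W]. *)
have := dderive_mean A_lc (csn_renorm A) (f := fun t : R^o => alpha (expG (t *: x)) b)
  (x := (0 : R^o)) (v := (1 : R^o)) (w := dpi x (z u)) (t := r) (M := e)
  (g := fun s' => alpha (expG ((s' * r) *: x)) (dpi x b)).
rewrite !add0r [r *: (1 : R^o)]mulr1 (exp0 x) alpha1; apply=> s' s'01.
  rewrite add0r [(s' * r) *: (1 : R^o)]mulr1; exact: dexp.
by apply/ltW/(VW (s' * r, _)); split=> //=; exact: rV.
Unshelve. all: by end_near. Qed.

Lemma dpis_cvg T (Fi : set_system T) {FF : Filter Fi} (I : Type) (l : seq I)
    (phi : T -> I -> E) (y : I -> E) a : sv a ->
  (forall i, phi t i @[t --> Fi] --> y i) ->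
  dpis [seq phi t i | i <- l] a @[t --> Fi] --> dpis [seq y i | i <- l] a.
Proof.
case: l => [|i0 l] a_sv phi_cvg; first exact: cvg_cst.
set l' := i0 :: l.
under eq_fun do rewrite -(codom_nth _ i0).
rewrite -(codom_nth _ i0).
have s_cvg : ((fun i : 'I_(size l') => phi t (nth i0 l' i)) : {ptws 'I_(size l') -> E})
    @[t --> Fi] --> ((fun i => y (nth i0 l' i)) : {ptws 'I_(size l') -> E}).
  by apply: cvg_ptws => i; exact: phi_cvg.
exact: cvg_comp s_cvg (@dpis_codom_continuous (size l') a a_sv _).
Qed.

(** The vectors [alpha (cinv c v * cinv d u) a] are differentiated at [v = o] in two ways: as the
    orbit of [alpha (cinv d u) a], and as the orbit of [a] along a curve with velocity
    [right_field c d u x]. *)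
Lemma dpi_alpha a d u x : sv a -> AG d -> crange d u ->
  dpi x (alpha (cinv d u) a) = alpha (cinv d u) (dpi (adjoint_inv c d u x) a).
Proof.
move=> a_sv dA du.
have b_sv := sv_alpha (cinv d u) a_sv.
have := @dorbit _ c o x b_sv cA (crange_origin c1).
rewrite (left_log_origin G_lie c1) (cinv_origin G_lie c1) alpha1.
move=> /(is_dderive_unique A_lc); apply.
have du' : crange d (cfun d (cinv c o * cinv d u)%g).
  by rewrite (cinv_origin G_lie c1) mul1g (cfunK G_lie).
have := is_dderive_comp_Ck A_lc (0 : E) (open_crange G_lie dA) (sv_Ck E 2 a_sv dA) du'
  (right_fieldP G_lie c1 x dA du).
rewrite /= (cinv_origin G_lie c1) mul1g (cfunK G_lie) //.
rewrite (dderive_eq A_lc (@dorbit _ d u _ a_sv dA du)).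
apply: is_dderive_eq_near.
have cu : (cinv c v * cinv d u)%g @[v --> o] --> (cinv c o * cinv d u)%g.
  have g0 : (fun=> cinv d u) @ o --> cinv d u by exact: cvg_cst.
  exact: (mulg_cvg G_lie (cinv_cvg G_lie cA (crange_origin c1)) g0).
have n1 : \forall v \near o, cdom d (cinv c v * cinv d u)%g.
  have du1 : cdom d (cinv c o * cinv d u)%g.
    by rewrite (cinv_origin G_lie c1) mul1g; exact: (cdom_cinv G_lie).
  exact: cu (near_cdom G_lie dA du1).
by apply: filterS n1 => v dv; rewrite /= (cinvK G_lie) // alphaM.
Qed.

Lemma dpis_alpha a d u xs : sv a -> AG d -> crange d u ->
  dpis xs (alpha (cinv d u) a) =
  alpha (cinv d u) (dpis [seq adjoint_inv c d u x | x <- xs] a).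
Proof.
move=> a_sv dA du; elim: xs => //= x xs ->.
by rewrite dpi_alpha //; exact: sv_dpis.
Qed.

(** The operators [dpi x] are moved through the derivative one by one. The continuity that
    [is_dderive_dpi] asks for is visible after [dpis_alpha], when only the directions and the group
    element depend on the point. *)
Lemma dorbit_dpis a d u h xs : sv a -> AG d -> crange d u ->
  is_dderive (fun v => dpis xs (alpha (cinv d v) a) : realified R A) u h
    (dpis xs (alpha (cinv d u) (dpi (left_log c d u h) a))).
Proof.
move=> a_sv dA; elim: xs u => [|x xs IHxs] u du; first exact: dorbit.
apply: (is_dderive_dpi (open_crange G_lie dA) du
  (z := fun v => dpis xs (alpha (cinv d v) (dpi (left_log c d v h) a)))) => //.
- by move=> v dv; exact/sv_dpis/sv_alpha.
- by move=> v dv; exact/sv_dpis/sv_alpha/sv_dpi.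
(* The index [None] stands for the direction of the orbit derivative; it ends the list because that
   operator acts on [a] before the others. *)
pose phi v (i : option E) := if i is Some x then adjoint_inv c d v x else left_log c d v h.
have phiE v : crange d v ->
    dpi x (dpis xs (alpha (cinv d v) (dpi (left_log c d v h) a))) =
    alpha (cinv d v) (dpis [seq phi v i | i <- rcons (map Some (x :: xs)) None] a).
  move=> dv; rewrite -[LHS]/(dpis (x :: xs) _) dpis_alpha //; last exact: sv_dpi.
  by rewrite map_rcons -cats1 /dpis foldr_cat -map_comp.
have : alpha (cinv d v) (dpis [seq phi v i | i <- rcons (map Some (x :: xs)) None] a)
    @[v --> u] -->
    alpha (cinv d u) (dpis [seq phi u i | i <- rcons (map Some (x :: xs)) None] a).
  apply: alpha_cvg; first exact: (cinv_cvg G_lie).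
  apply: dpis_cvg => // -[x'|] /=.
    have c0 : (fun=> x') v @[v --> u] --> x' by exact: cvg_cst.
    have cu : v @[v --> u] --> u by exact: cvg_id.
    exact: cvg_comp2 cu c0 (adjoint_inv_cvg G_lie c1 x' dA du).
  have c0 : (fun=> h) v @[v --> u] --> h by exact: cvg_cst.
  have cu : v @[v --> u] --> u by exact: cvg_id.
  exact: cvg_comp2 cu c0 (left_log_cvg G_lie c1 h dA du).
rewrite -phiE //; apply: cvg_trans; apply: near_eq_cvg.
have n1 : \forall v \near u, crange d v by exact: (near_crange G_lie dA du).
by apply: filterS n1 => v dv; rewrite phiE.
Qed.

(** * The natural topology *)

Section NaturalSeminorms.
Context (N : E -> R) (N_norm : is_lie_norm c N).
Implicit Types (xs : seq E) (n : nat).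

Lemma lie_normD x y : N (x + y) <= N x + N y.
Proof. by case: N_norm => [[]]. Qed.

Lemma lie_normZ (r : R) x : N (r *: x) = `|r| * N x.
Proof. by case: N_norm => [[]]. Qed.

Lemma lie_norm_eq0 x : N x = 0 -> x = 0.
Proof. by case: N_norm => [[_ _ N0] _ _]; exact: N0. Qed.

Lemma lie_norm_nbhs (W : set E) :
  nbhs 0 W <-> exists2 e : R, 0 < e & [set x | N x < e] `<=` W.
Proof. by case: N_norm => _ + _; exact. Qed.

Lemma csn_lie_norm : continuous_seminorm N.
Proof.
split=> [x y|r x|e e0]; [exact: lie_normD|exact: lie_normZ|].
by apply/lie_norm_nbhs; exists e.
Qed.

Lemma lie_norm0 : N 0 = 0. Proof. exact: csn0 csn_lie_norm. Qed.
Lemma lie_norm_ge0 x : 0 <= N x. Proof. exact: csn_ge0 csn_lie_norm _. Qed.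

Definition directions n (C : R) xs : Prop :=
  size xs = n /\ all (fun x => N x <= C) xs.

Lemma directions_scale n C r xs : directions n C xs ->
  directions n (`|r| * C) [seq r *: x | x <- xs].
Proof.
move=> [xs_n xsC]; split; first by rewrite size_map.
rewrite all_map; apply: sub_all xsC => x /= xC.
by rewrite lie_normZ ler_wpM2l.
Qed.

Lemma directions0 n : directions n 1 (nseq n 0).
Proof.
by split; [rewrite size_nseq|rewrite all_nseq lie_norm0 ler01 orbT].
Qed.

(** A multilinear map that is continuous at 0 is bounded on the unit ball, by scaling all directions
    at once. *)
Lemma dpis_bounded n a : sv a ->
  exists M : R, forall xs, directions n 1 xs -> renorm (dpis xs a) <= M.
Proof.
move=> a_sv.
(* Uniform balls form a filter that converges to 0 pointwise, which turns continuity into a single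
   radius [e]. *)
pose B (e : R) := [set s : {ptws 'I_n -> E} | forall i, N (s i) < e].
have B_filter : Filter (filter_from [set e : R | 0 < e] B).
  apply: filter_from_filter; first by exists 1; exact: ltr01.
  move=> e e' /= e0 e'0; exists (Num.min e e'); first by rewrite /= lt_min e0.
  by move=> s sB; split=> i; have := sB i; rewrite lt_min => /andP[].
have B_cvg : (fun s : {ptws 'I_n -> E} => s) @ filter_from [set e : R | 0 < e] B -->
    ((fun=> 0) : {ptws 'I_n -> E}).
  apply: cvg_ptws => i W /lie_norm_nbhs[e e0 eW].
  by exists e => // s sB; apply: eW; exact: sB.
have lim := cvg_comp _ _ B_cvg (@dpis_codom_continuous n a a_sv _).
have {lim} := (cvg_renormP _ _).1 lim _ ltr01.
set s0 := fun=> 0; move=> [e /= e0 eB].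
(* The value at the zero tuple is kept because for [n = 0] it is [a] itself. *)
pose K := 1 + renorm (dpis (codom s0) a).
exists (K / (e / 2) ^+ n) => xs [xs_n xs1].
have e20 : 0 < e / 2 by rewrite divr_gt0.
pose s : {ptws 'I_n -> E} := fun i => (e / 2) *: nth 0 xs i.
have sB : B e s.
  move=> i; rewrite /s lie_normZ gtr0_norm //.
  have : N (nth 0 xs i) <= 1 by apply: (allP xs1); rewrite mem_nth // xs_n.
  rewrite -(ler_pM2l e20) mulr1 => /le_lt_trans; apply.
  by rewrite ltr_pdivrMr // ltr_pMr // ltr1n.
have sE : codom s = [seq (e / 2) *: x | x <- xs].
  by rewrite /s; clear -xs_n; case: n / xs_n; exact: codom_nth.
have := eB s sB; rewrite /= sE dpisZ // xs_n => lt1.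
rewrite ler_pdivlMr ?exprn_gt0 // mulrC -[X in X * _]gtr0_norm ?exprn_gt0 //.
rewrite -renormZr -[X in renorm X](subrK (dpis (codom s0) a)).
by apply: le_trans (renormD _ _) _; rewrite lerD2r ltW.
Qed.

(** Meaningful for smooth vectors, where the supremum is finite; [fine] sends infinite values to
    0. *)
Definition pnorm n a : R := fine (smooth_seminorm alpha expG N n a).

Lemma smooth_seminormE n a : sv a ->
  smooth_seminorm alpha expG N n a = (pnorm n a)%:E.
Proof.
move=> a_sv; have [M aM] := dpis_bounded n a_sv.
rewrite fineK // fin_numE; apply/andP; split; last first.
  rewrite lt_eqF // (@le_lt_trans _ _ M%:E) ?ltry //.
  by apply: ge_ereal_sup => _ [xs xsP <-]; rewrite lee_fin; exact: aM.
(* The tuple of zero directions shows that the supremum is not that of the empty set. *)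
rewrite gt_eqF // (@lt_le_trans _ _ (renorm (dpis (nseq n 0) a))%:E) ?ltNyr //.
by apply: ereal_sup_ubound; exists (nseq n 0) => //; exact: directions0.
Qed.

Lemma pnorm_ub n a xs : sv a -> directions n 1 xs -> renorm (dpis xs a) <= pnorm n a.
Proof.
move=> a_sv xsP; rewrite -lee_fin -smooth_seminormE //.
by apply: ereal_sup_ubound; exists xs.
Qed.

Lemma pnorm_le n a (M : R) : sv a ->
  (forall xs, directions n 1 xs -> renorm (dpis xs a) <= M) -> pnorm n a <= M.
Proof.
move=> a_sv aM; rewrite -lee_fin -smooth_seminormE //.
by apply: ge_ereal_sup => _ [xs xsP <-]; rewrite lee_fin; exact: aM.
Qed.

Lemma pnorm_ge0 n a : sv a -> 0 <= pnorm n a.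
Proof.
by move=> a_sv; apply: le_trans (pnorm_ub a_sv (directions0 n)); exact: renorm_ge0.
Qed.

Lemma pnorm0E a : sv a -> pnorm 0 a = renorm a.
Proof.
move=> a_sv; apply/le_anti/andP; split.
  by apply: pnorm_le => // xs [/size0nil ->].
by apply: (pnorm_ub (xs := [::]) a_sv).
Qed.

Lemma pnormD n a b : sv a -> sv b -> pnorm n (a + b) <= pnorm n a + pnorm n b.
Proof.
move=> a_sv b_sv; apply: pnorm_le => [|xs xsP]; first exact: sv_add.
rewrite -{1}[a]scale1r dpis_linearC // scale1r.
by apply: le_trans (renormD _ _) _; rewrite lerD // pnorm_ub.
Qed.

Lemma pnormZ n (k : R[i]) a : sv a -> pnorm n (k *: a) = complex.Re `|k| * pnorm n a.
Proof.
have k_ge0 (q : R[i]) : 0 <= complex.Re `|q|.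
  by have := normr_ge0 q; rewrite lecE => /andP[].
have le_pnorm (q : R[i]) b : sv b -> pnorm n (q *: b) <= complex.Re `|q| * pnorm n b.
  move=> b_sv; apply: pnorm_le => [|xs xsP]; first exact: sv_scale.
  rewrite dpis_scale // renormZ; apply: ler_wpM2l; first exact: k_ge0.
  exact: pnorm_ub.
move=> a_sv; apply/le_anti/andP; split; first exact: le_pnorm.
have [->|k0] := eqVneq k 0.
  by rewrite normr0 /= mul0r pnorm_ge0 //; exact: sv_scale.
have kE (q : R[i]) : (complex.Re `|q|)%:C = `|q| by rewrite RRe_real ?normr_real.
have kV : complex.Re `|k^-1| = (complex.Re `|k|)^-1.
  by apply: complexI; rewrite fmorphV /= !kE normfV.
have kr0 : 0 < complex.Re `|k| by rewrite -ltcR kE normr_gt0.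
rewrite mulrC -ler_pdivlMr // mulrC -kV.
(* The reverse inequality is the first one for [k^-1] and the vector [k *: a]. *)
rewrite -{1}[a]scale1r -(mulVf k0) -scalerA.
exact: le_pnorm (sv_scale _ a_sv).
Qed.

Lemma pnorm_bound n C a xs : sv a -> 0 < C -> directions n C xs ->
  renorm (dpis xs a) <= C ^+ n * pnorm n a.
Proof.
move=> a_sv C0 xsP.
have CV : `|C^-1| * C = 1 by rewrite gtr0_norm ?invr_gt0 // mulVf // gt_eqF.
have := directions_scale C^-1 xsP; rewrite CV.
move=> /(pnorm_ub a_sv); rewrite dpisZ // renormZr exprVn.
case: xsP => -> _; rewrite gtr0_norm ?invr_gt0 ?exprn_gt0 //.
by rewrite ler_pdivrMl ?exprn_gt0.
Qed.

(** After normalisation [x] is one more unit direction, placed at the end of the list because it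
    acts first. *)
Lemma pnorm_dpi n x a : sv a -> pnorm n (dpi x a) <= N x * pnorm n.+1 a.
Proof.
move=> a_sv; apply: pnorm_le => [|xs [xs_n xs1]]; first exact: sv_dpi.
have [N0|N0] := leP (N x) 0.
  have -> : x = 0 by apply: lie_norm_eq0; apply/le_anti; rewrite N0 lie_norm_ge0.
  by rewrite lie_norm0 mul0r dpi0l // -[0]subr0 dpisB ?subrr ?renorm0 //; exact: sv_0.
pose y := (N x)^-1 *: x.
have Ny : N y <= 1 by rewrite lie_normZ gtr0_norm ?invr_gt0 // mulVf // gt_eqF.
have xE : x = N x *: y by rewrite scalerA divff ?scale1r // gt_eqF.
rewrite {1}xE dpiZ // dpis_scale; last exact: sv_dpi.
rewrite renormZr gtr0_norm // ler_wpM2l ?lie_norm_ge0 //.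
have := @pnorm_ub n.+1 a (rcons xs y) a_sv; rewrite /dpis foldr_rcons; apply.
by split; [rewrite size_rcons xs_n|rewrite all_rcons Ny].
Qed.

(** Homogeneity turns continuity at the direction 0 into a bound on the unit ball of directions:
    shrinking them by [r / 2] gives values of norm below 1. *)
Lemma adjoint_locally_bounded d u0 : AG d -> crange d u0 ->
  exists2 C : R, 0 < C & \forall u \near u0, crange d u /\
    forall x, N x <= 1 -> N (adjoint_inv c d u x) <= C.
Proof.
move=> dA du0.
have lim := adjoint_inv_cvg G_lie c1 0 dA du0.
have ad0 u : crange d u -> adjoint_inv c d u 0 = 0.
  by move=> du; rewrite -{1}(scale0r (0 : E)) (adjoint_invZ G_lie c1) // scale0r.
have N1 : nbhs (adjoint_inv c d u0 0) [set x | N x < 1].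
  by rewrite ad0 //; apply/lie_norm_nbhs; exists 1 => //; exact: ltr01.
have [[V W] /= [Vu0 /lie_norm_nbhs[r r0 rW]] VW] := lim _ N1.
exists (2 / r); first by rewrite divr_gt0.
apply: filterS2 Vu0 (near_crange G_lie dA du0) => u Vu du; split=> // x Nx.
have r20 : 0 < r / 2 by rewrite divr_gt0.
have := VW (u, (r / 2) *: x); rewrite /= (adjoint_invZ G_lie c1) // !lie_normZ gtr0_norm //.
move=> lt1; rewrite -(ler_pM2l r20) (le_trans (ltW (lt1 _))) //.
  split=> //; apply: rW; rewrite /= lie_normZ gtr0_norm //.
  apply: (@le_lt_trans _ _ (r / 2)); first by rewrite ler_piMr // ltW.
  by rewrite ltr_pdivrMr // ltr_pMr // ltr1n.
by rewrite mulrA divfK // divff // gt_eqF.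
Qed.

(** The exponent counts one factor for [alpha] and [n] factors for the directions moved by the
    adjoint action. The constant and the neighbourhood serve all [n] at once. *)
Lemma pnorm_alpha_bounded d u0 : AG d -> crange d u0 ->
  exists2 C : R, 0 < C & \forall u \near u0, crange d u /\
    forall n a, sv a -> pnorm n (alpha (cinv d u) a) <= C ^+ n.+1 * pnorm n a.
Proof.
move=> dA du0.
have [C1 C1_gt0 adC] := adjoint_locally_bounded dA du0.
have [C2 C2_gt0 alphaC] := alpha_locally_bounded (cinv d u0).
have alphaC' : \forall u \near u0, forall a, renorm (alpha (cinv d u) a) <= C2 * renorm a.
  exact: (cinv_cvg G_lie dA du0) alphaC.
pose C := Num.max C1 C2.
exists C; first by rewrite /C lt_max C1_gt0.
have C_gt0 : 0 < C by rewrite /C lt_max C1_gt0.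
apply: filterS2 adC alphaC' => u [du adC] alphaC'; split=> // n a a_sv.
apply: pnorm_le => [|xs [xs_n /allP xs1]]; first exact: sv_alpha.
rewrite dpis_alpha // exprS -mulrA; apply: le_trans (alphaC' _) _.
have C2C : C2 <= C by rewrite /C le_max lexx orbT.
apply: ler_pM; [exact: ltW|exact: renorm_ge0|exact: C2C|].
apply: pnorm_bound => //; split; first by rewrite size_map.
rewrite all_map; apply/allP => x /xs1 x1 /=.
by apply: le_trans (adC x x1) _; rewrite /C le_max lexx.
Qed.

Lemma sv_closed : subspace_closed sv.
Proof. by split; [exact: sv_0|move=> k a b; exact: sv_linear]. Qed.

Definition sv_norm n (v : subspace sv_closed) : R := pnorm n (val v).

Lemma sv_norm_family : seminorm_family sv_norm.
Proof.
move=> n; split=> [v w|k v]; rewrite /sv_norm.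
  by rewrite raddfD pnormD //; exact: subspace_valP.
by rewrite linearZ /= pnormZ //; exact: subspace_valP.
Qed.

Definition sv_space := seminormed sv_norm_family.

HB.instance Definition _ := Tvs.on sv_space.

Definition iota (b : sv_space) : A := val (b : subspace sv_closed).

Fact iota_linear : linear iota.
Proof. by move=> k x y; rewrite /iota linearP. Qed.

HB.instance Definition _ := GRing.isLinear.Build R[i] sv_space A *:%R iota iota_linear.

Definition of_sv a (a_sv : sv a) : sv_space := to_subspace sv_closed a_sv.

Lemma of_svK a (a_sv : sv a) : iota (of_sv a_sv) = a. Proof. by []. Qed.

Lemma iotaP (b : sv_space) : sv (iota b). Proof. exact: subspace_valP. Qed.

Lemma iota_inj : injective iota. Proof. exact: val_inj. Qed.

Lemma sv_cvgP T (Fi : set_system T) {FF : Filter Fi} (f : T -> sv_space) (b : sv_space) :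
  f @ Fi --> b <->
  forall n (e : R), 0 < e -> \forall t \near Fi, pnorm n (iota (f t) - iota b) < e.
Proof.
split=> [/cvg_snP fb n e e0|fb].
  by apply: filterS (fb n e e0) => t; rewrite /sv_norm raddfB.
by apply/cvg_snP => n e e0; apply: filterS (fb n e e0) => t; rewrite /sv_norm raddfB.
Qed.

Lemma sv_nbhsP (b : sv_space) (W : set sv_space) : nbhs b W <->
  exists n (e : R), 0 < e /\ forall b' : sv_space,
    (forall k : nat, (k <= n)%N -> pnorm k (iota (b' - b)) < e) -> W b'.
Proof. by []. Qed.

Lemma sv_hausdorff : hausdorff_space sv_space.
Proof.
move=> x y xy; apply: iota_inj; apply/eqP; rewrite -subr_eq0; apply/eqP.
apply: renorm_eq0; apply/le_anti; rewrite renorm_ge0 andbT.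
apply/ler_addgt0Pr => e e0; rewrite add0r.
have e20 : 0 < e / 2 by rewrite divr_gt0.
have near_ball (z : sv_space) : nbhs z [set b : sv_space | renorm (iota b - iota z) < e / 2].
  exists 0%N, (e / 2); split=> // b bz; have := bz 0%N (leqnn _).
  by rewrite /sv_norm pnorm0E ?raddfB //; exact: (iotaP (b - z)).
have [z [zx zy]] := xy _ _ (near_ball x) (near_ball y).
rewrite -(subrKA (iota z)) (splitr e); apply: le_trans (renormD _ _) _.
by rewrite lerD //; apply: ltW => //; rewrite -renormN opprB.
Qed.

Lemma sv_nbhs_basis : exists U : nat -> set sv_space, (forall n, nbhs 0 (U n)) /\
  forall W : set sv_space, nbhs 0 W -> exists n, U n `<=` W.
Proof.
exists (fun n => sn_ball (qP := sv_norm_family) n n.+1%:R^-1 0); split=> [n|W [n [e [e0 eW]]]].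
  by exists n, n.+1%:R^-1; split; rewrite ?invr_gt0.
have [m em] : exists m : nat, m.+1%:R^-1 < e.
  have [m _ /(_ m (leqnn m)) /= me] := near_infty_natSinv_lt (PosNum e0).
  by exists m.
exists (maxn n m) => b bW; apply: eW => k kn.
apply: lt_le_trans (bW k (leq_trans kn (leq_maxl _ _))) _.
apply: le_trans (ltW em); rewrite lef_pV2 ?posrE // ler_nat ltnS.
exact: leq_maxr.
Qed.

(** * Completeness of the space of smooth vectors *)

Section Completeness.
Context (Fi : set_system sv_space) (FF : ProperFilter Fi).
Hypothesis F_cauchy : forall W : set sv_space, nbhs 0 W ->
  exists2 S, Fi S & forall b b' : sv_space, S b -> S b' -> W (b - b').

Lemma pnorm_cauchy n (e : R) : 0 < e ->
  exists2 S, Fi S & forall b b' : sv_space, S b -> S b' -> pnorm n (iota b - iota b') < e.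
Proof.
move=> e0.
have [] := F_cauchy (W := [set b : sv_space | pnorm n (iota b) < e]).
  exists n, e; split => // b /(_ n (leqnn n)).
  by rewrite subr0.
by move=> S FS SW; exists S => // b b' Sb Sb'; have := SW b b' Sb Sb'; rewrite /= raddfB.
Qed.

Lemma directions_ex xs : exists2 C : R, 0 < C & directions (size xs) C xs.
Proof.
elim: xs => [|x xs [C C0 [_ xsC]]]; first by exists 1.
exists (Num.max C (N x)); first by rewrite lt_max C0.
split=> //=; rewrite le_max lexx orbT /=; apply: sub_all xsC => y yC.
by rewrite le_max yC.
Qed.

Lemma dpis_cauchy n (C e : R) : 0 < C -> 0 < e ->
  exists2 S, Fi S & forall (b b' : sv_space) xs, S b -> S b' -> directions n C xs ->
    renorm (dpis xs (iota b) - dpis xs (iota b')) < e.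
Proof.
move=> C0 e0; have Cn0 : 0 < C ^+ n by rewrite exprn_gt0.
have e'0 : 0 < e / C ^+ n by rewrite divr_gt0.
have [S FS SP] := pnorm_cauchy n e'0.
exists S => // b b' xs Sb Sb' xsP.
rewrite -dpisB; [|exact: iotaP|exact: iotaP].
have bb_sv := sv_sub (iotaP b) (iotaP b').
apply: le_lt_trans (pnorm_bound bb_sv C0 xsP) _.
by rewrite mulrC -ltr_pdivlMr //; exact: SP.
Qed.

(** The limits are taken in [A] separately for each list of directions; that they form the jet of
    the single vector [limit_jet [::]] is the content of [dpis_limit_jet]. *)
Definition limit_jet xs : A := lim ((dpis xs (iota y) : A) @[y --> Fi]).

Lemma limit_jet_cvg xs : dpis xs (iota y) @[y --> Fi] --> limit_jet xs.
Proof.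
apply: cauchy_cvg; apply: cauchy_exP => e e0.
have e_real : e = (complex.Re e)%:C.
  by case: e e0 => x y; rewrite ltcE /= => /andP[/eqP-> _].
have re0 : 0 < complex.Re e by rewrite -ltcR -e_real.
have [C C0 xsC] := directions_ex xs.
have [S FS SP] := dpis_cauchy (size xs) C0 re0.
have [b Sb] := filter_ex FS.
exists (dpis xs (iota b)); apply: (@filterS _ Fi _ S) FS => b' Sb'.
by rewrite /= -ball_normE /= renormE [ltRHS]e_real ltcR; exact: SP b b' xs Sb Sb' xsC.
Qed.

Lemma limit_jet_unif n (C e : R) : 0 < C -> 0 < e ->
  \forall y \near Fi, forall xs, directions n C xs ->
    renorm (dpis xs (iota y) - limit_jet xs) <= e.
Proof.
move=> C0 e0; have [S FS SP] := dpis_cauchy n C0 e0.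
apply: filterS (FS) => b Sb xs xsP.
have lim : dpis xs (iota b) - dpis xs (iota y) @[y --> Fi] -->
    dpis xs (iota b) - limit_jet xs.
  apply: (@tvs_cvgB R (realified R A)); first exact: cvg_cst.
  exact: limit_jet_cvg.
apply: (renorm_lim_le lim).
by apply: filterS FS => b' Sb'; exact: ltW (SP b b' xs Sb Sb' xsP).
Qed.

Lemma limit_jet_linear xs :
  linear (fun x => limit_jet (x :: xs) : realified R A).
Proof.
move=> r x y.
have lim1 := @limit_jet_cvg (r *: x + y :: xs).
have lim2 : (r *: (dpis (x :: xs) (iota z) : realified R A) + dpis (y :: xs) (iota z))
    @[z --> Fi] --> (r *: (limit_jet (x :: xs) : realified R A) + limit_jet (y :: xs)
       : realified R A).
  apply: tvs_cvgD; last exact: limit_jet_cvg.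
  by apply: tvs_cvgZ; [exact: cvg_cst|exact: limit_jet_cvg].
case: A_lc => hA _; apply: (cvg_unique hA lim1).
apply: cvg_trans lim2; apply: near_eq_cvg; apply: nearW => b /=.
by rewrite (dpi_linear (sv_dpis xs (iotaP b))).
Qed.

(** A uniform limit of continuous maps: the directions near the given ones stay in the ball of
    radius [C + 1], on which one jet from the filter is within [e / 3] of the limit. *)
Lemma limit_jet_continuous T (Fj : set_system T) {FFj : Filter Fj} (I : Type)
    (l : seq I) (phi : T -> I -> E) (y : I -> E) :
  (forall i, phi t i @[t --> Fj] --> y i) ->
  limit_jet [seq phi t i | i <- l] @[t --> Fj] --> limit_jet [seq y i | i <- l].
Proof.
move=> phi_cvg; apply/cvg_renormP => e e0.
have e30 : 0 < e / 3 by rewrite divr_gt0.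
have [C C0 [_ yC]] := directions_ex [seq y i | i <- l].
have C10 : 0 < C + 1 by rewrite ltr_wpDl // ltW.
have yC1 : directions (size l) (C + 1) [seq y i | i <- l].
  split; first by rewrite size_map.
  by apply: sub_all yC => x /le_trans; apply; rewrite lerDl.
have [b bP] := filter_ex (limit_jet_unif (size l) C10 e30).
have near_dir : \forall t \near Fj, directions (size l) (C + 1) [seq phi t i | i <- l].
  have : \forall t \near Fj, all (fun i => N (phi t i) <= C + 1) l.
    move: yC; elim: l {yC1 bP} => [|i l IHl] /=; first by move=> _; exact: filterE.
    move=> /andP[iC lC].
    have ni : \forall t \near Fj, N (phi t i - y i) < 1.
      exact: cvg_csn (phi_cvg i) csn_lie_norm ltr01.
    apply: filterS2 ni (IHl lC) => t ti ->; rewrite andbT.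
    apply: le_trans (csn_sub csn_lie_norm _ (y i)) _.
    by rewrite addrC lerD // ltW.
  by apply: filterS => t tC; split; rewrite ?size_map // all_map.
have near_b : \forall t \near Fj, renorm (dpis [seq phi t i | i <- l] (iota b) -
    dpis [seq y i | i <- l] (iota b)) < e / 3.
  exact: (cvg_renormP _ _).1 (dpis_cvg (l := l) (iotaP b) phi_cvg) _ e30.
apply: filterS2 near_dir near_b => t tP tb.
have -> : limit_jet [seq phi t i | i <- l] - limit_jet [seq y i | i <- l] =
  - (dpis [seq phi t i | i <- l] (iota b) - limit_jet [seq phi t i | i <- l]) +
  ((dpis [seq phi t i | i <- l] (iota b) - dpis [seq y i | i <- l] (iota b)) +
  (dpis [seq y i | i <- l] (iota b) - limit_jet [seq y i | i <- l])).
  by module R[i] A.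
apply: le_lt_trans (renormD _ _) _; rewrite renormN.
apply: (@le_lt_trans _ _ (e / 3 + (renorm (dpis [seq phi t i | i <- l] (iota b) -
  dpis [seq y i | i <- l] (iota b)) + e / 3))).
  apply: lerD; first exact: bP.
  by apply: le_trans (renormD _ _) _; rewrite lerD2l; exact: bP.
have eE : e / 3 + (e / 3 + e / 3) = e by field.
by rewrite -[ltRHS]eE ltrD2l ltrD2r.
Qed.

(* Apply the mean value inequality to the orbit maps of [dpis xs (iota y)] and pass
   to the limit; the remainder is controlled uniformly in [y] because the limits
   defining [limit_jet] are uniform on bounded sets of directions. *)
Lemma limit_jet_dorbit d u h xs : AG d -> crange d u ->
  is_dderive (fun v => alpha (cinv d v) (limit_jet xs) : realified R A) u h
    (alpha (cinv d u) (limit_jet (left_log c d u h :: xs))).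
Proof.
move=> dA du; apply: is_dderive_renorm => e e0.
have e20 : 0 < e / 2 by rewrite divr_gt0.
set w := alpha (cinv d u) (limit_jet (_ :: _)).
have log_cvg : left_log c d v h @[v --> u] --> left_log c d u h.
  have c0 : (fun=> h) v @[v --> u] --> h by exact: cvg_cst.
  have cu : v @[v --> u] --> u by exact: cvg_id.
  exact: cvg_comp2 cu c0 (left_log_cvg G_lie c1 h dA du).
have jet_cvg : limit_jet (left_log c d v h :: xs) @[v --> u] -->
    limit_jet (left_log c d u h :: xs).
  pose phi v (i : option E) := if i is Some x then x else left_log c d v h.
  have phiE v : left_log c d v h :: xs = [seq phi v i | i <- None :: map Some xs].
    by rewrite /= -map_comp map_id.
  have -> : (fun v => limit_jet (left_log c d v h :: xs)) =
      fun v => limit_jet [seq phi v i | i <- None :: map Some xs].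
    by apply/funext => v; rewrite phiE.
  rewrite phiE; apply: limit_jet_continuous => -[x|] //=.
  exact: (@cvg_cst _ x _ (nbhs u)).
have F_cvg : alpha (cinv d v) (limit_jet (left_log c d v h :: xs)) @[v --> u] --> w.
  exact: alpha_cvg (cinv_cvg G_lie dA du) jet_cvg.
have [C2 C2_gt0 alphaC] := alpha_locally_bounded (cinv d u).
(* Half of [e] is for the distance of a jet from its limit, which [alpha] may enlarge by [C2]; the
   other half is for the oscillation of the limit along the segment. *)
have e'0 : 0 < e / 2 / C2 by rewrite divr_gt0.
have [C C0 [_ /= /andP[logC xsC]]] := directions_ex (left_log c d u h :: xs).
have C10 : 0 < C + 1 by rewrite ltr_wpDl // ltW.
have near_u : \forall v \near u, [/\ crange d v,
    renorm (alpha (cinv d v) (limit_jet (left_log c d v h :: xs)) - w) < e / 2,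
    forall a, renorm (alpha (cinv d v) a) <= C2 * renorm a &
    directions (size xs).+1 (C + 1) (left_log c d v h :: xs)].
  near=> v; split; near: v.
  - exact: (near_crange G_lie dA du).
  - exact: (cvg_renormP _ _).1 F_cvg _ e20.
  - exact: (cinv_cvg G_lie dA du) alphaC.
  - have n1 : \forall v \near u, N (left_log c d v h - left_log c d u h) < 1.
      exact: cvg_csn log_cvg csn_lie_norm ltr01.
    apply: filterS n1 => v v1; split=> //=; apply/andP; split.
      apply: le_trans (csn_sub csn_lie_norm _ (left_log c d u h)) _.
      by rewrite addrC lerD // ltW.
    by apply: sub_all xsC => x /le_trans; apply; rewrite lerDl.
have /nbhs_ballP[r /= r0 rP] := line_cvg u h _ near_u.
apply/nbhs_ballP; exists r => //= t tr.
have seg s : 0 <= s <= 1 -> ball 0 r (s * t).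
  move=> /andP[s0 s1]; move: tr; rewrite -ball_normE /= !sub0r !normrN.
  by apply: le_lt_trans; rewrite normrM ler_piMl // ger0_norm.
have lim : alpha (cinv d (u + t *: h)) (dpis xs (iota y)) -
    alpha (cinv d u) (dpis xs (iota y)) - t%:C *: w @[y --> Fi] -->
    alpha (cinv d (u + t *: h)) (limit_jet xs) -
    alpha (cinv d u) (limit_jet xs) - t%:C *: w.
  apply: (@tvs_cvgB R (realified R A)); last exact: cvg_cst.
  apply: (@tvs_cvgB R (realified R A)).
    by apply: alpha_cvg; [exact: cvg_cst|exact: limit_jet_cvg].
  by apply: alpha_cvg; [exact: cvg_cst|exact: limit_jet_cvg].
apply: (renorm_lim_le lim).
apply: filterS (limit_jet_unif (size xs).+1 C10 e'0) => b bP.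
rewrite mulrC.
apply: (dderive_mean A_lc (csn_renorm A) (f := fun v => alpha (cinv d v) (dpis xs (iota b)))
  (g := fun s => alpha (cinv d (u + (s * t) *: h))
    (dpis (left_log c d (u + (s * t) *: h) h :: xs) (iota b)))) => s s01.
  have [dv _ _ _] := rP _ (seg s s01).
  by apply: dorbit => //; exact/sv_dpis/iotaP.
have [dv Fv alphaCv dirv] := rP _ (seg s s01).
set v := u + (s * t) *: h in dv Fv alphaCv dirv *.
rewrite -(subrKA (alpha (cinv d v) (limit_jet (left_log c d v h :: xs)))) (splitr e).
apply: le_trans (renormD _ _) _; apply: lerD; last exact: ltW.
rewrite -(linB (alpha_linear (cinv d v))); apply: le_trans (alphaCv _) _.
by rewrite mulrC -ler_pdivlMr //; exact: bP.
Unshelve. all: by end_near. Qed.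

Lemma limit_jet_codom_continuous j :
  continuous (fun s : {ptws 'I_j -> E} => limit_jet (codom s)).
Proof.
move=> s; apply: (@limit_jet_continuous _ (nbhs s) (nbhs_filter s) _ (enum 'I_j)
  (fun s' i => s' i) (fun i => s i)) => i.
exact: (@proj_continuous _ _ i s).
Qed.

(** Each derivative adds the direction [left_log c d u h] in front, so the induction on [k] runs
    over all [j]. As that direction depends on the point, it is inserted by [Ck_subst], using that
    [limit_jet] is linear in its first direction. *)
Lemma limit_jet_Ck (k j : nat) d : AG d -> Ck k (crange d)
  (fun (s : {ptws 'I_j -> E}) u => alpha (cinv d u) (limit_jet (codom s)) : realified R A).
Proof.
move=> dA; have Uo := open_crange G_lie dA.
elim: k j => [|k IHk] j.
all: have jet_cont (s : {ptws 'I_j -> E}) u : crange d u ->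
  (alpha (cinv d z.2) (limit_jet (codom z.1)) : realified R A) @[z --> (s, u)] -->
  (alpha (cinv d u) (limit_jet (codom s)) : realified R A).
1, 3: move=> du.
1, 2: have c1' : limit_jet (codom z.1) @[z --> (s, u)] --> limit_jet (codom s)
  by exact: cvg_comp (fst_continuous (s, u)) (@limit_jet_codom_continuous j s).
1, 2: have c2' : cinv d z.2 @[z --> (s, u)] --> cinv d u
  by exact: cvg_comp (snd_continuous (s, u)) (cinv_cvg G_lie dA du).
1, 2: exact: alpha_cvg c2' c1'.
  by split.
pose f (z : ({ptws 'I_j -> E} * E) * E) u : realified R A :=
  alpha (cinv d u) (limit_jet (z.2 :: codom z.1.1)).
have fC : Ck k (crange d) f.
  pose phi (z : ({ptws 'I_j -> E} * E) * E) := ptws_cons z.1.1 z.2.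
  have phi_cont : continuous phi.
    move=> z.
    have c1' : y.1.1 @[y --> z] --> z.1.1.
      exact: cvg_comp (fst_continuous z) (fst_continuous z.1).
    exact: cvg_comp2 c1' (snd_continuous z) (@ptws_cons_continuous _ _ j (z.1.1, z.2)).
  apply: (Ck_near Uo _ (Ck_reparam phi_cont (IHk j.+1))) => z u du.
  by rewrite /phi codom_ptws_cons.
have C : Ck k (crange d) (fun (z : {ptws 'I_j -> E} * E) u => f (z, left_log c d u z.2) u).
  apply: (Ck_subst (g := fun (z : {ptws 'I_j -> E} * E) u => left_log c d u z.2)
    A_lc E_lc Uo _ fC).
    move=> z u du r x y; rewrite /f /= limit_jet_linear.
    exact: alpha_linear.
  exact: (Ck_reparam snd_continuous (left_log_Ck G_lie c1 k dA)).
apply: (CkS A_lc Uo jet_cont _ C) => s u h du.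
exact: limit_jet_dorbit.
Qed.

Lemma sv_limit_jet xs : sv (limit_jet xs).
Proof.
apply: svP => d k dA.
have := Ck_reparam (@cst_continuous E {ptws 'I_(size xs) -> E} (fun i => nth 0 xs i))
  (limit_jet_Ck k (size xs) dA).
by rewrite (codom_nth id) map_id.
Qed.

(** Now that [limit_jet xs] is known to be smooth, its orbit map has two expressions for the
    derivative at 1, from [dorbit] and from [limit_jet_dorbit]; uniqueness identifies them. *)
Lemma dpis_limit_jet xs : dpis xs (limit_jet [::]) = limit_jet xs.
Proof.
elim: xs => //= x xs ->.
have := @limit_jet_dorbit c o x xs cA (crange_origin c1).
rewrite (left_log_origin G_lie c1) (cinv_origin G_lie c1) alpha1.
have := @dorbit _ c o x (sv_limit_jet xs) cA (crange_origin c1).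
rewrite (left_log_origin G_lie c1) (cinv_origin G_lie c1) alpha1.
exact: is_dderive_unique.
Qed.

Lemma sv_complete : exists b : sv_space, Fi --> b.
Proof.
exists (of_sv (sv_limit_jet [::])).
apply/(@sv_cvgP _ Fi _ id) => n e e0.
have e20 : 0 < e / 2 by rewrite divr_gt0.
apply: filterS (limit_jet_unif n ltr01 e20) => b bP.
rewrite of_svK; apply: (@le_lt_trans _ _ (e / 2)); last first.
  by rewrite ltr_pdivrMr // ltr_pMr // ltr1n.
apply: pnorm_le => [|xs xsP]; first by apply: sv_sub; [exact: iotaP|exact: sv_limit_jet].
rewrite dpisB; [|exact: iotaP|exact: sv_limit_jet].
by rewrite dpis_limit_jet; exact: bP.
Qed.

End Completeness.

(** * Smoothness of the action *)

Local Notation B_R := (realified R sv_space).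

Lemma csn_pnorm n : continuous_seminorm (fun b : B_R => pnorm n (iota b)).
Proof.
split=> [x y|r x|e e0].
- by rewrite raddfD pnormD //; exact: iotaP.
- rewrite -[iota (r *: x)]/(iota (r%:C *: (x : sv_space))) linearZ /= pnormZ; last exact: iotaP.
  by rewrite normc_def /= expr0n addr0 sqrtr_sqr.
by exists n, e; split => // y /(_ n (leqnn n)); rewrite subr0.
Qed.

Lemma seminormed_sv : seminormed_space B_R.
Proof.
split; first exact: sv_hausdorff.
move=> W [n [e [e0 eW]]].
(* The sum dominates each of the seminorms up to order [n]. *)
exists (fun b : B_R => e^-1 * \sum_(k < n.+1) pnorm k (iota b)).
  apply: csn_scale; first by rewrite invr_ge0 ltW.
  elim: n.+1 => [|m [IH1 IH2 IH3]].
    by split=> [x y|r x|e' e'0]; rewrite ?big_ord0 ?addr0 ?mulr0 //;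
      near=> b; rewrite big_ord0.
  split=> [x y|r x|e' e'0].
  - by rewrite !big_ord_recr /= addrACA lerD //; exact: csnD (csn_pnorm m) _ _.
  - by rewrite !big_ord_recr /= IH2 (csnZ (csn_pnorm m)) mulrDr.
  have e'20 : 0 < e' / 2 by rewrite divr_gt0.
  apply: filterS2 (IH3 _ e'20) (csn_near (csn_pnorm m) e'20) => b b1 b2.
  by rewrite big_ord_recr /= (splitr e') ltrD.
move=> b /=; rewrite ltr_pdivrMl // mulr1 => b_lt; apply: eW => k kn.
apply: le_lt_trans b_lt; rewrite subr0 (bigD1 (Ordinal (kn : (k < n.+1)%N))) //= lerDl.
by apply: sumr_ge0 => i _; exact/pnorm_ge0/iotaP.
Unshelve. all: by end_near. Qed.

Definition act g (b : sv_space) : sv_space := of_sv (sv_alpha g (iotaP b)).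

Lemma iota_act g (b : sv_space) : iota (act g b) = alpha g (iota b).
Proof. by []. Qed.

Definition infinitesimal x (b : sv_space) : sv_space := of_sv (sv_dpi x (iotaP b)).

Lemma act_linear g : linear (act g : B_R -> B_R).
Proof.
by move=> r x y; apply: iota_inj; rewrite linearP /= !iota_act linearP alpha_linearC.
Qed.

Lemma infinitesimal_linearl (b : sv_space) :
  linear ((fun x => infinitesimal x b) : E -> B_R).
Proof.
move=> r x y; apply: iota_inj; rewrite linearP /=.
exact: (dpi_linear (iotaP b)).
Qed.

Lemma infinitesimal_linearr x : linear (infinitesimal x : B_R -> B_R).
Proof.
move=> r b b'; apply: iota_inj; rewrite linearP /= !of_svK linearP dpi_linearC //.
all: exact: iotaP.
Qed.

(** Jointly continuous at the price of one order: p_n of the value is at most the norm of [x] times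
    p_(n+1) of the vector. *)
Lemma infinitesimal_continuous :
  continuous (fun z : E * B_R => infinitesimal z.1 z.2 : B_R).
Proof.
move=> [x0 b0]; apply/sv_cvgP => n e e0.
have Nx0 : 0 < N x0 + 1 by rewrite ltr_wpDl // lie_norm_ge0.
have pb0 : 0 < pnorm n.+1 (iota b0) + 1 by rewrite ltr_wpDl // pnorm_ge0 //; exact: iotaP.
have e20 : 0 < e / 2 by rewrite divr_gt0.
have e1 : 0 < e / 2 / (N x0 + 1) by rewrite divr_gt0.
have e2 : 0 < e / 2 / (pnorm n.+1 (iota b0) + 1) by rewrite divr_gt0.
near=> z.
have z1 : N (z.1 - x0) < 1.
  by near: z; exact: cvg_csn (fst_continuous (x0, b0)) csn_lie_norm ltr01.
have z1e : N (z.1 - x0) < e / 2 / (pnorm n.+1 (iota b0) + 1).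
  by near: z; exact: cvg_csn (fst_continuous (x0, b0)) csn_lie_norm e2.
have z2e : pnorm n.+1 (iota (z.2 - b0)) < e / 2 / (N x0 + 1).
  by near: z; exact: cvg_csn (snd_continuous (x0, b0)) (csn_pnorm n.+1) e1.
rewrite /= !of_svK.
have -> : dpi z.1 (iota z.2) - dpi x0 (iota b0) =
    dpi z.1 (iota (z.2 - b0)) + dpi (z.1 - x0) (iota b0).
  have -> : dpi (z.1 - x0) (iota b0) = dpi z.1 (iota b0) - dpi x0 (iota b0).
    exact: (linB (dpi_linear (iotaP b0))).
  have -> : dpi z.1 (iota (z.2 - b0)) = dpi z.1 (iota z.2) - dpi z.1 (iota b0).
    by rewrite raddfB; exact: (dpisB [:: z.1] (iotaP _) (iotaP _)).
  by rewrite subrKA.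
have sv1 := sv_dpi z.1 (iotaP (z.2 - b0)).
have sv2 := sv_dpi (z.1 - x0) (iotaP b0).
apply: le_lt_trans (pnormD n sv1 sv2) _; rewrite (splitr e) ltrD //.
  apply: le_lt_trans (pnorm_dpi _ _ (iotaP _)) _.
  apply: (@le_lt_trans _ _ ((N x0 + 1) * pnorm n.+1 (iota (z.2 - b0)))).
    rewrite ler_wpM2r ?pnorm_ge0 //; first exact: iotaP.
    apply: le_trans (csn_sub csn_lie_norm _ x0) _.
    by rewrite addrC lerD2l ltW.
  by rewrite mulrC -ltr_pdivlMr.
apply: le_lt_trans (pnorm_dpi _ _ (iotaP _)) _.
apply: (@le_lt_trans _ _ (N (z.1 - x0) * (pnorm n.+1 (iota b0) + 1))).
  by rewrite ler_wpM2l ?lie_norm_ge0 // lerDl.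
by rewrite -ltr_pdivlMr.
Unshelve. all: by end_near. Qed.

(** The mean value inequality for p_n: it is applied in [A] to each [dpis xs] of the orbit map, with
    derivative from [dorbit_dpis], and the supremum over [xs] is taken at the end. *)
Lemma orbit_increment d u h (t M : R) n a (w0 : A) : sv a -> sv w0 -> AG d ->
  (forall s : R, 0 <= s <= 1 -> crange d (u + (s * t) *: h)) ->
  (forall s : R, 0 <= s <= 1 ->
    pnorm n (alpha (cinv d (u + (s * t) *: h))
      (dpi (left_log c d (u + (s * t) *: h) h) a) - w0) <= M) ->
  pnorm n (alpha (cinv d (u + t *: h)) a - alpha (cinv d u) a - t%:C *: w0) <= `|t| * M.
Proof.
move=> a_sv w_sv dA seg segM.
have sv1 := sv_alpha (cinv d (u + t *: h)) a_sv.
have sv2 := sv_alpha (cinv d u) a_sv.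
apply: pnorm_le => [|xs xsP].
  by apply: sv_sub; [exact: sv_sub|exact: sv_scale].
rewrite dpisB; [|exact: sv_sub|exact: sv_scale].
rewrite dpisB // dpis_scale //.
apply: (dderive_mean A_lc (csn_renorm A)
  (f := fun v => dpis xs (alpha (cinv d v) a)) (w := dpis xs w0)
  (g := fun s => dpis xs (alpha (cinv d (u + (s * t) *: h))
    (dpi (left_log c d (u + (s * t) *: h) h) a)))) => s s01.
  by apply: dorbit_dpis => //; exact: seg.
rewrite -[_ - _](dpisB xs _ w_sv); last exact/sv_alpha/sv_dpi.
apply: le_trans (segM s s01); apply: pnorm_ub => //.
by apply: sv_sub => //; exact/sv_alpha/sv_dpi.
Qed.

(** The change of the vector is controlled by local equicontinuity. The change of the group element
    is a mean value estimate, whose derivative is small because [left_log] is continuous at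
    [(u0, 0)] and vanishes there. *)
Lemma act_chart_cvg d u0 (b0 : B_R) : AG d -> crange d u0 ->
  {for (b0, u0), continuous (fun z : B_R * E => act (cinv d z.2) z.1 : B_R)}.
Proof.
move=> dA du0; apply/sv_cvgP => n e e0.
have [C C0 actC] := pnorm_alpha_bounded dA du0.
have C'0 : 0 < C ^+ n.+1 by rewrite exprn_gt0.
have e20 : 0 < e / 2 by rewrite divr_gt0.
have e1 : 0 < e / 2 / C ^+ n.+1 by rewrite divr_gt0.
pose K := C ^+ n.+1 * (pnorm n.+1 (iota b0) + 1).
have K0 : 0 < K.
  by rewrite mulr_gt0 // ltr_wpDl // pnorm_ge0 //; exact: iotaP.
have e2 : 0 < e / 4 / K by rewrite !divr_gt0.
have log_lim := left_log_cvg G_lie c1 (0 : E) dA du0.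
have log0 : left_log c d u0 0 = 0 by exact: (lin0 (left_log_linear G_lie c1 dA du0)).
have log_small : nbhs (left_log c d u0 0) [set x | N x < e / 4 / K].
  by rewrite log0; apply/lie_norm_nbhs; exists (e / 4 / K).
have [[V W] /= [Vu0 W0] VW] := log_lim _ log_small.
have VC : nbhs u0 (V `&` [set u | crange d u /\
    forall n a, sv a -> pnorm n (alpha (cinv d u) a) <= C ^+ n.+1 * pnorm n a]).
  exact: filterI.
have /nbhs_ballP[r /= r0 rVC] := VC.
have Ws : \forall u \near u0, W (u - u0).
  have : u - u0 @[u --> u0] --> u0 - u0.
    by apply: (@tvs_cvgB R E); [exact: cvg_id|exact: cvg_cst].
  by rewrite subrr; exact.
have near_u0 : \forall u \near u0, ball u0 r u /\ W (u - u0).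
  by apply: filterS2 (nbhsx_ballx u0 r r0) Ws.
have near_z1 : nbhs (b0, u0) [set z : B_R * E | ball u0 r z.2 /\ W (z.2 - u0)].
  exact: (@snd_continuous B_R E (b0, u0)) near_u0.
have near_z2 : nbhs (b0, u0)
    [set z : B_R * E | pnorm n (iota (z.1 - b0)) < e / 2 / C ^+ n.+1].
  exact: cvg_csn (@fst_continuous B_R E (b0, u0)) (csn_pnorm n) e1.
apply: filterS2 near_z1 near_z2 => z [zr zW] zb.
have [_ [dz actz]] := rVC _ zr.
rewrite !iota_act.
have -> : alpha (cinv d z.2) (iota z.1) - alpha (cinv d u0) (iota b0) =
    alpha (cinv d z.2) (iota (z.1 - b0)) +
    (alpha (cinv d z.2) (iota b0) - alpha (cinv d u0) (iota b0)).
  by rewrite raddfB (linB (alpha_linear (cinv d z.2))) subrKA.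
have sv1 := sv_alpha (cinv d z.2) (iotaP (z.1 - b0)).
have sv2 := sv_alpha (cinv d z.2) (iotaP b0).
have sv3 := sv_alpha (cinv d u0) (iotaP b0).
apply: le_lt_trans (pnormD n sv1 (sv_sub sv2 sv3)) _; rewrite (splitr e) ltrD //.
  apply: le_lt_trans (actz n _ (iotaP _)) _.
  by rewrite mulrC -ltr_pdivlMr.
(* With [w0 = 0] the estimate is one for the plain increment; [e / 4] leaves room for a strict
   inequality. *)
have := @orbit_increment d u0 (z.2 - u0) 1 (e / 4) n (iota b0) 0 (iotaP b0) sv_0 dA.
rewrite scale1r subrKC scaler0 subr0 normr1 mul1r.
have seg s : 0 <= s <= 1 -> ball u0 r (u0 + (s * 1) *: (z.2 - u0)).
  move=> /andP[s0 s1]; move: zr; rewrite -!ball_normE /= mulr1 opprD addrA subrr sub0r.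
  rewrite normrN normrZ distrC => zr; apply: le_lt_trans zr.
  by rewrite ler_piMl // ger0_norm.
move=> H; apply: le_lt_trans (H _ _) _.
- by move=> s s01; have [_ []] := rVC _ (seg s s01).
- move=> s s01; have [sV [ds acts]] := rVC _ (seg s s01).
  rewrite subr0; apply: le_trans (acts n _ (sv_dpi _ (iotaP b0))) _.
  have log_lt := VW (_, _) (conj sV zW).
  apply: (@le_trans _ _ (C ^+ n.+1 * (e / 4 / K * (pnorm n.+1 (iota b0) + 1)))).
    rewrite ler_wpM2l ?(ltW C'0) //.
    apply: le_trans (pnorm_dpi _ _ (iotaP b0)) _.
    apply: ler_pM; [exact: lie_norm_ge0|exact/pnorm_ge0/iotaP|exact: ltW|].
    by rewrite lerDl.
  by rewrite mulrCA -/K divfK // gt_eqF.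
by rewrite ltr_pM2l // ltf_pV2 ?posrE // ltr_nat.
Unshelve. all: by end_near. Qed.

(** The candidate derivative is continuous along the segment by [act_chart_cvg], so
    [orbit_increment] makes the difference quotients converge in every p_n. *)
Lemma is_dderive_act d u h (b : sv_space) : AG d -> crange d u ->
  is_dderive (fun v => act (cinv d v) b : B_R) u h
    (act (cinv d u) (infinitesimal (left_log c d u h) b)).
Proof.
move=> dA du; apply/sv_cvgP => n e e0.
have e20 : 0 < e / 2 by rewrite divr_gt0.
set w := act _ (infinitesimal _ _).
have log_lim : left_log c d v h @[v --> u] --> left_log c d u h.
  have c0 : (fun=> h) v @[v --> u] --> h by exact: cvg_cst.
  have cu : v @[v --> u] --> u by exact: cvg_id.
  exact: cvg_comp2 cu c0 (left_log_cvg G_lie c1 h dA du).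
have inf_lim : (infinitesimal (left_log c d v h) b : B_R) @[v --> u] -->
    (infinitesimal (left_log c d u h) b : B_R).
  have c0 : (fun=> b : B_R) v @[v --> u] --> (b : B_R) by exact: cvg_cst.
  exact: cvg_comp2 log_lim c0 (@infinitesimal_continuous (left_log c d u h, b : B_R)).
have cu : v @[v --> u] --> u by exact: cvg_id.
have act_lim : (act (cinv d v) (infinitesimal (left_log c d v h) b) : B_R) @[v --> u] -->
    (w : B_R).
  exact: (cvg_comp2 (b := fun (b : B_R) v => act (cinv d v) b : B_R) inf_lim cu
    (@act_chart_cvg d u (infinitesimal (left_log c d u h) b) dA du)).
have near_act : \forall v \near u,
    pnorm n (iota (act (cinv d v) (infinitesimal (left_log c d v h) b)) - iota w) < e / 2.
  exact: (@sv_cvgP _ _ _ _ _).1 act_lim n _ e20.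
have near_both : \forall v \near u,
    pnorm n (iota (act (cinv d v) (infinitesimal (left_log c d v h) b)) - iota w) < e / 2 /\
    crange d v by exact: filterI near_act (near_crange G_lie dA du).
have /nbhs_ballP[r /= r0 rP] := @line_cvg R E u h _ near_both.
rewrite near_withinE; apply/nbhs_ballP; exists r => //= t tr t0.
have seg s : 0 <= s <= 1 -> ball 0 r (s * t).
  move=> /andP[s0 s1]; move: tr; rewrite -ball_normE /= !sub0r !normrN.
  by apply: le_lt_trans; rewrite normrM ler_piMl // ger0_norm.
have tn0 : 0 < `|t| by rewrite normr_gt0.
have := @orbit_increment d u h t (e / 2) n (iota b) (iota w) (iotaP b) (iotaP w) dA.
move=> H; have {}H := H (fun s s01 => (rP _ (seg s s01)).2)
  (fun s s01 => ltW (rP _ (seg s s01)).1).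
rewrite -(ltr_pM2l tn0) -raddfB -(csnZ (csn_pnorm n)) scalerBr scalerA divff // scale1r.
have -> : iota (act (cinv d (u + t *: h)) b - act (cinv d u) b - (t *: (w : B_R)) : sv_space) =
    alpha (cinv d (u + t *: h)) (iota b) - alpha (cinv d u) (iota b) - t%:C *: iota w.
  by rewrite !raddfB /= -[iota (t *: (w : B_R))]/(iota (t%:C *: w)) linearZ.
apply: le_lt_trans H _.
by rewrite ltr_pM2l // ltr_pdivrMr // ltr_pMr // ltr1n.
Qed.

(** The derivative is the action again, applied to the vector [infinitesimal (left_log c d u h) b].
    Linearity in the vector allows this substitution, and the induction feeds on itself. *)
Lemma act_Ck (k : nat) d : AG d ->
  Ck k (crange d) (fun (b : B_R) u => act (cinv d u) b : B_R).
Proof.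
move=> dA; have Uo := open_crange G_lie dA; have B_lc := seminormed_sv.
have act_cont (b : B_R) u : crange d u ->
    (act (cinv d z.2) z.1 : B_R) @[z --> (b, u)] --> (act (cinv d u) b : B_R).
  by move=> du; exact: act_chart_cvg.
elim: k => [|k IHk]; first by split.
have gC : Ck k (crange d) (fun (z : B_R * E) u => infinitesimal (left_log c d u z.2) z.1 : B_R).
  apply: (Ck_bilin E_lc B_lc B_lc Uo infinitesimal_linearr infinitesimal_linearl
    infinitesimal_continuous).
    exact: (Ck_reparam snd_continuous (left_log_Ck G_lie c1 k dA)).
  by apply: Ck_cst => //; exact: fst_continuous.
apply: (CkS B_lc Uo act_cont (P := B_R)
  (f := fun (b : B_R) u => act (cinv d u) b : B_R)
  (df := fun (z : B_R * E) u => act (cinv d u) (infinitesimal (left_log c d u z.2) z.1) : B_R)).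
  by move=> b u h du; exact: is_dderive_act.
apply: (Ck_subst (f := fun (z : (B_R * E) * B_R) u => act (cinv d u) z.2 : B_R)
  B_lc B_lc Uo _ _ gC).
  by move=> z u du; exact: act_linear.
exact: (Ck_reparam snd_continuous IHk).
Qed.

(** In [act_Ck] the vector is only a continuous parameter; linearity in it lets [Ck_subst] turn the
    parameter into a variable of differentiation. *)
Lemma act_smooth : smooth_map (prod_atlas AG (@flat_atlas B_R)) (@flat_atlas B_R)
  (fun p : G * B_R => act p.1 p.2).
Proof.
have B_lc := seminormed_sv.
split.
  move=> [g b]; have [d dA dg] := lie_chart_ex G_lie g.
  have c1' : cfun d p.1 @[p --> (g, b)] --> cfun d g.
    exact: cvg_comp (fst_continuous (g, b)) (cfun_cvg G_lie dA dg).
  have lim : (act (cinv d (cfun d p.1)) p.2 : B_R) @[p --> (g, b)] -->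
      (act (cinv d (cfun d g)) b : B_R).
    exact: (cvg_comp2 (b := fun (b : B_R) u => act (cinv d u) b : B_R)
      (@snd_continuous G B_R (g, b)) c1' (@act_chart_cvg d _ b dA (crange_cfun dg))).
  move: lim; rewrite (cinvK G_lie) //; apply: cvg_trans; apply: near_eq_cvg.
  have near_d : nbhs (g, b) [set p : G * B_R | cdom d p.1].
    exact: (@fst_continuous G B_R (g, b)) (near_cdom G_lie dA dg).
  by apply: filterS near_d => p dp; rewrite (cinvK G_lie).
move=> _ _ [d [_ [dA -> ->]]] ->.
have Uo : open (crange d `*` [set: B_R]).
  by apply: open_setX; [exact: open_crange dA|exact: openT].
rewrite (_ : crange _ `&` _ = crange d `*` [set: B_R]).
  apply: Ck_smooth_on => // P k.
  have C1 : Ck k (crange d `*` [set: B_R])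
      (fun (z : P * B_R) (w : E * B_R) => act (cinv d w.1) z.2 : B_R).
    apply: (Ck_comp (E := (E * B_R)%type) E_lc B_lc Uo (open_crange G_lie dA)
      (f := fun (z : P * B_R) u => act (cinv d u) z.2 : B_R)
      (g := fun (_ : P * B_R) (w : E * B_R) => w.1)).
    - by move=> _ w [].
    - exact: (Ck_reparam snd_continuous (act_Ck k dA)).
    - by apply: Ck_lin => //; exact: fst_continuous.
  have C2 : Ck k (crange d `*` [set: B_R]) (fun (_ : P) (w : E * B_R) => w.2).
    by apply: Ck_lin => //; exact: snd_continuous.
  apply: (Ck_near Uo _ (Ck_subst B_lc B_lc Uo _ C1 C2)) => //.
  by move=> p w _; exact: act_linear.
apply/seteqP; split=> [[u b] [[[g b'] [/= dg _] [<- _]] _]|[u b] [/= [g dg <-] _]].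
  by split=> //; exact: crange_cfun.
by split => //; exists (g, b).
Qed.

(** * The continuous inverse algebra of smooth vectors *)

(** Splitting off the innermost direction gives two products by the Leibniz rule, which doubles the
    constant. All orders up to [n] must be bounded because the derivatives are distributed over both
    factors. *)
Lemma pnorm_cmul n a b (Ma Mb : R) : sv a -> sv b ->
  (forall k : nat, (k <= n)%N -> pnorm k a <= Ma) ->
  (forall k : nat, (k <= n)%N -> pnorm k b <= Mb) ->
  pnorm n (cmul a b) <= 2 ^+ n * (Ma * Mb).
Proof.
elim: n a b Ma Mb => [|n IHn] a b Ma Mb a_sv b_sv aM bM.
  rewrite pnorm0E; last exact: sv_cmul.
  rewrite expr0 mul1r; apply: le_trans (renormM _ _) _.
  by rewrite -!pnorm0E // ler_pM ?pnorm_ge0 ?aM ?bM.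
have Ma0 : 0 <= Ma by apply: le_trans (aM 0%N _) => //; exact: pnorm_ge0.
have Mb0 : 0 <= Mb by apply: le_trans (bM 0%N _) => //; exact: pnorm_ge0.
apply: pnorm_le => [|xs]; first exact: sv_cmul.
case/lastP: xs => [[//]|xs x] [xs_n xs1].
move: xs_n xs1; rewrite size_rcons all_rcons => -[xs_n] /andP[x1 xs1].
rewrite /dpis foldr_rcons dpi_cmul // -/(dpis xs _).
have dpiM (v : A) M (k : nat) : sv v -> (forall j : nat, (j <= n.+1)%N -> pnorm j v <= M) ->
    (k <= n)%N -> pnorm k (dpi x v) <= M.
  move=> v_sv vM kn; apply: le_trans (pnorm_dpi _ _ v_sv) _.
  apply: le_trans (vM k.+1 kn).
  by rewrite ler_piMl // pnorm_ge0.
have [sva svb] := (sv_dpi x a_sv, sv_dpi x b_sv).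
have [sv1 sv2] := (sv_cmul sva b_sv, sv_cmul a_sv svb).
have le1 := IHn _ _ Ma Mb sva b_sv (fun (k : nat) => dpiM a Ma k a_sv aM)
  (fun (k : nat) kn => bM k (leqW kn)).
have le2 := IHn _ _ Ma Mb a_sv svb (fun (k : nat) kn => aM k (leqW kn))
  (fun (k : nat) => dpiM b Mb k b_sv bM).
have xsP : directions n 1 xs by [].
apply: le_trans (pnorm_ub (sv_add sv1 sv2) xsP) _.
apply: le_trans (pnormD n sv1 sv2) _; apply: le_trans (lerD le1 le2) _.
by rewrite exprS -mulrA mulr_natl mulr2n.
Qed.

Lemma pnorm_bound_le n a : sv a ->
  exists2 M : R, 0 < M & forall k : nat, (k <= n)%N -> pnorm k a <= M.
Proof.
move=> a_sv; elim: n => [|n [M M0 aM]].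
  exists (pnorm 0 a + 1) => [|k]; first by rewrite ltr_wpDl // pnorm_ge0.
  by rewrite leqn0 => /eqP->; rewrite lerDl.
exists (Num.max M (pnorm n.+1 a)) => [|k]; first by rewrite lt_max M0.
rewrite leq_eqVlt => /orP[/eqP->|kn]; first by rewrite le_max lexx orbT.
by rewrite le_max aM.
Qed.

Lemma pnorm_star n a : sv a -> pnorm n (star a) <= pnorm n a.
Proof.
move=> a_sv; apply: pnorm_le => [|xs xsP]; first exact: sv_star.
have -> : dpis xs (star a) = star (dpis xs a).
  elim: {xsP}xs => //= x xs ->; rewrite dpi_star //; exact: sv_dpis.
by rewrite renorm_star pnorm_ub.
Qed.

Lemma pnormN n a : sv a -> pnorm n (- a) = pnorm n a.
Proof. by move=> a_sv; rewrite -scaleN1r pnormZ // normrN1 mul1r. Qed.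

Lemma pnorm_sub_lt n a b (M e : R) : sv a -> sv b ->
  pnorm n b <= M -> pnorm n (a - b) <= e -> pnorm n a <= M + e.
Proof.
move=> a_sv b_sv bM abe; rewrite -[a](subrK b) addrC.
by apply: le_trans (pnormD n b_sv (sv_sub a_sv b_sv)) _; rewrite lerD.
Qed.

Definition sv_one : sv_space := of_sv sv_cone.

Definition sv_mul (a b : sv_space) : sv_space := of_sv (sv_cmul (iotaP a) (iotaP b)).

Definition sv_adj (a : sv_space) : sv_space := of_sv (sv_star (iotaP a)).

Lemma sv_adj_continuous : continuous sv_adj.
Proof.
move=> a; apply/(@sv_cvgP _ (nbhs a) (nbhs_filter a) sv_adj) => n e e0.
have near_a : nbhs a [set b : sv_space | pnorm n (iota (b - a)) < e].
  by exists n, e; split => // b /(_ n (leqnn n)).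
apply: filterS near_a => b; apply: le_lt_trans.
rewrite !of_svK -(linB (@star_linear R A)) raddfB.
by apply: pnorm_star; apply: sv_sub; exact: iotaP.
Qed.

Lemma near_pnorm n (a : sv_space) (e : R) : 0 < e ->
  nbhs a [set b : sv_space | forall k : nat, (k <= n)%N -> pnorm k (iota (b - a)) < e].
Proof. by move=> e0; exists n, e; split. Qed.

Lemma pnorm_mul3 n a b b' (M1 M2 M3 : R) : sv a -> sv b -> sv b' ->
  (forall k : nat, (k <= n)%N -> pnorm k a <= M1) ->
  (forall k : nat, (k <= n)%N -> pnorm k b <= M2) ->
  (forall k : nat, (k <= n)%N -> pnorm k b' <= M3) ->
  pnorm n (cmul (cmul a b) b') <= 2 ^+ n * (2 ^+ n * (M1 * M2) * M3).
Proof.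
move=> a_sv b_sv b'_sv aM bM b'M.
have M1_0 : 0 <= M1 by apply: le_trans (aM 0%N _) => //; exact: pnorm_ge0.
have M2_0 : 0 <= M2 by apply: le_trans (bM 0%N _) => //; exact: pnorm_ge0.
apply: pnorm_cmul => //; first exact: sv_cmul.
move=> k kn; apply: (@le_trans _ _ (2 ^+ k * (M1 * M2))).
  by apply: pnorm_cmul => // j jk; [apply: aM|apply: bM]; exact: leq_trans jk kn.
by rewrite ler_wpM2r ?mulr_ge0 // ler_weXn2l // ler1n.
Qed.

Lemma sv_mul_continuous : continuous (fun p : sv_space * sv_space => sv_mul p.1 p.2).
Proof.
move=> [a0 b0]; apply/(@sv_cvgP _ (nbhs (a0, b0)) (nbhs_filter (a0, b0))
  (fun p => sv_mul p.1 p.2)) => n e e0.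
have [Ma Ma0 aM] := pnorm_bound_le n (iotaP a0).
have [Mb Mb0 bM] := pnorm_bound_le n (iotaP b0).
pose K := 2 ^+ n * (Ma + (Mb + 1)).
have K0 : 0 < K by rewrite mulr_gt0 ?exprn_gt0 // !addr_gt0.
(* The bound 1 controls the second factor by [Mb + 1], the other bound makes the total [r * K] at
   most [e / 2]. *)
pose r := Num.min 1 (e / 2 / K).
have r0 : 0 < r by rewrite lt_min ltr01 !divr_gt0.
have r1 : r <= 1 by rewrite ge_min lexx.
pose near_r (b : sv_space) := [set b' : sv_space |
  forall k : nat, (k <= n)%N -> pnorm k (iota (b' - b)) < r].
exists (near_r a0, near_r b0); first by split; exact: near_pnorm.
move=> [a b] [/= ar br].
have -> : cmul (iota a) (iota b) - cmul (iota a0) (iota b0) =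
    cmul (iota (a - a0)) (iota b) + cmul (iota a0) (iota (b - b0)).
  by rewrite !raddfB cmulBl cmulBr subrKA.
have bM1 (k : nat) : (k <= n)%N -> pnorm k (iota b) <= Mb + 1.
  move=> kn; apply: (pnorm_sub_lt (iotaP b) (iotaP b0)); first exact: bM.
  by rewrite -raddfB (le_trans (ltW (br k kn))).
have sv1 := sv_cmul (iotaP (a - a0)) (iotaP b).
have sv2 := sv_cmul (iotaP a0) (iotaP (b - b0)).
apply: le_lt_trans (pnormD n sv1 sv2) _.
have le1 := pnorm_cmul (iotaP (a - a0)) (iotaP b) (fun (k : nat) kn => ltW (ar k kn)) bM1.
have le2 := pnorm_cmul (iotaP a0) (iotaP (b - b0)) aM (fun (k : nat) kn => ltW (br k kn)).
apply: le_lt_trans (lerD le1 le2) _.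
have -> : 2 ^+ n * (r * (Mb + 1)) + 2 ^+ n * (Ma * r) = r * K by rewrite /K; ring.
apply: (@le_lt_trans _ _ (e / 2)); last by rewrite ltr_pdivrMr // ltr_pMr // ltr1n.
by rewrite -ler_pdivlMr // /r ge_min lexx orbT.
Qed.

(** Write x, x0 for the images of [a] under g, g0 and x', x0' for those of [a']. The identity x' -
    x0' = - x' (x - x0) x0' makes the orbit of [a'] differentiable, with a derivative polynomial in
    that orbit, of class C^k by induction, and in the derivative of the orbit of [a]. *)
Lemma orbit_inverse_Ck (k : nat) a a' d : sv a -> cmul a a' = cone -> cmul a' a = cone ->
  AG d -> Ck k (crange d) (fun (_ : E) u => alpha (cinv d u) a' : realified R A).
Proof.
move=> a_sv aa' a'a dA; have Uo := open_crange G_lie dA.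
have orb_cont (p : E) u : crange d u ->
    (alpha (cinv d z.2) a' : realified R A) @[z --> (p, u)] --> alpha (cinv d u) a'.
  move=> du; apply: alpha_cvg; last exact: cvg_cst.
  exact: cvg_comp (snd_continuous (p, u)) (cinv_cvg G_lie dA du).
elim: k => [|k IHk]; first by split.
pose dpsi (z : E * E) u := dderive (fun u => alpha (cinv d u) a : realified R A) u z.2.
pose df (z : E * E) u : realified R A :=
  - cmul (cmul (alpha (cinv d u) a') (dpsi z u)) (alpha (cinv d u) a').
have IH : Ck k (crange d) (fun (_ : E * E) u => alpha (cinv d u) a' : realified R A).
  exact: (Ck_reparam fst_continuous IHk).
have dpsiC : Ck k (crange d) dpsi := Ck_dderive (sv_Ck E k.+1 a_sv dA).
have C1 := Ck_bilin A_lc A_lc A_lc Uo (@cmul_linearr R A) (@cmul_linearl R A)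
  (@cmul_continuous R A) IH dpsiC.
have C2 := Ck_bilin A_lc A_lc A_lc Uo (@cmul_linearr R A) (@cmul_linearl R A)
  (@cmul_continuous R A) C1 IH.
have N_lin : linear (-%R : realified R A -> realified R A).
  by move=> r x y; rewrite opprD scalerN.
have C := Ck_postlin A_lc A_lc Uo N_lin (@opp_continuous (realified R A)) C2.
apply: (CkS A_lc Uo orb_cont (df := df) _ C) => p u h du.
have psi_der := dderivable_Ck (0 : E) h A_lc (sv_Ck E 1 a_sv dA) du.
have line_lim : alpha (cinv d (u + t *: h)) a' @[t --> (0 : R)^'] --> alpha (cinv d u) a'.
  have cu : u + t *: h @[t --> (0 : R)^'] --> u.
    exact: cvg_comp (@nbhs_dnbhs _ (0 : R)) (line_cvg u h).
  have ca : (fun=> a') t @[t --> (0 : R)^'] --> a' by exact: cvg_cst.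
  exact: alpha_cvg (cvg_comp _ _ cu (cinv_cvg G_lie dA du)) ca.
have lim1 : (cmul (alpha (cinv d (u + t *: h)) a')
    (t^-1 *: (alpha (cinv d (u + t *: h)) a - alpha (cinv d u) a : realified R A)) : realified R A)
    @[t --> (0 : R)^'] --> cmul (alpha (cinv d u) a') (dpsi (p, h) u).
  exact: cvg_comp2 line_lim psi_der (@cmul_continuous R A (_, _)).
have ca : (fun=> alpha (cinv d u) a') t @[t --> (0 : R)^'] --> alpha (cinv d u) a'.
  exact: cvg_cst.
have lim2 : (cmul (cmul (alpha (cinv d (u + t *: h)) a')
    (t^-1 *: (alpha (cinv d (u + t *: h)) a - alpha (cinv d u) a : realified R A)))
    (alpha (cinv d u) a') : realified R A)
    @[t --> (0 : R)^'] --> cmul (cmul (alpha (cinv d u) a') (dpsi (p, h) u)) (alpha (cinv d u) a').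
  exact: cvg_comp2 lim1 ca (@cmul_continuous R A (_, _)).
have lim3 := cvg_comp _ _ lim2 (@opp_continuous (realified R A) _).
apply: cvg_trans lim3; apply: near_eq_cvg; apply: nearW => t /=.
set g := cinv d (u + t *: h); set g0 := cinv d u.
rewrite (linZ (cmul_linearr (alpha g a'))) (linZ (cmul_linearl (alpha g0 a'))) -scalerN.
congr (_ *: _).
have mulg1 g' : cmul (alpha g' a') (alpha g' a) = cone by rewrite -alpha_cmul a'a alpha_cone.
have mulg2 g' : cmul (alpha g' a) (alpha g' a') = cone by rewrite -alpha_cmul aa' alpha_cone.
by rewrite cmulBr cmulBl mulg1 cmul1a -cmulA mulg2 cmula1 opprB.
Qed.

Lemma sv_inverse a a' : sv a -> cmul a a' = cone -> cmul a' a = cone -> sv a'.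
Proof. by move=> a_sv aa' a'a; apply: svP => d n dA; exact: (orbit_inverse_Ck n a_sv). Qed.

Lemma dpi_cone x : dpi x cone = 0.
Proof.
have := dpi_cmul x sv_cone sv_cone; rewrite !cmul1a cmula1 => /eqP.
by rewrite -subr_eq0 opprD addrA subrr sub0r oppr_eq0 => /eqP.
Qed.

Lemma dpi_inverse x a a' : sv a -> cmul a a' = cone -> cmul a' a = cone ->
  dpi x a' = - cmul (cmul a' (dpi x a)) a'.
Proof.
move=> a_sv aa' a'a; have a'_sv := sv_inverse a_sv aa' a'a.
have := dpi_cmul x a_sv a'_sv; rewrite aa' dpi_cone => /esym/eqP.
rewrite addr_eq0 => /eqP e.
have : cmul a' (cmul a (dpi x a')) = dpi x a' by rewrite cmulA a'a cmul1a.
move=> <-; rewrite -[cmul a (dpi x a')]opprK -e.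
by rewrite (linN (cmul_linearr a')) cmulA.
Qed.

Definition sv_units : set sv_space :=
  [set b | exists b' : sv_space, sv_mul b b' = sv_one /\ sv_mul b' b = sv_one].

Lemma sv_unitsP (b : sv_space) a' : cmul (iota b) a' = cone -> cmul a' (iota b) = cone ->
  sv_units b.
Proof.
move=> ba' a'b; exists (of_sv (sv_inverse (iotaP b) ba' a'b)).
by split; apply: iota_inj; rewrite !of_svK.
Qed.

Lemma open_sv_units : open sv_units.
Proof.
rewrite openE => b [b' [bb' b'b]]; rewrite /interior /=.
have [ibb' ib'b] : cmul (iota b) (iota b') = cone /\ cmul (iota b') (iota b) = cone.
  by split; [move/(congr1 iota): bb'|move/(congr1 iota): b'b]; rewrite !of_svK.
have rb0 : 0 < renorm (iota b') + 1 by rewrite ltr_wpDl // renorm_ge0.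
have r0 : 0 < (renorm (iota b') + 1)^-1 by rewrite invr_gt0.
apply: filterS (near_pnorm 0 b r0) => a /(_ 0%N (leqnn 0)).
rewrite pnorm0E; last exact: iotaP.
rewrite raddfB => ab.
have [|a' [aa' a'a]] := @unit_near R A (iota b) (iota b') (iota a) ibb' ib'b.
  apply: (@le_lt_trans _ _ (renorm (iota a - iota b) * (renorm (iota b') + 1))).
    by rewrite ler_wpM2l ?renorm_ge0 // lerDl.
  by rewrite -ltr_pdivlMr // div1r.
exact: (sv_unitsP aa' a'a).
Qed.

(* The derivatives of an inverse are polynomials in the inverse and in the
   derivatives of the element, so their bounds are obtained recursively. *)
Lemma pnorm_inverse_le n (M M' : R) : 0 < M -> 0 < M' ->
  exists2 K : R, 0 < K & forall a a', sv a -> cmul a a' = cone -> cmul a' a = cone ->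
    renorm a' <= M -> (forall k : nat, (k <= n)%N -> pnorm k a <= M') ->
    forall k : nat, (k <= n)%N -> pnorm k a' <= K.
Proof.
move=> M0 M'0; elim: n => [|n [K K0 KP]].
  exists M => // a a' a_sv aa' a'a a'M aM' k; rewrite leqn0 => /eqP->.
  by rewrite pnorm0E //; exact: sv_inverse a_sv aa' a'a.
(* The bound of [pnorm_mul3] for - a' (dpi x a) a': [K] for the inverse up to order [n], and [M']
   for [dpi x a], which uses the orders of [a] up to [n.+1]. *)
pose K' := 2 ^+ n * (2 ^+ n * (K * M') * K).
exists (Num.max K K'); first by rewrite lt_max K0.
move=> a a' a_sv aa' a'a a'M aM' k.
have a'_sv := sv_inverse a_sv aa' a'a.
have a'K := KP a a' a_sv aa' a'a a'M (fun (j : nat) jn => aM' j (leqW jn)).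
rewrite leq_eqVlt => /orP[/eqP->|kn]; last by rewrite le_max a'K.
rewrite le_max; apply/orP; right.
apply: pnorm_le => // xs; case/lastP: xs => [[//]|xs x] [xs_n xs1].
move: xs_n xs1; rewrite size_rcons all_rcons => -[xs_n] /andP[x1 xs1].
rewrite /dpis foldr_rcons (dpi_inverse x a_sv aa' a'a) -/(dpis xs _).
have sv1 := sv_cmul (sv_cmul a'_sv (sv_dpi x a_sv)) a'_sv.
have -> : dpis xs (- cmul (cmul a' (dpi x a)) a') = - dpis xs (cmul (cmul a' (dpi x a)) a').
  by rewrite -scaleN1r dpis_scale // scaleN1r.
rewrite renormN; have xsP : directions n 1 xs by [].
apply: le_trans (pnorm_ub sv1 xsP) _.
apply: pnorm_mul3 => //; first exact: sv_dpi.
move=> j jn; apply: le_trans (pnorm_dpi _ _ a_sv) _.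
apply: le_trans (aM' j.+1 jn).
by rewrite ler_piMl // pnorm_ge0.
Qed.

Lemma sv_continuous_inverse : is_continuous_inverse_algebra sv_mul sv_one.
Proof.
split; first exact: open_sv_units.
have [inv invP] : exists inv : sv_space -> sv_space, forall b : sv_space, sv_units b ->
    sv_mul b (inv b) = sv_one /\ sv_mul (inv b) b = sv_one.
  have ex_inv (b : sv_space) : exists b' : sv_space, sv_units b ->
      sv_mul b b' = sv_one /\ sv_mul b' b = sv_one.
    by have [[b' b'P]|nb] := pselect (sv_units b); [exists b'|exists b].
  by have [inv invP] := choice ex_inv; exists inv.
exists inv => //.
rewrite continuous_open_subspace; last exact: open_sv_units.
move=> b0 /[!inE] b0_unit; apply/(@sv_cvgP _ (nbhs b0) (nbhs_filter b0) inv) => n e e0.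
have invE (b : sv_space) : sv_units b ->
    cmul (iota b) (iota (inv b)) = cone /\ cmul (iota (inv b)) (iota b) = cone.
  move=> /invP[e1 e2].
  by split; [move/(congr1 iota): e1|move/(congr1 iota): e2]; rewrite !of_svK.
have [bb0 b0b] := invE b0 b0_unit.
have [Mb Mb0 bM] := pnorm_bound_le n (iotaP b0).
have [Mi Mi0 iM] := pnorm_bound_le n (iotaP (inv b0)).
pose M := 2 * renorm (iota (inv b0)) + 1.
have M0 : 0 < M by rewrite ltr_wpDl // mulr_ge0 // renorm_ge0.
have Mb10 : 0 < Mb + 1 by rewrite ltr_wpDl // ltW.
have [K K0 KP] := pnorm_inverse_le n M0 Mb10.
pose L := 2 ^+ n * (2 ^+ n * K * Mi).
have L0 : 0 < L by rewrite !mulr_gt0 // exprn_gt0.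
(* The three bounds serve to control [b] by [Mb + 1], to keep the norm of its inverse below [M] by
   [renorm_inverse], and to make the final estimate [r * L] at most [e / 2]. *)
pose r := Num.min 1 (Num.min (2^-1 / M) (e / 2 / L)).
have r0 : 0 < r by rewrite !lt_min ltr01 /= !divr_gt0.
have units_b0 : nbhs b0 sv_units by exact: open_sv_units.
apply: filterS2 units_b0 (near_pnorm n b0 r0) => b b_unit br.
have [bb' b'b] := invE b b_unit.
have r1 : r <= 1 by rewrite ge_min lexx.
have bM1 (k : nat) : (k <= n)%N -> pnorm k (iota b) <= Mb + 1.
  move=> kn; apply: (pnorm_sub_lt (iotaP b) (iotaP b0)); first exact: bM.
  by rewrite -raddfB (le_trans (ltW (br k kn))).
have invM : renorm (iota (inv b)) <= M.
  apply: (@le_trans _ _ (2 * renorm (iota (inv b0)))); last by rewrite lerDl.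
  apply: (renorm_inverse bb0 b0b bb').
  apply: (@le_trans _ _ (r * M)).
    apply: ler_pM; rewrite ?renorm_ge0 //.
      by have := br 0%N isT; rewrite pnorm0E ?raddfB; [exact: ltW|exact: (iotaP (b - b0))].
    by rewrite /M; have := renorm_ge0 (iota (inv b0)); lra.
  by rewrite -ler_pdivlMr // !ge_min lexx orbT.
have invK := KP _ _ (iotaP b) bb' b'b invM bM1.
have -> : iota (inv b) - iota (inv b0) =
    cmul (cmul (iota (inv b)) (iota (b0 - b))) (iota (inv b0)).
  by rewrite raddfB cmulBr cmulBl b'b cmul1a -cmulA bb0 cmula1.
have br' (k : nat) : (k <= n)%N -> pnorm k (iota (b0 - b)) <= r.
  move=> kn; have -> : iota (b0 - b) = - iota (b - b0) by rewrite -raddfN opprB.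
  by rewrite pnormN ?ltW ?br //; exact: (iotaP (b - b0)).
apply: le_lt_trans (pnorm_mul3 (iotaP _) (iotaP _) (iotaP _) invK br' iM) _.
have -> : 2 ^+ n * (2 ^+ n * (K * r) * Mi) = r * L by rewrite /L; ring.
apply: (@le_lt_trans _ _ (e / 2)); last by rewrite ltr_pdivrMr // ltr_pMr // ltr1n.
by rewrite -ler_pdivlMr // !ge_min lexx !orbT.
Qed.

Lemma sv_frechet : is_frechet sv_space.
Proof.
split; [exact: sv_hausdorff|exact: sv_nbhs_basis|].
by move=> F FF F_cauchy; exact: (@sv_complete F FF F_cauchy).
Qed.

Lemma sv_star_subalgebra : is_star_subalgebra sv.
Proof.
by split; [exact: sv_cone|move=> k a b; exact: sv_linear|exact: sv_cmul|exact: sv_star].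
Qed.

Definition sv_iota : {linear sv_space -> A} := iota.

Lemma sv_smooth_vector_space : is_smooth_vector_space AG alpha expG N sv_iota.
Proof.
split=> [|| b W]; first exact: iota_inj.
  rewrite eqEsubset; split=> [_ [b _ <-]|a a_sv]; first exact: iotaP.
  by exists (of_sv a_sv).
rewrite sv_nbhsP; split=> -[n [e [e0 eW]]]; exists n, e; split=> // b' bb';
  apply: eW => k kn.
  by rewrite -lte_fin -smooth_seminormE ?bb' //; exact: (iotaP (b' - b)).
by rewrite smooth_seminormE ?lte_fin ?bb' //; exact: (iotaP (b' - b)).
Qed.

End NaturalSeminorms.
End SmoothVectors.

Theorem theorem6p2 (R : realType) (E : completeNormedModType R)
    (G : preTopologicalGroupType) (AG : set (chart G E))
    (A : unitalCstarAlgType R) (alpha : G -> A -> A)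
    (c : chart G E) (expG : E -> G) (N : E -> R)
    (G_lie : is_banach_lie_group AG)
    (alpha_sys : is_cstar_dynamical_system alpha)
    (c1 : chart_at1 AG c)
    (expG_exp : is_exponential AG c expG)
    (N_norm : is_lie_norm c N) :
  is_star_subalgebra (smooth_vectors AG alpha) /\
  exists (B : tvsType R[i]) (iota : {linear B -> A})
         (oneB : B) (mulB : B -> B -> B) (starB : B -> B) (act : G -> B -> B),
    [/\ is_smooth_vector_space AG alpha expG N iota /\ is_frechet B,
        [/\ iota oneB = cone,
            forall a b, iota (mulB a b) = cmul (iota a) (iota b),
            forall b, iota (starB b) = star (iota b)
          & forall g b, iota (act g b) = alpha g (iota b)],
        continuous (fun p : B * B => mulB p.1 p.2) /\ continuous starB,
        smooth_map (prod_atlas AG (@flat_atlas (realified R B)))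
                   (@flat_atlas (realified R B))
                   (fun p : G * realified R B => act p.1 p.2)
      & is_continuous_inverse_algebra mulB oneB].
Proof.
split; first exact: sv_star_subalgebra G_lie alpha_sys.
exists (sv_space G_lie alpha_sys c1 expG_exp N_norm), (sv_iota _ _ _ _ _).
exists (sv_one _ _ _ _ _), (@sv_mul _ _ _ _ _ _ _ _ _ _ _ _ _ _).
exists (@sv_adj _ _ _ _ _ _ _ _ _ _ _ _ _ _), (@act _ _ _ _ _ _ _ _ _ _ _ _ _ _).
split.
- split; [exact: sv_smooth_vector_space|exact: sv_frechet].
- by split.
- split; [exact: sv_mul_continuous|exact: sv_adj_continuous].
- exact: act_smooth.
- exact: sv_continuous_inverse.
Qed.
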